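(* Let $p\in\mathbb{R}[x_0,x_1,\ldots,x_n]$ be a homogeneous polynomial, hyperbolic with respect to a point $e\in\mathbb{R}^{n+1}$, let $C\subset\mathbb{R}^{n+1}$ be its (closed) hyperbolicity cone, and suppose that $C$ is a proper cone. Then for every proper face $F\neq\{0\}$ of $C$, either there is exactly one open patch $P$ of $C$ with $\operatorname{relint}F\subset\pi_1(P)$, or there is no open patch $P$ of $C$ such that $\pi_1(P)$ intersects $F$.
   Context: A homogeneous polynomial $p\in\mathbb{R}[x_0,\ldots,x_n]$ is hyperbolic with respect to $e\in\mathbb{R}^{n+1}$ if $p(e)\ne0$ and for every $x\in\mathbb{R}^{n+1}$ the univariate polynomial $p(x+te)\in\mathbb{R}[t]$ has only real roots. Its (closed) hyperbolicity cone is the closure of the connected component of $e$ in $\mathbb{R}^{n+1}\setminus\{p=0\}$; it is a convex cone. A proper cone is a closed convex cone with tip at the origin, with non-empty interior and containing no line. A proper face of $C$ is a face different from $C$. The dual cone is $C^\vee=\{\ell\in(\mathbb{R}^{n+1})^* : \ell(x)\ge0\text{ for all }x\in C\}$. Cones in $\mathbb{R}^{n+1}$ (such as $C$, $\partial C$, $F$, $\operatorname{relint}F$) are also regarded as subsets of $\mathbb{P}^n(\mathbb{R})$ via their non-zero points; similarly $C^\vee,\partial C^\vee\subset\mathbb{P}^n(\mathbb{R})^*$. $\mathbb{P}^n$ is complex projective $n$-space. A real projective variety is the zero set in $\mathbb{P}^n$ of real homogeneous polynomials; Zariski closures and irreducible components are taken with respect to real varieties. $X_{\rm reg}$ is the regular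 locus of $X$ and $\mathbb{T}_x(X)$ the projective tangent space at $x\in X_{\rm reg}$. The algebraic boundary $\partial_a C$ is the Zariski closure of $\partial C$ in $\mathbb{P}^n$. The conormal variety $\mathrm{CN}(X)$ is the Zariski closure of $\{(x,\ell)\in\mathbb{P}^n\times(\mathbb{P}^n)^* : x\in X_{\rm reg},\ \ell\equiv0\text{ on }\mathbb{T}_x(X)\}$, the dual variety $X^*$ is its image in $(\mathbb{P}^n)^*$, and $\mathrm{CN}_{\rm bireg}(X)=\{(x,\ell)\in\mathrm{CN}(X) : x\in X_{\rm reg},\ \ell\in(X^* )_{\rm reg}\}$. The (conic) normal cycle is $\mathcal{N}_+(C)=\{(x,\ell)\in\partial C\times\partial C^\vee : \ell(x)=0\}\subset\mathbb{P}^n(\mathbb{R})\times\mathbb{P}^n(\mathbb{R})^*$. For an irreducible component $Y$ of $\partial_a C$, a patch (also called open patch) of $C$ over $Y$ is a connected component of the set of pairs $(x,\ell)\in\mathcal{N}_+(C)\cap\mathrm{CN}_{\rm bireg}(Y)$ such that $x$ lies on no irreducible component of $\partial_a C$ other than $Y$. An open patch of $C$ is a patch over some irreducible component. $\pi_1$ is the projection to the first factor. *)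

(* Defs.v *)
From HB Require Import structures.
(* The notations of mpoly clash with those of MathComp-Analysis, and some of its
   names (such as symmetric) with those of MathComp: hence this import order. *)
From mathcomp Require mpoly.
Import -(notations) mpoly.
From mathcomp Require Import all_boot all_order all_algebra.
From mathcomp Require Import all_classical all_reals all_analysis.
From mathcomp Require Import generic_quotient complex.

Set Implicit Arguments.
Unset Strict Implicit.
Unset Printing Implicit Defensive.

Import Order.TTheory GRing.Theory Num.Theory.
Import numFieldNormedType.Exports.

Local Open Scope quotient_scope.
Local Open Scope complex_scope.
Local Open Scope classical_set_scope.
Local Open Scope ring_scope.

(* Points of P^n(K) are classes of non-zero row vectors of length n+1; two such
   vectors are equivalent when they span the same line.  Linear forms are also
   encoded by their coefficient vectors, so (P^n)^* is again [projspace K n]. *)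

Definition nzvec (K : fieldType) (n : nat) := {v : 'rV[K]_n.+1 | v != 0}.

HB.instance Definition _ (K : fieldType) (n : nat) := Choice.on (nzvec K n).

Definition same_line (K : fieldType) (n : nat) (u v : nzvec K n) : bool :=
  (val u == val v)%MS.

Lemma same_line_refl K n : reflexive (@same_line K n).
Proof. by move=> u; rewrite /same_line submx_refl. Qed.

Lemma same_line_sym K n : symmetric (@same_line K n).
Proof. by move=> u v; rewrite /same_line andbC. Qed.

Lemma same_line_trans K n : transitive (@same_line K n).
Proof.
move=> v u w /andP[uv vu] /andP[vw wv].
by rewrite /same_line (submx_trans uv vw) (submx_trans wv vu).
Qed.

Canonical same_line_equiv (K : fieldType) (n : nat) :=
  EquivRel (@same_line K n) (@same_line_refl K n)
    (@same_line_sym K n) (@same_line_trans K n).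

Definition projspace (K : fieldType) (n : nat) := {eq_quot @same_line_equiv K n}.

HB.instance Definition _ (K : fieldType) (n : nat) :=
  Quotient.on (projspace K n).

Definition proj_of (K : fieldType) (n : nat) (v : nzvec K n) : projspace K n :=
  \pi_(projspace K n) v.

Definition vec_of (K : fieldType) (n : nat) (x : projspace K n) : 'rV[K]_n.+1 :=
  val (repr x).

(* A set of vectors regarded as a set of points of P^n, via its non-zero
   elements. *)
Definition proj_set (K : fieldType) (n : nat) (A : set 'rV[K]_n.+1) :
    set (projspace K n) :=
  [set x | exists2 v : nzvec K n, A (val v) & x = proj_of v].

(* The Euclidean topology on P^n(R): the quotient of the subspace topology. *)
HB.instance Definition _ (R : realType) (n : nat) :=
  Topological.copy (nzvec R n)
    (initial_topology (val : nzvec R n -> 'rV[R]_n.+1)).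

HB.instance Definition _ (R : realType) (n : nat) :=
  Topological.copy (projspace R n) (quotient_topology (projspace R n)).

Lemma complexify_neq0 (R : realType) (n : nat) (v : nzvec R n) :
  map_mx (real_complex R) (val v) != 0.
Proof. by rewrite map_mx_eq0 (valP v). Qed.

Definition complexify (R : realType) (n : nat) (x : projspace R n) :
    projspace R[i] n :=
  proj_of (exist (fun v : 'rV_n.+1 => is_true (v != 0)) _
             (complexify_neq0 (repr x))).

Definition pairing (K : fieldType) (n : nat) (l v : 'rV[K]_n.+1) : K :=
  \sum_(i < n.+1) l 0 i * v 0 i.

Definition rpoly (R : realType) (n : nat) := mpoly n R.

Definition homogeneous (R : realType) (n : nat) (p : rpoly R n) : Prop :=
  exists d : nat, p \is ishomog1 d mdeg.

Definition reval (R : realType) (n : nat) (p : rpoly R n) (x : 'rV[R]_n) : R :=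
  meval (fun i => x 0 i) p.

(* The polynomial p(x + t e) in the variable t. *)
Definition along_line (R : realType) (n : nat) (p : rpoly R n)
    (x e : 'rV[R]_n) : {poly R} :=
  mmap polyC (fun i => (x 0 i)%:P + (e 0 i) *: 'X) p.

Definition hyperbolic (R : realType) (n : nat) (p : rpoly R n)
    (e : 'rV[R]_n) : Prop :=
  reval p e != 0 /\
  forall (x : 'rV[R]_n) (z : R[i]),
    root (map_poly (real_complex R) (along_line p x e)) z ->
    exists t : R, z = t%:C.

Definition hyperbolicity_cone (R : realType) (n : nat)
    (p : rpoly R n.+1) (e : 'rV[R]_n.+1) : set 'rV[R]_n.+1 :=
  closure (connected_component [set x | reval p x != 0] e).

Section Cones.
Variables (R : realType) (n : nat).
Local Notation V := 'rV[R]_n.+1.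
Implicit Types C F A : set V.

Definition convex_cone C : Prop :=
  [/\ C 0, convex_set C & forall (a : R) (x : V), 0 <= a -> C x -> C (a *: x)].

Definition proper_cone C : Prop :=
  [/\ closed C, convex_cone C, C° !=set0 &
      ~ exists x v : V, v != 0 /\ forall t : R, C (x + t *: v)].

Definition face C F : Prop :=
  [/\ F !=set0, F `<=` C, convex_set F &
      forall (x y : V) (t : R), C x -> C y -> 0 < t < 1 ->
        F (t *: x + (1 - t) *: y) -> F x /\ F y].

Definition proper_face C F : Prop := face C F /\ F <> C.

Definition affine_subspace A : Prop :=
  forall (x y : V) (t : R), A x -> A y -> A (t *: x + (1 - t) *: y).

Definition affine_hull A : set V :=
  \bigcap_(L in [set L | affine_subspace L /\ A `<=` L]) L.

Definition relint A : set V :=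
  [set x | A x /\ \forall y \near x, affine_hull A y -> A y].

Definition boundary A : set V := closure A `\` A°.

Definition dual_cone C : set V :=
  [set l | forall x, C x -> 0 <= pairing l x].

Definition normal_cycle C : set (projspace R n * projspace R n) :=
  [set xl | [/\ proj_set (boundary C) xl.1,
                proj_set (boundary (dual_cone C)) xl.2 &
                pairing (vec_of xl.2) (vec_of xl.1) = 0]].

End Cones.

(* Closures for the topology whose closed sets are those satisfying [closedP]. *)
Definition closure_for (T : Type) (closedP : set (set T)) (A : set T) : set T :=
  \bigcap_(V in [set V | closedP V /\ A `<=` V]) V.

Section Varieties.
Variables (R : realType) (n : nat).
Local Notation PC := (projspace R[i] n).
Implicit Types X Y Z : set PC.

Definition ceval (m : nat) (f : rpoly R m) (z : 'rV[R[i]]_m) : R[i] :=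
  meval (fun i => z 0 i) (map_mpoly (real_complex R) f).

Definition real_variety X : Prop :=
  exists2 S : set (rpoly R n.+1), (forall f, S f -> homogeneous f) &
    X = [set x | forall f, S f -> ceval f (vec_of x) = 0].

Definition zariski_closure (A : set PC) : set PC := closure_for real_variety A.

Definition irreducible_variety X : Prop :=
  [/\ real_variety X, X !=set0 &
      forall Y Z, real_variety Y -> real_variety Z ->
        X = Y `|` Z -> X = Y \/ X = Z].

Definition irreducible_component X Y : Prop :=
  [/\ irreducible_variety Y, Y `<=` X &
      forall Z, irreducible_variety Z -> Z `<=` X -> Y `<=` Z -> Z = Y].

(* W 0 < ... < W d are irreducible subvarieties of X. *)
Definition variety_chain X (d : nat) (W : nat -> set PC) : Prop :=
  (forall i, (i <= d)%N -> irreducible_variety (W i) /\ W i `<=` X) /\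
  (forall i, (i < d)%N -> W i `<` W i.+1).

Definition has_dimension X (d : nat) : Prop :=
  (exists W, variety_chain X d W) /\
  (forall m W, variety_chain X m W -> (m <= d)%N).

(* The dimension of X at x is the largest dimension of an irreducible component
   of X through x. *)
Definition has_local_dimension X (x : PC) (d : nat) : Prop :=
  (exists Z, [/\ irreducible_component X Z, Z x & has_dimension Z d]) /\
  (forall Z m, irreducible_component X Z -> Z x -> has_dimension Z m ->
     (m <= d)%N).

(* The linear subspace of C^(n+1) whose projectivization is the projective
   (Zariski) tangent space of X at x. *)
Definition tangent_space X (x : PC) : set 'rV[R[i]]_n.+1 :=
  [set v | forall f : rpoly R n.+1, homogeneous f ->
     (forall y, X y -> ceval f (vec_of y) = 0) ->
     \sum_(i < n.+1) ceval (mderiv i f) (vec_of x) * v 0 i = 0].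

Definition regular_locus X : set PC :=
  [set x | X x /\ exists d : nat, has_local_dimension X x d /\
     exists2 U : {vspace 'rV[R[i]]_n.+1},
       [set` U] = tangent_space X x & \dim U = d.+1].

(* In a polynomial in n+1+(n+1) variables, the first n+1 are coordinates on P^n
   and the last n+1 are coordinates on (P^n)^*. *)
Definition bihomogeneous (f : rpoly R (n.+1 + n.+1)) : Prop :=
  exists d e : nat, forall m : multinom (n.+1 + n.+1), m \in msupp f ->
    (\sum_(i < n.+1) m (lshift n.+1 i))%N = d /\
    (\sum_(i < n.+1) m (rshift n.+1 i))%N = e.

Definition real_bivariety (W : set (PC * PC)) : Prop :=
  exists2 S : set (rpoly R (n.+1 + n.+1)), (forall f, S f -> bihomogeneous f) &
    W = [set xl | forall f, S f ->
                    ceval f (row_mx (vec_of xl.1) (vec_of xl.2)) = 0].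

Definition conormal_variety X : set (PC * PC) :=
  closure_for real_bivariety
    [set xl | regular_locus X xl.1 /\
              forall v, tangent_space X xl.1 v -> pairing (vec_of xl.2) v = 0].

Definition dual_variety X : set PC := snd @` conormal_variety X.

Definition conormal_bireg X : set (PC * PC) :=
  [set xl | [/\ conormal_variety X xl, regular_locus X xl.1 &
                regular_locus (dual_variety X) xl.2]].

End Varieties.

Section Patches.
Variables (R : realType) (n : nat).
Implicit Types (C : set 'rV[R]_n.+1) (P : set (projspace R n * projspace R n)).

Definition algebraic_boundary C : set (projspace R[i] n) :=
  zariski_closure (@complexify R n @` proj_set (boundary C)).

(* The set whose connected components are the patches of C over Y. *)
Definition patch_locus C (Y : set (projspace R[i] n)) :
    set (projspace R n * projspace R n) :=
  [set xl | [/\ normal_cycle C xl,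
                conormal_bireg Y (complexify xl.1, complexify xl.2) &
                forall Z, irreducible_component (algebraic_boundary C) Z ->
                  Z (complexify xl.1) -> Z = Y]].

Definition patch_over C Y P : Prop :=
  exists2 xl, patch_locus C Y xl &
    P = connected_component (patch_locus C Y) xl.

Definition open_patch C P : Prop :=
  exists2 Y, irreducible_component (algebraic_boundary C) Y & patch_over C Y P.

End Patches.

(* Main.v *)
(* If [l] is dual to a regular point [x] of the cone [C] lying on a single
   component [f = 0] of the algebraic boundary, then [l] is the gradient of [f]
   at [x], up to a factor: the boundary of [C] is a graph in the direction [e],
   so that the gradient spans all functionals which are nonnegative on [C] and
   vanish at [x].  Let [y = t x + z] with [t > 0] and [z] in a proper face
   through [x].  The boundary polynomial vanishes on the ray [x + s z], hence so
   does [f]; by Garding's theorem the derivative of the boundary polynomial in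
   the direction [e] cannot drop to zero from [t x] to [y], and since its
   gradient at [y] vanishes at [x], the two gradients are proportional.  So [y]
   is again a point of the patch locus, with the same [l], and a path from [x]
   to [y] keeps both in the same patch.  Points of the relative interior of a
   face have this form for every [x] in the face.
   The equation of the algebraic boundary is the product of a minimal set of
   prime factors of [p] vanishing on the boundary of [C]; by a resultant-like
   Bezout identity, it generates the ideal of the boundary. *)

From mathcomp Require mpoly.
Import -(notations) mpoly.
Require Import Defs.
From mathcomp Require Import all_boot all_order all_algebra.
From mathcomp Require Import all_classical all_reals all_analysis.
From mathcomp Require Import generic_quotient complex zify ring lra.

Set Implicit Arguments.
Unset Strict Implicit.
Unset Printing Implicit Defensive.

Import Order.TTheory GRing.Theory Num.Theory.
Import numFieldNormedType.Exports.

Local Open Scope complex_scope.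
Local Open Scope classical_set_scope.
Local Open Scope ring_scope.

(** * Factorial domains *)

Section Factorial.
Implicit Type D : idomainType.

(** A form that vanishes at the real zeros of a real polynomial need not be a multiple of it. Here
    divisibility holds because the boundary projects onto a hyperplane along [e]: a nonzero
    polynomial that is constant along [e] is nonzero at boundary points arbitrarily close to any
    given one, and can be cancelled. This is why the Bezout identity is taken for polynomials in one
    variable along [e], over a factorial ring of coefficients.

    Roots are never followed continuously. A form on a complex line is the product of its value in
    the direction and of the distances to its roots, and the resulting lower bound survives limits.

    Regularity compares the tangent space with the local dimension. A vanishing gradient would make
    the tangent space everything, so an upper bound on the dimension of a hypersurface suffices to
    exclude it.

    Uniqueness: two patches over the relative interior of the face have points over the same [x].
    The component is the only one through [x], and the functional is the gradient up to a factor, so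
    the patches share a point. *)

Definition rdvd D (a b : D) : Prop := exists c, b = c * a.

Definition prime_elt D (x : D) : Prop :=
  [/\ x != 0, x \isn't a GRing.unit &
      forall a b, rdvd x (a * b) -> rdvd x a \/ rdvd x b].

Definition has_factorization D (x : D) := exists u (s : seq D),
  [/\ u \is a GRing.unit, forall y, y \in s -> prime_elt y &
      x = u * \prod_(y <- s) y].

Definition factorial_domain D : Prop :=
  forall x : D, x != 0 -> has_factorization x.

Lemma rdvd_refl D (a : D) : rdvd a a.
Proof. by exists 1; rewrite mul1r. Qed.

Lemma rdvd_mull D (a b c : D) : rdvd a b -> rdvd a (c * b).
Proof. by case=> d ->; exists (c * d); rewrite mulrA. Qed.

Lemma rdvd_mulr D (a b c : D) : rdvd a b -> rdvd a (b * c).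
Proof. by rewrite mulrC; exact: rdvd_mull. Qed.

Lemma rdvd_trans D (a b c : D) : rdvd a b -> rdvd b c -> rdvd a c.
Proof. by move=> ab [d ->]; exact: rdvd_mull. Qed.

Lemma rdvdD D (a b c : D) : rdvd a b -> rdvd a c -> rdvd a (b + c).
Proof. by case=> d -> [f ->]; exists (d + f); rewrite mulrDl. Qed.

Lemma rdvd_unit D (a u : D) : u \is a GRing.unit -> rdvd a u ->
  a \is a GRing.unit.
Proof.
by move=> uU [c uE]; move: uU; rewrite uE unitrM => /andP[].
Qed.

Lemma rdvd_prime D (a b : D) :
  prime_elt a -> prime_elt b -> rdvd a b -> rdvd b a.
Proof.
move=> [a0 aU aP] [b0 bU bP] [c bE].
have [|[d cE]|//] := bP c a; first by rewrite -bE; exact: rdvd_refl.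
have : b * 1 = b * (d * a) by rewrite mulr1 mulrA [b * d]mulrC -cE -bE.
by move/(mulfI b0) => E; case/negP: aU; apply: (@rdvd_unit _ _ 1); rewrite ?unitr1//; exists d.
Qed.

Lemma prime_dvd_prod D (x : D) (s : seq D) : prime_elt x ->
  rdvd x (\prod_(y <- s) y) -> exists2 y, y \in s & rdvd x y.
Proof.
move=> [x0 xU xP]; elim: s => [|y s IHs].
  rewrite big_nil => x1; case/negP: xU; exact: rdvd_unit (unitr1 _) x1.
rewrite big_cons => /xP[xy|/IHs[z zs xz]].
  by exists y; rewrite ?mem_head.
by exists z; rewrite // in_cons zs orbT.
Qed.

Lemma nonunit_prime_dvd D (x : D) : factorial_domain D -> x != 0 ->
  x \isn't a GRing.unit -> exists2 y, prime_elt y & rdvd y x.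
Proof.
move=> fD /fD[u [[|y s] [uU sP ->]]].
  by rewrite big_nil mulr1 uU.
move=> _; exists y; first by apply: sP; rewrite mem_head.
by rewrite big_cons mulrCA; apply: rdvd_mulr; exact: rdvd_refl.
Qed.

(** Gauss's argument: if [x] divides neither factor, take in each the lowest coefficient not
    divisible by [x]. At the sum of the two indices, the coefficient of the product is the product
    of these two plus multiples of [x]. *)
Lemma prime_polyC D (x : D) : prime_elt x -> prime_elt x%:P.
Proof.
move=> [x0 xU xP]; split; first by rewrite polyC_eq0.
  by rewrite poly_unitE coefC eqxx negb_and xU orbT.
have dvdP (f : {poly D}) : rdvd x%:P f <-> forall i, rdvd x f`_i.
  split=> [[g ->] i|H]; first by rewrite coefMC; apply: rdvd_mull (rdvd_refl _).
  have [g gE] := choice H.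
  exists (\poly_(i < size f) g i); apply/polyP => i.
  rewrite coefMC coef_poly; case: ltnP => [_|/leq_sizeP ->//]; first exact: gE.
  by rewrite mul0r.
have nP (f : {poly D}) : ~ rdvd x%:P f -> exists i, ~ rdvd x f`_i /\
    forall j, (j < i)%N -> rdvd x f`_j.
  move=> nf.
  have /existsNP[i0 ni0] : ~ forall i, rdvd x f`_i by move=> /dvdP.
  have ex : exists i, `[< ~ rdvd x f`_i >] by exists i0; apply/asboolP.
  case: (ex_minnP ex) => i /asboolP ni imin; exists i; split=> // j ji.
  apply: contrapT => nj.
  by have := imin j; rewrite leqNgt ji => /(_ (asboolT nj)).
move=> f g fg; apply: contrapT => /not_orP[/nP[i [ni li]] /nP[j [nj lj]]].
move/dvdP: fg => /(_ (i + j)%N).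
rewrite coefM.
have ij : (i < (i + j).+1)%N by rewrite ltnS leq_addr.
rewrite (bigD1 (Ordinal ij)) //= addKn; set S := (X in _ + X) => H.
have {H} : rdvd x (f`_i * g`_j).
  have -> : f`_i * g`_j = (f`_i * g`_j + S) + (-1) * S by rewrite mulN1r addrK.
  apply: rdvdD => //; apply: rdvd_mull; rewrite /S.
  elim/big_ind: _ => [|a b|k ki]; first by exists 0; rewrite mul0r.
    exact: rdvdD.
  case: (ltngtP k i) => [ki'|ik|ki']; first exact: rdvd_mulr (li _ _).
    by apply/rdvd_mull/lj; rewrite ltn_subLR ?ltn_add2r // -ltnS.
  by case/negP: ki; apply/eqP/val_inj.
by case/xP.
Qed.

(* Dividing out, one prime at a time, the primes of [s] which occur in the
   left-hand side of [c f = r w]. *)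
Lemma strip_primes D (f r w : {poly D}) (u : D) (s : seq D) :
  u \is a GRing.unit -> (forall y, y \in s -> prime_elt y) ->
  (u * \prod_(y <- s) y)%:P * f = r * w ->
  exists r' w' : {poly D}, [/\ f = r' * w', size r' = size r, size w' = size w &
    rdvd r' r].
Proof.
move=> uU; elim: s r w => [|y s IHs] r w sP.
  rewrite big_nil mulr1 => E; exists r, (u^-1 *: w).
  have u0 : u^-1 != 0 by apply: contraTneq (uU) => u0; rewrite -unitrV u0 unitr0.
  split=> //; last exact: rdvd_refl.
    by rewrite -scalerAr -E mul_polyC scalerA mulVr // scale1r.
  by rewrite size_scale.
have yp : prime_elt y by apply: sP; rewrite mem_head.
have sP' z : z \in s -> prime_elt z by move=> zs; apply: sP; rewrite in_cons zs orbT.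
have y0 : y != 0 by case: yp.
have y0P : y%:P != 0 by rewrite polyC_eq0.
rewrite big_cons mulrCA polyCM -mulrA => E.
have [_ _ yP] := prime_polyC yp.
have [|[r1 rE]|[w1 wE]] := yP r w.
- by rewrite -E mulrC; exact: rdvd_mull (rdvd_refl _).
- move: E; rewrite {1}rE mulrAC [RHS]mulrC => E.
  have [r' [w' [fE sr sw rr]]] := IHs _ _ sP' (mulfI y0P E).
  exists r', w'; split=> //.
    by rewrite sr rE mulrC size_Cmul.
  by rewrite rE; exact: rdvd_mulr.
- move: E; rewrite {1}wE [RHS]mulrA [RHS]mulrC => E.
  have [r' [w' [fE sr sw rr]]] := IHs _ _ sP' (mulfI y0P E).
  exists r', w'; split=> //.
  by rewrite sw wE mulrC size_Cmul.
Qed.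

(** A nonzero element of least size in the ideal is a gcd over the fraction field. Pseudo-division
    keeps the argument inside [{poly D}], at the price of the constants [c]: a nonzero remainder
    would be a smaller element of the ideal. *)
Lemma ideal_gcd D (f g : {poly D}) : f != 0 ->
  exists r : {poly D}, [/\ r != 0, exists a b, r = a * f + b * g,
    exists c w, c != 0 /\ c%:P * f = r * w &
    exists c w, c != 0 /\ c%:P * g = r * w].
Proof.
move=> f0.
pose P n := `[< exists r : {poly D}, [/\ r != 0, size r = n &
  exists a b, r = a * f + b * g] >].
have exP : exists n, P n.
  exists (size f); apply/asboolP; exists f; split=> //.
  by exists 1, 0; rewrite mul1r mul0r addr0.
case: (ex_minnP exP) => m /asboolP[r [r0 rm [a [b rE]]]] mmin.
have red (h : {poly D}) : (exists a' b', h = a' * f + b' * g) ->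
    exists c w, c != 0 /\ c%:P * h = r * w.
  move=> [a' [b' hE]]; exists (lead_coef r ^+ Pdiv.Idomain.scalp h r), (h %/ r).
  split; first by rewrite expf_neq0 // lead_coef_eq0.
  have E := Pdiv.Idomain.divp_eq h r.
  rewrite mul_polyC E mulrC -[RHS]addr0; congr (_ + _).
  apply: contrapT => /eqP h0.
  suff Pm : P (size (h %% r)).
    by have := mmin _ Pm; rewrite leqNgt -rm Pdiv.Idomain.ltn_modp r0.
  apply/asboolP; exists (h %% r); split=> //.
  set k := _ ^+ _ in E.
  exists (k%:P * a' - (h %/ r) * a), (k%:P * b' - (h %/ r) * b).
  have -> : h %% r = k%:P * h - (h %/ r) * r by rewrite mul_polyC E addrC addKr.
  rewrite hE {2}rE !mulrDl !mulrDr !mulNr !mulrA opprD.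
  by rewrite -!addrA; congr (_ + _); rewrite addrCA.
exists r; split=> //; first by exists a, b.
- by apply: red; exists 1, 0; rewrite mul1r mul0r addr0.
- by apply: red; exists 0, 1; rewrite mul1r mul0r add0r.
Qed.

(** Gauss's lemma: a factorization up to a constant comes from a true one with the same degrees. *)
Lemma strip_const D (f r w : {poly D}) (c : D) : factorial_domain D ->
  c != 0 -> c%:P * f = r * w ->
  exists r' w' : {poly D}, [/\ f = r' * w', size r' = size r, size w' = size w &
    rdvd r' r].
Proof.
by move=> fD /fD[u [s [uU sP ->]]]; exact: strip_primes.
Qed.

Lemma rdvd_size D (f g : {poly D}) : g != 0 -> rdvd f g -> (size f <= size g)%N.
Proof.
move=> g0 [c gE]; move: g0; rewrite gE mulf_eq0 negb_or => /andP[c0 f0].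
rewrite size_mul //; move: c0; rewrite -size_poly_gt0.
by case: (size c) => // k _; rewrite addSn leq_addl.
Qed.

(** The gcd [r] yields a factorization [f = r' * w'] with [r'] of the size of [r]. If [f] divides
    [r'], it divides a constant multiple of [g], hence [g]. If [f] divides [w'], there is no degree
    left for [r], which is then the wanted constant. *)
Lemma prime_bezout D (f g : {poly D}) : factorial_domain D -> prime_elt f ->
  ~ rdvd f g -> exists a b (c : D), c != 0 /\ c%:P = a * f + b * g.
Proof.
move=> fD fp nfg; have [f0 fU fP] := fp.
have [sf|sf] := leqP (size f) 1.
  have fE := size1_polyC sf; exists 1, 0, f`_0; rewrite mul1r mul0r addr0 -fE.
  by split=> //; rewrite -polyC_eq0 -fE.
have [r [r0 [a [b rE]] [c [w [c0 cf]]] [d [v [d0 dg]]]]] := ideal_gcd g f0.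
have [r' [w' [fE sr _ rr]]] := strip_const fD c0 cf.
have w'0 : w' != 0 by apply: contraNneq f0 => w0; rewrite fE w0 mulr0.
have r'0 : r' != 0 by apply: contraNneq f0 => w0; rewrite fE w0 mul0r.
have [fr|fw] : rdvd f r' \/ rdvd f w' by apply: fP; rewrite -fE; exact: rdvd_refl.
  have : rdvd f (d%:P * g) by rewrite dg; apply/rdvd_mulr/(rdvd_trans fr).
  case/fP => // /rdvd_size; rewrite polyC_eq0 => /(_ d0).
  by rewrite size_polyC d0 leqNgt sf.
have sr1 : (size r <= 1)%N.
  have := rdvd_size w'0 fw; rewrite fE size_mul // sr.
  rewrite -size_poly_gt0 in w'0.
  case: (size w') w'0 => // k _; rewrite addnS /= -[X in (_ <= X)%N -> _]add1n.
  by rewrite leq_add2r.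
have rC := size1_polyC sr1; exists a, b, r`_0; rewrite -rC; split=> //.
by rewrite -polyC_eq0 -rC.
Qed.

(** Either the gcd of [f] and [g] has full size, and [f] divides a constant multiple of [g], or it
    is a constant, and multiplying its Bezout identity by [h] shows that [f] divides a constant
    multiple of [h]. Primitivity removes the constant, prime by prime ([fcancel]). *)
Lemma primitive_irreducible_prime D (f : {poly D}) : factorial_domain D ->
  (1 < size f)%N -> (forall y, prime_elt y -> ~ rdvd y%:P f) ->
  (forall a b, f = a * b -> size a = size f \/ size b = size f) -> prime_elt f.
Proof.
move=> fD sf prim irr.
have f0 : f != 0 by rewrite -size_poly_gt0 (ltn_trans _ sf).
have const_unit a b : f = a * b -> size a = size f -> b \is a GRing.unit.
  move=> fE sa; have b0 : b != 0 by apply: contraNneq f0 => b0; rewrite fE b0 mulr0.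
  have a0 : a != 0 by apply: contraNneq f0 => a0; rewrite fE a0 mul0r.
  have sb : (size b <= 1)%N.
    have := congr1 (fun q : {poly D} => size q) fE; rewrite size_mul // -sa.
    move: a0 b0; rewrite -!size_poly_gt0; lia.
  have bC := size1_polyC sb; rewrite bC poly_unitE coefC eqxx.
  have bn0 : b`_0 != 0 by rewrite -polyC_eq0 -bC.
  rewrite size_polyC bn0 /=; apply: contrapT => /negP bU.
  have [y yp yb] := nonunit_prime_dvd fD bn0 bU; apply: (prim y yp).
  rewrite fE bC; apply: rdvd_mull; case: yb => c ->; exists c%:P.
  by rewrite polyCM.
have fU : f \isn't a GRing.unit by rewrite poly_unitE gtn_eqF.
have fcancel h (c : D) : c != 0 -> rdvd f (c%:P * h) -> rdvd f h.
  move=> /fD[u [s [uU sP ->]]]; elim: s sP => [|y s IHs] sP.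
    rewrite big_nil mulr1 => -[v E]; exists ((u^-1)%:P * v).
    by rewrite -mulrA -E mulrA -polyCM mulVr // mul1r.
  rewrite big_cons mulrCA polyCM -mulrA => -[v E].
  have yp : prime_elt y by apply: sP; rewrite mem_head.
  have y0P : y%:P != 0 by rewrite polyC_eq0; case: yp.
  have [_ _ yP] := prime_polyC yp.
  have [|[v' vE]|/(prim y yp)//] := yP v f.
    by rewrite -E mulrC; exact: rdvd_mull (rdvd_refl _).
  apply: IHs => [z zs|]; first by apply: sP; rewrite in_cons zs orbT.
  exists v'; apply: (mulfI y0P); rewrite E vE [v' * _]mulrC -mulrA //.
split=> // g h fgh; have [|nfg] := EM (rdvd f g); first by left.
right.
have [r [r0 [a [b rE]] [c [w [c0 cf]]] [d [v [d0 dg]]]]] := ideal_gcd g f0.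
have [r' [w' [fE sr _ rr]]] := strip_const fD c0 cf.
have [sr'|sw'] := irr _ _ fE.
  case: nfg; apply: (fcancel _ d d0); rewrite dg; apply: rdvd_mulr.
  apply: rdvd_trans rr; have wU := const_unit _ _ fE sr'.
  by exists w'^-1; rewrite fE mulrCA mulVr ?mulr1.
have rU : r' \is a GRing.unit by apply: (const_unit w'); rewrite // mulrC.
have sr1 : (size r <= 1)%N by rewrite -sr; move: rU; rewrite poly_unitE => /andP[/eqP->].
have rC := size1_polyC sr1.
apply: (fcancel _ r`_0); first by rewrite -polyC_eq0 -rC.
rewrite -rC rE mulrDl; apply: rdvdD.
  by rewrite mulrAC; exact: rdvd_mull (rdvd_refl _).
by rewrite -mulrA; exact: rdvd_mull.
Qed.

Lemma has_factorizationM D (x y : D) :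
  has_factorization x -> has_factorization y -> has_factorization (x * y).
Proof.
move=> [u [s [uU sP ->]]] [v [t [vU tP ->]]]; exists (u * v), (s ++ t); split.
- by rewrite unitrM uU.
- by move=> z; rewrite mem_cat => /orP[/sP|/tP].
- by rewrite big_cat mulrACA.
Qed.

Lemma prime_has_factorization D (x : D) : prime_elt x -> has_factorization x.
Proof.
move=> xp; exists 1, [:: x]; split; rewrite ?unitr1 ?big_seq1 ?mul1r //.
by move=> y; rewrite inE => /eqP->.
Qed.

(** Double induction. A factorization into smaller sizes lowers [n]. Pulling out a constant prime
    may keep the size of [f], but removes one prime from its leading coefficient, so the length [k]
    of a factorization of that coefficient drops. What remains is primitive and irreducible. *)
Lemma factorial_poly D : factorial_domain D -> factorial_domain {poly D}.
Proof.
move=> fD.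
suff H n k (f : {poly D}) u (s : seq D) : (size f <= n)%N -> f != 0 ->
    (size s <= k)%N -> u \is a GRing.unit -> (forall y, y \in s -> prime_elt y) ->
    lead_coef f = u * \prod_(y <- s) y -> has_factorization f.
  move=> f f0; have := fD (lead_coef f); rewrite lead_coef_eq0 => /(_ f0).
  by move=> [u [s [uU sP E]]]; exact: (H (size f) (size s) f u s).
elim: n k f u s => [|n IHn] k f u s.
  by rewrite leqn0 size_poly_eq0 => /eqP-> /eqP.
elim: k f u s => [|k IHk] f u s sf f0 sk uU sP lf.
all: have [sf1|sf1] := leqP (size f) 1.
1,3: rewrite (size1_polyC sf1); have [] := fD f`_0;
    [by rewrite -polyC_eq0 -(size1_polyC sf1)|];
    move=> v [t [vU tP ->]]; exists v%:P, (map polyC t); split;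
    [exact: (rmorph_unit polyC vU)
    |by move=> z /mapP[y /tP yp ->]; exact: prime_polyC
    |by rewrite polyCM big_map rmorph_prod].
all: have [[a [b [fE sa sb]]]|irr] := EM (exists a b : {poly D},
    [/\ f = a * b, (size a < size f)%N & (size b < size f)%N]).
1,3: have a0 : a != 0 by apply: contraNneq f0 => a0; rewrite fE a0 mul0r.
1,2: have b0 : b != 0 by apply: contraNneq f0 => b0; rewrite fE b0 mulr0.
1,2: have [|v [t [vU tP aE]]] := fD (lead_coef a); first by rewrite lead_coef_eq0.
1,2: have [|v' [t' [vU' tP' bE]]] := fD (lead_coef b); first by rewrite lead_coef_eq0.
1,2: rewrite fE; apply: has_factorizationM;
  [apply: (IHn (size t) _ v t) | apply: (IHn (size t') _ v' t')] => //;
  rewrite -ltnS; exact: leq_trans sf.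
all: have irr' (a b : {poly D}) : f = a * b -> size a = size f \/ size b = size f.
1,3: move=> fE; apply: contrapT => /not_orP[na nb]; apply: irr; exists a, b.
1,2: have a0 : a != 0 by apply: contraNneq f0 => a0; rewrite fE a0 mul0r.
1,2: have b0 : b != 0 by apply: contraNneq f0 => b0; rewrite fE b0 mulr0.
1,2: by split=> //; rewrite ltn_neqAle; apply/andP; split; try (exact/eqP);
  apply: rdvd_size => //; [exists b; rewrite mulrC|exists a].
all: have [[y [yp [g fE]]]|prim] := EM (exists y, prime_elt y /\ rdvd y%:P f).
2,4: apply/prime_has_factorization/primitive_irreducible_prime => // y yp yf;
   by apply: prim; exists y.
all: have y0 : y != 0 by case: yp.
all: have ys : rdvd y (\prod_(z <- s) z).
1,3: have [_ yU yP] := yp; have [|yu|//] := yP u (\prod_(z <- s) z);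
  [by rewrite -lf fE lead_coefM lead_coefC; exact: rdvd_mull (rdvd_refl _)
  |by case/negP: yU; exact: rdvd_unit yu].
all: have [z zs yz] := prime_dvd_prod yp ys.
  by move: sk; rewrite leqn0 => /nilP s0; rewrite s0 in zs.
rewrite fE; apply: has_factorizationM; last first.
  exact/prime_has_factorization/prime_polyC.
have [v' yE] := rdvd_prime yp (sP _ zs) yz.
case: yz => v zE.
have vU : v \is a GRing.unit.
  apply: (@rdvd_unit _ _ 1); rewrite ?unitr1 //; exists v'.
  by apply: (mulIf y0); rewrite mul1r -mulrA -zE.
apply: (IHk _ (u * v) (rem z s)).
- rewrite (leq_trans _ sf) //; apply: rdvd_size => //.
  by rewrite fE; exact: rdvd_mulr (rdvd_refl _).
- by apply: contraNneq f0 => g0; rewrite fE g0 mul0r.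
- rewrite size_rem // -ltnS prednK //; by case: (s) zs.
- by rewrite unitrM uU.
- by move=> x /mem_rem/sP.
- apply: (mulIf y0); move: lf; rewrite fE lead_coefM lead_coefC => ->.
  rewrite (perm_big _ (perm_to_rem zs)) big_cons zE.
  by rewrite /= -!mulrA [y * _]mulrC.
Qed.

End Factorial.

(** * Multivariate polynomials *)

Lemma mpoly_ring_ind (K : nzRingType) (n : nat) (P : mpoly n K -> Prop) :
  (forall c, P (mpolyC n c)) -> (forall i, P (mpolyX K (mnm1 i))) ->
  (forall f g, P f -> P g -> P (f + g)) ->
  (forall f g, P f -> P g -> P (f * g)) -> forall f, P f.
Proof.
move=> PC PX PD PM f; rewrite (mpolyE f).
elim/big_ind: _ => [||m _]; [by rewrite -(mpolyC0 n)|exact: PD|].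
rewrite -mul_mpolyC; apply: (PM) => //; rewrite mpolyXE_id.
elim/big_ind: _ => [||i _]; [by rewrite -(mpolyC1 n)|exact: PM|].
elim: (m i) => [|k IHk]; first by rewrite expr0 -(mpolyC1 n).
by rewrite exprS; exact: PM.
Qed.

Lemma prime_elt_iso (D E : idomainType) (f : {rmorphism D -> E})
    (g : {rmorphism E -> D}) (x : D) : cancel f g -> cancel g f ->
  prime_elt x -> prime_elt (f x).
Proof.
move=> fK gK [x0 xU xP]; split.
- by rewrite -(rmorph0 f) (can_eq fK).
- by apply: contra xU => /(rmorph_unit g); rewrite fK.
- move=> a b [c E2]; have [|[d dE]|[d dE]] := xP (g a) (g b).
  + by exists (g c); rewrite -rmorphM E2 rmorphM fK.
  + by left; exists (f d); rewrite -rmorphM -dE gK.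
  + by right; exists (f d); rewrite -rmorphM -dE gK.
Qed.

Lemma factorial_iso (D E : idomainType) (f : {rmorphism D -> E})
    (g : {rmorphism E -> D}) : cancel f g -> cancel g f ->
  factorial_domain D -> factorial_domain E.
Proof.
move=> fK gK fD x x0.
have [|u [s [uU sP E1]]] := fD (g x); first by rewrite -(rmorph0 g) (can_eq gK).
exists (f u), (map f s); split; first exact: rmorph_unit.
  by move=> _ /mapP[y /sP yp ->]; exact: (prime_elt_iso fK gK).
by rewrite big_map -rmorph_prod -rmorphM -E1 gK.
Qed.

(* [S] is [f |-> f (v + t e)] with [v] in the hyperplane [x_k = 0], and [E]
   extends a polynomial on this hyperplane constantly in the direction [e]. *)
Lemma shear_exists (K : fieldType) n (e : 'I_n.+1 -> K) (k : 'I_n.+1) :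
  e k != 0 ->
  exists (S : {rmorphism mpoly n.+1 K -> {poly mpoly n K}})
    (T : {rmorphism {poly mpoly n K} -> mpoly n.+1 K})
    (E : {rmorphism mpoly n K -> mpoly n.+1 K}),
  [/\ cancel S T, cancel T S, (forall c, T c%:P = E c) /\
      T 'X = mpolyC n.+1 (e k)^-1 * mpolyX K (mnm1 k),
    forall c, E (mpolyC n c) = mpolyC n.+1 c &
    forall j, E (mpolyX K (mnm1 j)) = mpolyX K (mnm1 (lift k j)) -
       mpolyC n.+1 (e (lift k j) / e k) * mpolyX K (mnm1 k)].
Proof.
move=> ek.
have [S [SC SX]] : exists S : {rmorphism mpoly n.+1 K -> {poly mpoly n K}},
    (forall c, S (mpolyC n.+1 c) = (mpolyC n c)%:P) /\
    forall i, S (mpolyX K (mnm1 i)) =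
      (if unlift k i is Some j then mpolyX K (mnm1 j) else 0)%:P +
      (mpolyC n (e i))%:P * 'X.
  unshelve eexists; first apply: (GRing.RMorphism.clone _ _
    (mmap (@polyC (mpoly n K) \o @mpolyC n K)
      (fun i => (if unlift k i is Some j then mpolyX K (mnm1 j) else 0)%:P +
              (mpolyC n (e i))%:P * 'X)) _).
  by split=> [c|i]; [exact: mmapC|rewrite [LHS]mmapX mmap1U].
have [E [EC EX]] : exists E : {rmorphism mpoly n K -> mpoly n.+1 K},
    (forall c, E (mpolyC n c) = mpolyC n.+1 c) /\
    forall j, E (mpolyX K (mnm1 j)) = mpolyX K (mnm1 (lift k j)) -
       mpolyC n.+1 (e (lift k j) / e k) * mpolyX K (mnm1 k).
  unshelve eexists; first apply: (GRing.RMorphism.clone _ _ (mmap (@mpolyC n.+1 K)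
    (fun j => mpolyX K (mnm1 (lift k j)) -
       mpolyC n.+1 (e (lift k j) / e k) * mpolyX K (mnm1 k))) _).
  by split=> [c|i]; [exact: mmapC|rewrite [LHS]mmapX mmap1U].
have [T [TC TX]] : exists T : {rmorphism {poly mpoly n K} -> mpoly n.+1 K},
    (forall c, T c%:P = E c) /\
    T 'X = mpolyC n.+1 (e k)^-1 * mpolyX K (mnm1 k).
  unshelve eexists; first apply: (GRing.RMorphism.clone _ _
    (horner_eval (mpolyC n.+1 (e k)^-1 * mpolyX K (mnm1 k)) \o map_poly E) _).
  by split=> [c|] /=; rewrite /horner_eval ?map_polyC ?hornerC ?map_polyX ?hornerX.
exists S, T, E; split=> //.
  elim/mpoly_ring_ind => [c|i|f g fE gE|f g fE gE].
  - by rewrite SC TC EC.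
  - rewrite SX rmorphD rmorphM !TC TX EC mulrA -mpolyCM.
    case: unliftP => [j ->|->]; first by rewrite EX subrK.
    by rewrite rmorph0 add0r divff // mpolyC1 mul1r.
  - by rewrite (rmorphD S) (rmorphD T) fE gE.
  - by rewrite (rmorphM S) (rmorphM T) fE gE.
have SE g : S (E g) = g%:P.
  elim/mpoly_ring_ind: g => [c|i|f g fE gE|f g fE gE].
  - by rewrite EC SC.
  - rewrite EX rmorphB rmorphM SC !SX liftK unlift_none.
    by rewrite polyC0 add0r mulrA -polyCM -mpolyCM divfK // addrK.
  - by rewrite (rmorphD E) (rmorphD S) fE gE polyCD.
  - by rewrite (rmorphM E) (rmorphM S) fE gE polyCM.
elim/poly_ind => [|g c gE]; first by rewrite (rmorph0 T) rmorph0.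
rewrite (rmorphD T) (rmorphM T) (rmorphD S) (rmorphM S) gE TC SE TX.
congr (_ * _ + _).
rewrite (rmorphM S) SC SX unlift_none polyC0 add0r mulrA -polyCM -mpolyCM mulVf //.
by rewrite mpolyC1 mul1r.
Qed.

Lemma factorial_mpoly (K : fieldType) n : factorial_domain (mpoly n K).
Proof.
elim: n => [|n IHn].
  move=> x x0; exists x, [::]; rewrite big_nil mulr1; split=> //.
  rewrite (nvar0_mpolyC x) in x0 *; rewrite mpolyC_eq0 in x0.
  by apply: (rmorph_unit (@mpolyC 0 K)); rewrite unitfE.
have [S [T [_ [SK TK _ _ _]]]] :=
  @shear_exists K n (fun=> 1) ord0 (oner_neq0 K).
exact: (factorial_iso TK SK (factorial_poly IHn)).
Qed.

(** The shear turns the direction [e] into the variable of [{poly mpoly n K}]. The constant of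
    [prime_bezout] then becomes a polynomial that does not change along [e]. *)
Lemma mpoly_bezout (K : fieldType) n (e : 'I_n.+1 -> K) (f g : mpoly n.+1 K) :
  (exists k, e k != 0) -> prime_elt f -> ~ rdvd f g ->
  exists a b c, [/\ c != 0, c = a * f + b * g &
    forall (v : 'I_n.+1 -> K) t, meval (fun i => v i + t * e i) c = meval v c].
Proof.
move=> [k ek] fp nfg.
have [S [T [E [SK TK [TC _] EC EX]]]] := shear_exists ek.
have ng : ~ rdvd (S f) (S g).
  move=> [c Ec]; apply: nfg; exists (T c).
  by rewrite -[LHS]SK Ec (rmorphM T) SK.
have [a [b [c [c0 Ec]]]] :=
  prime_bezout (@factorial_mpoly K n) (prime_elt_iso SK TK fp) ng.
exists (T a), (T b), (T c%:P); split.
- by rewrite -(rmorph0 T) (can_eq TK) polyC_eq0.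
- by rewrite Ec (rmorphD T) !(rmorphM T) !SK.
move=> v t; rewrite TC.
have H (w : 'I_n.+1 -> K) : meval w (E c) =
    meval (fun j => w (lift k j) - e (lift k j) / e k * w k) c.
  elim/mpoly_ring_ind: (c) => [d|j|p q pE qE|p q pE qE].
  - by rewrite EC !mevalC.
  - by rewrite EX mevalB mevalM !mevalC !mevalXU.
  - by rewrite (rmorphD E) !mevalD pE qE.
  - by rewrite (rmorphM E) !mevalM pE qE.
rewrite !H; apply: meval_eq => j.
by field.
Qed.

Lemma poly_nonroot (K : numFieldType) (f : {poly K}) :
  f != 0 -> exists x, f.[x] != 0.
Proof.
move=> f0; apply: contrapT => nx.
pose s : seq K := [seq i%:R | i <- iota 0 (size f)].
have rs : all (root f) s.
  apply/allP => x _; rewrite rootE; apply: contrapT => /negP x0.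
  by apply: nx; exists x.
have us : uniq s by rewrite map_inj_uniq ?iota_uniq//; exact: mulrIn (oner_neq0 K).
by have := max_poly_roots f0 rs us; rewrite size_map size_iota ltnn.
Qed.

Lemma mpoly_nonroot (K : numFieldType) n (f : mpoly n K) :
  f != 0 -> exists v, meval v f != 0.
Proof.
elim: n f => [|n IHn] f f0.
  exists (fun=> 0); rewrite (nvar0_mpolyC f) mevalC.
  by rewrite (nvar0_mpolyC f) mpolyC_eq0 in f0.
have [S [T [E [SK TK [TC TX] EC EX]]]] :=
  @shear_exists K n (fun=> 1) ord0 (oner_neq0 K).
have Sf0 : S f != 0 by rewrite -(rmorph0 S) (can_eq SK).
have [|v v0] := IHn (lead_coef (S f)); first by rewrite lead_coef_eq0.
have [|t t0] := @poly_nonroot K (map_poly (meval v) (S f)).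
  rewrite -lead_coef_eq0 lead_coef_map_eq //.
pose w i := t + if unlift ord0 i is Some j then v j else 0.
exists w.
have H2 c : meval w (E c) = meval v c.
  elim/mpoly_ring_ind: c => [d|j|p q pE qE|p q pE qE].
  - by rewrite EC !mevalC.
  - rewrite EX mevalB mevalM mevalC !mevalXU /w liftK unlift_none.
    by rewrite divff ?oner_neq0 // mul1r addr0 addrC addKr.
  - by rewrite (rmorphD E) !mevalD pE qE.
  - by rewrite (rmorphM E) !mevalM pE qE.
have H (g : {poly mpoly n K}) : meval w (T g) = (map_poly (meval v) g).[t].
  elim/poly_ind: g => [|g c gE].
    by rewrite (rmorph0 T) meval0 rmorph0 horner0.
  rewrite (rmorphD T) (rmorphM T) mevalD mevalM gE rmorphD rmorphM /=.
  rewrite map_polyX map_polyC hornerMXaddC TX TC mevalM mevalC mevalXU H2.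
  by rewrite /w unlift_none invr1 mul1r addr0.
by rewrite -[f]SK H.
Qed.

Lemma mmap_comp (R S S' : comNzRingType) n (phi : {rmorphism R -> S})
    (psi : {rmorphism S -> S'}) (h : 'I_n -> S) (f : mpoly n R) :
  psi (mmap phi h f) = mmap (psi \o phi) (psi \o h) f.
Proof.
elim/mpoly_ring_ind: f => [c|i|p q pE qE|p q pE qE].
- by rewrite !mmapC.
- by rewrite !mmapX !mmap1U.
- by rewrite !mmapD rmorphD pE qE.
- by rewrite (rmorphM (mmap phi h)) (rmorphM (mmap (psi \o phi) _)) rmorphM /= pE qE.
Qed.

Lemma eq_mmap (R S : nzRingType) n (phi phi' : R -> S)
    (h h' : 'I_n -> S) (f : mpoly n R) : phi =1 phi' -> h =1 h' ->
  mmap phi h f = mmap phi' h' f.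
Proof.
move=> pE hE; apply: eq_bigr => m _; rewrite pE; congr (_ * _).
by apply: eq_bigr => i _; rewrite hE.
Qed.

Lemma mmap_homog (R S : comNzRingType) n (phi : R -> S)
    (h : 'I_n -> S) (f : mpoly n R) d c : f \is ishomog1 d mdeg ->
  mmap phi (fun i => c * h i) f = c ^+ d * mmap phi h f.
Proof.
move=> /dhomogP fd'; have {fd'} fd m : m \in msupp f -> mdeg m = d by exact: fd'.
rewrite /mmap big_distrr /=; apply: eq_big_seq => m /fd <-.
rewrite mulrCA; congr (_ * _); rewrite /mmap1 mdegE -prodrXr -big_split.
by apply: eq_bigr => i _; rewrite exprMn.
Qed.

(** Identifies the leading coefficient on a line, once [f] is known not to vanish at the direction
    [w]; the size is only bounded, since it may. *)
Lemma mmap_line_top (R S : comNzRingType) n (phi : {rmorphism R -> S})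
    (u w : 'I_n -> S) (f : mpoly n R) d : f \is ishomog1 d mdeg ->
  let L := mmap (@polyC S \o phi) (fun i => (u i)%:P + w i *: 'X) f in
  (size L <= d.+1)%N /\ L`_d = mmap phi w f.
Proof.
move=> /dhomogP fd'; have {fd'} fd m : m \in msupp f -> mdeg m = d by exact: fd'.
pose P k (g : {poly S}) c := (size g <= k.+1)%N /\ g`_k = c.
have PM k g c l h b : P k g c -> P l h b -> P (k + l)%N (g * h) (c * b).
  move=> [sg <-] [sh <-]; split.
    by rewrite (leq_trans (size_polyMleq _ _)) //; move: sg sh; lia.
  rewrite coefM (bigD1 (inord k)) //= inordK ?ltnS ?leq_addr // addKn big1 ?addr0 //.
  move=> i /eqP ik; have [ki|ki|ki] := ltngtP k i.
  - by rewrite nth_default ?mul0r // (leq_trans sg).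
  - by rewrite [X in _ * X]nth_default ?mulr0 // (leq_trans sh) //; lia.
  - by case: ik; apply: val_inj; rewrite /= inordK // ltnS leq_addr.
have P1 i : P 1%N ((u i)%:P + w i *: 'X) (w i).
  split; last by rewrite coefD coefC coefZ coefX mulr1 add0r.
  rewrite (leq_trans (size_polyD _ _)) // geq_max (leq_trans (size_polyC_leq1 _)) //.
  by rewrite (leq_trans (size_scale_leq _ _)) // size_polyX.
suff : P d (mmap (@polyC S \o phi) (fun i => (u i)%:P + w i *: 'X) f) (mmap phi w f) by [].
rewrite /mmap [X in P _ X _]big_seq_cond [X in P _ _ X]big_seq_cond.
elim/big_ind2: _ => [|g c h b [sg <-] [sh <-]|m /andP[/fd <- _]].
- by split; rewrite ?size_poly0 ?coef0.
- split; last by rewrite coefD.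
  by rewrite (leq_trans (size_polyD _ _)) // geq_max sg.
rewrite -[mdeg m]add0n; apply: (PM); first by split; rewrite ?size_polyC_leq1 ?coefC.
rewrite /mmap1 mdegE.
elim/big_ind3: _ => [|k1 g1 c1 k2 g2 c2 h1 h2|i _]; first by split; rewrite ?size_poly1 ?coef1.
- exact: PM.
- elim: (m i) => [|k IHk]; first by split; rewrite ?expr0 ?size_poly1 ?coef1.
  by rewrite !exprS -add1n; exact: PM.
Qed.

Lemma mcoeffM_mlast (R : comNzRingType) n (a b : mpoly n R) :
  mcoeff (mnm_add (mlast a) (mlast b)) (a * b) =
  mcoeff (mlast a) a * mcoeff (mlast b) b.
Proof.
set M := mnm_add _ _.
rewrite mcoeffM.
have ltM m m' : M == mnm_add m m' -> (mdeg m < (mdeg M).+1)%N.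
  by move/eqP->; rewrite mdegD ltnS leq_addr.
have ltM' m m' : M == mnm_add m m' -> (mdeg m' < (mdeg M).+1)%N.
  by move/eqP->; rewrite mdegD ltnS leq_addl.
rewrite (bigD1 (BMultinom (ltM _ _ (eqxx M)), BMultinom (ltM' _ _ (eqxx M)))) //=.
rewrite big1 ?addr0 // => -[k1 k2] /= /andP[/eqP Mk nk].
have [lt1|lt1|eq1] := ltgtP (k1 : multinom n) (mlast a).
- by rewrite mcoeff_lt_mlast ?mul0r.
- rewrite [X in _ * X]mcoeff_lt_mlast ?mulr0 // ltNge; apply/negP => le2.
  by have := ltmc_le_add lt1 le2; rewrite -/M -Mk ltxx.
- case/eqP: nk; congr (_, _); apply: val_inj => //=.
  by move: Mk; rewrite /M eq1 => /addmI.
Qed.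

(** Over a domain the lowest monomials multiply without cancellation, and so do the highest ones.
    Both products have degree [d], so the lowest and the highest degree of each factor agree. *)
Lemma homog_factor (R : idomainType) n (a b : mpoly n R) d :
  a * b != 0 -> a * b \is ishomog1 d mdeg -> exists k, a \is ishomog1 k mdeg.
Proof.
move=> ab0 /dhomogP abd.
have [a0 b0] : a != 0 /\ b != 0 by move: ab0; rewrite mulf_eq0 negb_or => /andP.
have lo : (mdeg (mlast a) + mdeg (mlast b))%N = d.
  rewrite -mdegD; apply: abd; rewrite mcoeff_msupp mcoeffM_mlast.
  by rewrite mulf_neq0 // -mcoeff_msupp mlast_supp.
have hi : (mdeg (mlead a) + mdeg (mlead b))%N = d.
  by rewrite -mdegD -mleadM //; apply: abd; exact: mlead_supp.
have lea m : m \in msupp a -> (mdeg (mlast a) <= mdeg m <= mdeg (mlead a))%N.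
  by move=> ma; rewrite !lemc_mdeg ?mlast_lemc ?msupp_le_mlead.
have leb : (mdeg (mlast b) <= mdeg (mlead b))%N.
  by rewrite lemc_mdeg // mlast_lemc // mlead_supp.
exists (mdeg (mlast a)); apply/dhomogP => m /lea /andP[] /=; lia.
Qed.

Section Evaluation.
Variables (R : realType) (n : nat).
Implicit Types (f g : rpoly R n) (x y u w : 'rV[R]_n).
Local Notation rc := (real_complex R).
Local Notation cv := (map_mx (real_complex R)).

Lemma ceval_mmap f (z : 'rV[R[i]]_n) : ceval f z = mmap rc (fun i => z 0 i) f.
Proof.
rewrite /ceval /map_mpoly /meval (mmap_comp (GRing.RMorphism.clone _ _ (@mpolyC n _ \o rc) _)).
apply: eq_mmap => [c|i] /=; first by rewrite mmapC.
by rewrite mmapX mmap1U.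
Qed.

Lemma cevalD f g (z : 'rV[R[i]]_n) : ceval (f + g) z = ceval f z + ceval g z.
Proof. by rewrite !ceval_mmap mmapD. Qed.

Lemma cevalM f g (z : 'rV[R[i]]_n) : ceval (f * g) z = ceval f z * ceval g z.
Proof. by rewrite !ceval_mmap (rmorphM (mmap rc _)). Qed.

Lemma cevalC (c : R) (z : 'rV[R[i]]_n) : ceval (mpolyC n c) z = c%:C.
Proof. by rewrite ceval_mmap mmapC. Qed.

Lemma cevalX i (z : 'rV[R[i]]_n) : ceval (mpolyX R (mnm1 i)) z = z 0 i.
Proof. by rewrite ceval_mmap mmapX mmap1U. Qed.

Lemma ceval_real f x : ceval f (cv x) = (reval f x)%:C.
Proof.
rewrite ceval_mmap /reval /meval (mmap_comp (idfun : {rmorphism R -> R})).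
by apply: eq_mmap => // i /=; rewrite mxE.
Qed.

Lemma revalD f g x : reval (f + g) x = reval f x + reval g x.
Proof. exact: mevalD. Qed.

Lemma revalM f g x : reval (f * g) x = reval f x * reval g x.
Proof. exact: mevalM. Qed.

Lemma revalC (c : R) x : reval (mpolyC n c) x = c.
Proof. exact: mevalC. Qed.

Lemma revalX i x : reval (mpolyX R (mnm1 i)) x = x 0 i.
Proof. exact: mevalXU. Qed.

Lemma ceval_homog f d (c : R[i]) (z : 'rV[R[i]]_n) : f \is ishomog1 d mdeg ->
  ceval f (c *: z) = c ^+ d * ceval f z.
Proof.
move=> fd; rewrite !ceval_mmap -(mmap_homog _ _ _ fd).
by apply: eq_mmap => // i; rewrite mxE.
Qed.

Lemma reval_homog f d (c : R) x : f \is ishomog1 d mdeg ->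
  reval f (c *: x) = c ^+ d * reval f x.
Proof.
move=> fd; rewrite /reval /meval -(mmap_homog _ _ _ fd).
by apply: eq_mmap => // i; rewrite mxE.
Qed.

Definition cline f (u w : 'rV[R[i]]_n) : {poly R[i]} :=
  mmap (@polyC R[i] \o rc) (fun i => (u 0 i)%:P + w 0 i *: 'X) f.

Lemma horner_cline f (u w : 'rV[R[i]]_n) a :
  (cline f u w).[a] = ceval f (u + a *: w).
Proof.
rewrite ceval_mmap -[LHS]/(horner_eval a (cline f u w)).
rewrite /cline (mmap_comp (GRing.RMorphism.clone _ _ (@polyC R[i] \o rc) _)).
apply: eq_mmap => [c|i] /=; rewrite /horner_eval ?hornerC //.
by rewrite hornerD hornerC hornerZ hornerX !mxE mulrC.
Qed.

Lemma horner_along_line f x w t :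
  (along_line f x w).[t] = reval f (x + t *: w).
Proof.
rewrite /reval -[LHS]/(horner_eval t (along_line f x w)).
rewrite /along_line (mmap_comp (@polyC R)).
apply: eq_mmap => [c|i] /=; rewrite /horner_eval ?hornerC //.
by rewrite hornerD hornerC hornerZ hornerX !mxE mulrC.
Qed.

Lemma map_along_line f x w : map_poly rc (along_line f x w) = cline f (cv x) (cv w).
Proof.
rewrite /along_line (mmap_comp (@polyC R) (map_poly rc)).
apply: eq_mmap => [c|i] /=; first by rewrite map_polyC.
by rewrite rmorphD /= map_polyC map_polyZ map_polyX !mxE.
Qed.

(** The squared modulus, taken in [R] so that order and limits are those of the reals. *)
Definition csqn (z : R[i]) : R := complex.Re z ^+ 2 + complex.Im z ^+ 2.

Lemma csqnE (z : R[i]) : (csqn z)%:C = `|z| ^+ 2.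
Proof. exact: add_Re2_Im2. Qed.

Lemma csqnM (z1 z2 : R[i]) : csqn (z1 * z2) = csqn z1 * csqn z2.
Proof.
by apply: (@fmorph_inj _ _ rc); rewrite rmorphM /= !csqnE normrM exprMn.
Qed.

Lemma csqn_ge0 (z : R[i]) : 0 <= csqn z.
Proof. by rewrite addr_ge0 ?sqr_ge0. Qed.

Lemma csqn_eq0 (z : R[i]) : (csqn z == 0) = (z == 0).
Proof.
rewrite paddr_eq0 ?sqr_ge0 // !sqrf_eq0.
by case: z => a b; rewrite eq_complex.
Qed.

Lemma csqn_real (a : R) : csqn a%:C = a ^+ 2.
Proof. by rewrite /csqn /= expr0n addr0. Qed.

(** On the line, [f] is [f w] times the product of [d] differences with its complex roots, each of
    squared modulus at least [k] at [a]. This bound replaces continuity of roots in all limit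
    arguments below. *)
Lemma csqn_root_bound f d (u w : 'rV[R[i]]_n) a k : f \is ishomog1 d mdeg ->
  0 <= k -> (forall z : R[i], ceval f (u + z *: w) = 0 -> k <= csqn (a - z)) ->
  csqn (ceval f w) * k ^+ d <= csqn (ceval f (u + a *: w)).
Proof.
move=> fd k0 kP.
have [w0|w0] := eqVneq (ceval f w) 0.
  by rewrite w0 /csqn /= expr0n addr0 mul0r csqn_ge0.
have [sL Ld] := mmap_line_top rc (fun i => u 0 i) (fun i => w 0 i) fd.
rewrite -/(cline f u w) -ceval_mmap in sL Ld.
have sL1 : size (cline f u w) = d.+1.
  apply/eqP; rewrite eqn_leq sL ltnNge; apply: contra w0 => sd.
  by rewrite -Ld nth_default.
have [r rE] := closed_field_poly_normal (cline f u w).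
have lE : lead_coef (cline f u w) = ceval f w by rewrite lead_coefE sL1.
have sr : size r = d.
  by apply: succn_inj; rewrite -sL1 rE lE size_scale // size_prod_XsubC.
rewrite -horner_cline rE lE hornerZ csqnM ler_wpM2l ?csqn_ge0 //.
have : all (fun z => k <= csqn (a - z)) r.
  apply/allP => z zr; apply: kP; rewrite -horner_cline rE hornerZ horner_prod.
  by rewrite (big_rem z) //= hornerXsubC subrr mul0r mulr0.
rewrite -sr; elim: r {rE sr} => [_|z r IHr] /=.
  by rewrite big_nil hornerC /csqn /= expr0n addr0 expr1n.
move=> /andP[kz /IHr kr]; rewrite big_cons hornerM hornerXsubC csqnM exprS.
by rewrite ler_pM // exprn_ge0.
Qed.

Lemma cvg_reval (T : Type) (F : set_system T) (h : T -> 'rV[R]_n) f (l : 'rV[R]_n) :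
  Filter F -> (forall i, (h t 0 i) @[t --> F] --> l 0 i) ->
  reval f (h t) @[t --> F] --> reval f l.
Proof.
move=> FF hl; elim/mpoly_ring_ind: f => [c|i|f g fE gE|f g fE gE].
- rewrite revalC; under eq_fun do rewrite revalC; exact: cvg_cst.
- rewrite revalX; under eq_fun do rewrite revalX; exact: hl.
- rewrite revalD; under eq_fun do rewrite revalD; exact: cvgD.
- rewrite revalM; under eq_fun do rewrite revalM; exact: cvgM.
Qed.

Lemma continuous_reval f : continuous (reval f).
Proof.
move=> x; apply: (@cvg_reval _ (nbhs x) id f x (nbhs_filter x)) => i.
exact: coord_continuous.
Qed.

End Evaluation.

(** * Hyperbolicity cones *)

Section ConeCharacterization.
Variables (R : realType) (n : nat).
Implicit Types (f p : rpoly R n.+1) (e u w x : 'rV[R]_n.+1).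
Local Notation rc := (real_complex R).
Local Notation cv := (map_mx (real_complex R)).

Lemma line_complex (u w : 'rV[R]_n.+1) (t : R) :
  cv (u + t *: w) = cv u + t%:C *: cv w.
Proof. by rewrite map_mxD map_mxZ. Qed.

Lemma real_root_bound f d u w : f \is ishomog1 d mdeg ->
  (forall z : R[i], ceval f (cv u + z *: cv w) = 0 ->
     exists t : R, z = t%:C /\ t <= 0) ->
  forall t, 0 <= t ->
    reval f w ^+ 2 * (t ^+ 2) ^+ d <= reval f (u + t *: w) ^+ 2.
Proof.
move=> fd fw t t0; rewrite -[X in X * _]csqn_real -[leRHS]csqn_real.
rewrite -!ceval_real line_complex; apply: csqn_root_bound => //.
  exact: sqr_ge0.
move=> z /fw[s [-> s0]]; rewrite -rmorphB csqn_real ler_sqr ?nnegrE; lra.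
Qed.

(** Garding's description of the cone: since all roots of [p (w + t e)] are real, the condition says
    that they are all negative. *)
Definition open_hcone p e : set 'rV[R]_n.+1 :=
  [set w | forall t, 0 <= t -> reval p (w + t *: e) != 0].

Definition closed_hcone p e : set 'rV[R]_n.+1 :=
  [set w | forall t, 0 < t -> reval p (w + t *: e) != 0].

Variables (p : rpoly R n.+1) (e : 'rV[R]_n.+1) (d : nat).
Hypotheses (pd : p \is ishomog1 d mdeg) (ph : hyperbolic p e).

Lemma hyperbolic_root x (z : R[i]) :
  ceval p (cv x + z *: cv e) = 0 -> exists t : R, z = t%:C.
Proof.
case: ph => _ rP; rewrite -horner_cline -map_along_line => z0.
by apply: (rP x); apply/eqP.
Qed.

(** The strict condition on roots becomes a family of weak polynomial inequalities, which makes the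
    cone visibly closed. *)
Lemma closed_hconeP w : closed_hcone p e w <-> forall t, 0 <= t ->
    reval p e ^+ 2 * (t ^+ 2) ^+ d <= reval p (w + t *: e) ^+ 2.
Proof.
split=> [wC|wC t t0].
  apply: (real_root_bound pd) => z z0; have [t zt] := hyperbolic_root z0.
  exists t; split=> //; rewrite leNgt; apply/negP => /wC/eqP; apply.
  move: z0; rewrite zt -line_complex ceval_real => /(congr1 (@complex.Re R)).
  by [].
have := wC t (ltW t0); apply: contraTneq => ->; rewrite expr0n /= -ltNge.
have e0 : 0 < reval p e ^+ 2 by rewrite exprn_even_gt0 //; case: ph.
by rewrite mulr_gt0 // !exprn_gt0.
Qed.

Lemma closed_hcone_closed : closed (closed_hcone p e).
Proof.
have -> : closed_hcone p e = \bigcap_(t in [set t : R | 0 <= t])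
    [set w | reval p e ^+ 2 * (t ^+ 2) ^+ d <= reval p (w + t *: e) ^+ 2].
  by apply/seteqP; split=> w; [move/closed_hconeP|move=> ?; apply/closed_hconeP].
apply: closed_bigI => t _; pose f (w : 'rV[R]_n.+1) := reval p (w + t *: e) ^+ 2.
have cf : continuous f.
  move=> w; have FF : Filter (nbhs w) := nbhs_filter w.
  rewrite /f /continuous_at; have H : reval p (v + t *: e) @[v --> w] --> reval p (w + t *: e).
    apply: cvg_reval => i; rewrite mxE; under eq_fun do rewrite mxE.
    by apply: cvgD; [exact: coord_continuous|exact: cvg_cst].
  rewrite expr2; under eq_fun do rewrite expr2; exact: cvgM.
exact: ((continuous_closedP f).1 cf _ (@closed_ge R _)).
Qed.

(** Homogeneity bends the ray from [w] into the segment from [w] to [e]. The parameter now runs over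
    a compact interval, whence openness of the cone. *)
Lemma open_hcone_segment w : open_hcone p e w <->
  forall s : R, 0 <= s <= 1 -> reval p ((1 - s) *: w + s *: e) != 0.
Proof.
have e0 : reval p e != 0 by case: ph.
split=> [wU s /andP[s0 s1]|wU t t0].
  have [->|s1'] := eqVneq s 1; first by rewrite subrr scale0r add0r scale1r.
  have s'0 : 1 - s != 0 by rewrite subr_eq0 eq_sym.
  have -> : (1 - s) *: w + s *: e = (1 - s) *: (w + (s / (1 - s)) *: e).
    by rewrite scalerDr scalerA mulrC divfK.
  rewrite (reval_homog _ _ pd) mulf_neq0 ?expf_neq0 // wU //.
  by rewrite divr_ge0 // subr_ge0.
have t1 : 1 + t != 0 by rewrite gt_eqF // ltr_wpDr.
have := wU (t / (1 + t)).
have -> : 1 - t / (1 + t) = (1 + t)^-1 by field.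
rewrite [X in X *: e]mulrC -scalerA -scalerDr (reval_homog _ _ pd).
rewrite mulf_eq0 negb_or => H; have /H/andP[]// : 0 <= t / (1 + t) <= 1.
by rewrite divr_ge0 ?addr_ge0 //= ler_pdivrMr ?mul1r ?lerDr // ltr_wpDr.
Qed.

Lemma open_hcone_open : open (open_hcone p e).
Proof.
rewrite openE => w wU; rewrite /interior /=.
have FF : Filter (nbhs w) := nbhs_filter w.
have : \forall v \near w, `[0, 1]%classic `<=`
    (fun s : R => reval p ((1 - s) *: v + s *: e) != 0).
  have /compact_near_coveringP/(_ _ (nbhs w)
    (fun v s => reval p ((1 - s) *: v + s *: e) != 0) FF) := @segment_compact R 0 1.
  apply=> s; rewrite /= in_itv /= => s01.
  have s0 := (open_hcone_segment w).1 wU s s01.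
  have H : reval p ((1 - t.1) *: t.2 + t.1 *: e) @[t --> filter_prod (nbhs s) (nbhs w)]
      --> reval p ((1 - s) *: w + s *: e).
    apply: cvg_reval => i; rewrite !mxE; under eq_fun do rewrite !mxE.
    apply: cvgD; apply: cvgM.
    - by apply: cvgB; [exact: cvg_cst|exact: cvg_fst].
    - apply: (cvg_comp snd (fun v : 'rV[R]_n.+1 => v 0 i)); first exact: cvg_snd.
      exact: coord_continuous.
    - exact: cvg_fst.
    - exact: cvg_cst.
  exact: cvgr_neq0 H s0.
apply: filterS => v vP; apply/open_hcone_segment => s s01; apply: vP.
by rewrite /= in_itv.
Qed.

Lemma open_hcone_neq0 w : open_hcone p e w -> reval p w != 0.
Proof. by move/(_ 0 (lexx _)); rewrite scale0r addr0. Qed.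

Lemma open_hcone_sub : open_hcone p e `<=` closed_hcone p e.
Proof. by move=> w wU t /ltW; exact: wU. Qed.

Lemma closed_hcone_shift w t : closed_hcone p e w -> 0 < t -> open_hcone p e (w + t *: e).
Proof.
by move=> wC t0 s s0; rewrite -addrA -scalerDl; apply: wC; rewrite ltr_pwDl.
Qed.

Lemma closed_hcone_neq0 w : closed_hcone p e w -> reval p w != 0 -> open_hcone p e w.
Proof.
by move=> wC w0 t; rewrite le_eqVlt => /predU1P[<-|]; rewrite ?scale0r ?addr0 //; exact: wC.
Qed.

Lemma open_hcone_e : open_hcone p e e.
Proof.
move=> t t0; rewrite -{1}[e]scale1r -scalerDl (reval_homog _ _ pd).
by case: ph => e0 _; rewrite mulf_neq0 // expf_neq0 // gt_eqF // ltr_wpDr.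
Qed.

(** The open cone is star-shaped about [e], hence connected. It is open, and off the zeros of [p] it
    coincides with the closed cone, so it is clopen there. *)
Lemma open_hcone_component :
  connected_component [set x | reval p x != 0] e = open_hcone p e.
Proof.
have e0 : reval p e != 0 by case: ph.
apply/seteqP; split; last first.
  move=> w wU.
  pose g (s : R) := (1 - s) *: w + s *: e.
  have cg : continuous g.
    by move=> s; apply: cvgD; apply: cvgZr_tmp; do ?[apply: cvgB];
      [exact: cvg_cst|exact: cvg_id|exact: cvg_id].
  have gU : g @` `[0, 1] `<=` [set x | reval p x != 0].
    by move=> _ [s s01 <-]; apply: (open_hcone_segment w).1; rewrite // -in_itv.
  apply: (connected_component_max _ gU).
  - by exists 1; rewrite /= ?in_itv /= ?ler01 ?lexx // /g subrr scale0r add0r scale1r.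
  - apply: connected_continuous_connected; first exact: segment_connected.
    exact: continuous_subspaceT.
  - by exists 0; rewrite /= ?in_itv /= ?ler01 ?lexx // /g subr0 scale0r addr0 scale1r.
set O := connected_component _ _.
have Oe : O e by exact: connected_component_refl.
have O0 w : O w -> reval p w != 0 by move/connected_component_sub.
have OC : connected O by exact: component_connected.
have : O `&` open_hcone p e = O.
  apply: OC; first by exists e; split => //; exact: open_hcone_e.
  - by exists (open_hcone p e) => //; exact: open_hcone_open.
  - exists (closed_hcone p e); first exact: closed_hcone_closed.
    apply/seteqP; split=> w [Ow wC]; split=> //; first exact: open_hcone_sub.
    exact: closed_hcone_neq0 (O0 _ Ow).
by move=> <- w [].
Qed.

Lemma hyperbolicity_coneE : hyperbolicity_cone p e = closed_hcone p e.
Proof.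
rewrite /hyperbolicity_cone open_hcone_component; apply/seteqP; split.
  apply: (subset_trans (closure_subset open_hcone_sub)).
  by rewrite -(closure_id _).1 //; exact: closed_hcone_closed.
move=> w wC B wB.
have : \forall s \near 0^'+, B (w + s *: e).
  have H : w + s *: e @[s --> 0^'+] --> w.
    rewrite -[X in _ --> X]addr0 -[X in _ --> w + X](scale0r e).
    apply: cvgD; [exact: cvg_cst|apply: cvgZr_tmp].
    exact: (cvg_at_right_filter cvg_id).
  exact: H.
move=> H; have /filter_ex[s [Bs s0]] : \forall s \near (0 : R)^'+, B (w + s *: e) /\ 0 < s.
  by near=> s; split; near: s; [exact: H|exact: nbhs_right_gt].
exists (w + s *: e); split=> //; exact: closed_hcone_shift.
Unshelve. all: end_near. Qed.

End ConeCharacterization.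

(** * Garding's theorem: [q] is hyperbolic in every direction of its open cone *)

Section Garding.
Variables (R : realType).
Local Notation rc := (real_complex R).
Local Notation cv := (map_mx (real_complex R)).
Local Notation Re := (@complex.Re R).
Local Notation Im := (@complex.Im R).

Lemma ReD (x y : R[i]) : Re (x + y) = Re x + Re y.
Proof. by case: x y => a b [c d]. Qed.

Lemma ImD (x y : R[i]) : Im (x + y) = Im x + Im y.
Proof. by case: x y => a b [c d]. Qed.

Lemma ReM (x y : R[i]) : Re (x * y) = Re x * Re y - Im x * Im y.
Proof. by case: x y => a b [c d]. Qed.

Lemma ImM (x y : R[i]) : Im (x * y) = Re x * Im y + Im x * Re y.
Proof. by case: x y => a b [c d] /=; rewrite addrC. Qed.

(** Convergence is assumed for the real and imaginary parts of the coordinates, so that every limit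
    is taken in [R]. *)
Lemma cvg_csqn_ceval n (T : Type) (F : set_system T) (h : T -> 'rV[R[i]]_n)
    (l : 'rV[R[i]]_n) (f : rpoly R n) (hr hi : 'I_n -> T -> R) (lr li : 'I_n -> R) :
  Filter F ->
  (forall i t, Re (h t 0 i) = hr i t) -> (forall i t, Im (h t 0 i) = hi i t) ->
  (forall i, Re (l 0 i) = lr i) -> (forall i, Im (l 0 i) = li i) ->
  (forall i, hr i t @[t --> F] --> lr i) -> (forall i, hi i t @[t --> F] --> li i) ->
  csqn (ceval f (h t)) @[t --> F] --> csqn (ceval f l).
Proof.
move=> FF hrE hiE lrE liE hrl hil.
have hR i : Re (h t 0 i) @[t --> F] --> Re (l 0 i).
  by rewrite lrE (_ : (fun t => _) = hr i) //; apply/funext => t.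
have hI i : Im (h t 0 i) @[t --> F] --> Im (l 0 i).
  by rewrite liE (_ : (fun t => _) = hi i) //; apply/funext => t.
have [H1 H2] : Re (ceval f (h t)) @[t --> F] --> Re (ceval f l) /\
    Im (ceval f (h t)) @[t --> F] --> Im (ceval f l).
  elim/mpoly_ring_ind: f => [c|i|f g [fR fI] [gR gI]|f g [fR fI] [gR gI]].
  - by rewrite cevalC; split; under eq_fun do rewrite cevalC; exact: cvg_cst.
  - rewrite cevalX; split; under eq_fun do rewrite cevalX; [exact: hR|exact: hI].
  - rewrite cevalD ReD ImD; split.
      have -> : (fun t => Re (ceval (f + g) (h t))) =
          (fun t => Re (ceval f (h t)) + Re (ceval g (h t))).
        by apply/funext => t; rewrite cevalD ReD.
      exact: (cvgD fR gR).
    have -> : (fun t => Im (ceval (f + g) (h t))) =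
        (fun t => Im (ceval f (h t)) + Im (ceval g (h t))).
      by apply/funext => t; rewrite cevalD ImD.
    exact: (cvgD fI gI).
  - rewrite cevalM ReM ImM; split.
      have -> : (fun t => Re (ceval (f * g) (h t))) = (fun t => Re (ceval f (h t)) *
          Re (ceval g (h t)) - Im (ceval f (h t)) * Im (ceval g (h t))).
        by apply/funext => t; rewrite cevalM ReM.
      exact: (cvgB (cvgM fR gR) (cvgM fI gI)).
    have -> : (fun t => Im (ceval (f * g) (h t))) = (fun t => Re (ceval f (h t)) *
        Im (ceval g (h t)) + Im (ceval f (h t)) * Re (ceval g (h t))).
      by apply/funext => t; rewrite cevalM ImM.
    exact: (cvgD (cvgM fR gI) (cvgM fI gR)).
rewrite /csqn; exact: (cvgD (cvgM H1 H1) (cvgM H2 H2)).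
Qed.

Variables (n : nat) (q : rpoly R n.+1) (e : 'rV[R]_n.+1) (d : nat).
Hypotheses (qd : q \is ishomog1 d mdeg) (qh : hyperbolic q e).

(** A homotopy in [b] from the line through the origin to the line through [v], both in direction
    [w]. The shift by ['i] times [e] keeps the zeros [al +i* be] off the real axis, so they cannot
    leave the lower half-plane. *)
Let pt (v w : 'rV[R]_n.+1) (b al be : R) : 'rV[R[i]]_n.+1 :=
  cv (b *: v) + (al +i* be) *: cv w + 'i *: cv e.

Lemma pt_real v w b al : ceval q (pt v w b al 0) != 0.
Proof.
apply/eqP; rewrite /pt -[al +i* 0]/(al%:C) -line_complex.
by move=> /(hyperbolic_root qh)[t] /(congr1 Im) /= /eqP; rewrite oner_eq0.
Qed.

(** Dividing the point by [al +i* be] turns a large zero into a zero near [w], where [q] does not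
    vanish. Compactness of the interval makes this uniform in [b]. *)
Lemma pt_bounded v w : open_hcone q e w -> exists2 B : R, 0 < B &
  forall b al be, 0 <= b <= 1 -> ceval q (pt v w b al be) = 0 ->
    al ^+ 2 + be ^+ 2 <= B.
Proof.
move=> wU.
pose g (st : R * R) (b : R) : 'rV[R[i]]_n.+1 :=
  cv w + (st.1 +i* st.2) *: (cv (b *: v) + 'i *: cv e).
have gR st b i : Re (g st b 0 i) = w 0 i + (st.1 * (b * v 0 i) - st.2 * e 0 i).
  by rewrite !mxE /= !(mul0r, mulr0, mul1r, subr0, addr0, add0r, sub0r).
have gI st b i : Im (g st b 0 i) = st.1 * e 0 i + st.2 * (b * v 0 i).
  by rewrite !mxE /= !(mul0r, mulr0, mul1r, subr0, addr0, add0r, sub0r).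
have : \forall st \near ((0 : R), (0 : R)), `[0, 1]%classic `<=`
    (fun b : R => csqn (ceval q (g st b)) != 0).
  have /compact_near_coveringP/(_ _ _ (fun st b => csqn (ceval q (g st b)) != 0)
    (nbhs_filter ((0 : R), (0 : R)))) :=
     @segment_compact R 0 1.
  apply => b _.
  have H : csqn (ceval q (g t.2 t.1)) @[t --> filter_prod (nbhs b) (nbhs ((0 : R), (0 : R)))]
      --> csqn (ceval q (g (0, 0) b)).
    have c21 : t.2.1 @[t --> filter_prod (nbhs b) (nbhs ((0 : R), (0 : R)))] --> (0 : R).
      by apply: (cvg_comp snd fst); [exact: cvg_snd|exact: cvg_fst].
    have c22 : t.2.2 @[t --> filter_prod (nbhs b) (nbhs ((0 : R), (0 : R)))] --> (0 : R).
      by apply: (cvg_comp snd snd); [exact: cvg_snd|exact: cvg_snd].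
    apply: (@cvg_csqn_ceval _ _ _ (fun t : R * (R * R) => g t.2 t.1) (g (0, 0) b) q
      (fun i t => w 0 i + (t.2.1 * (t.1 * v 0 i) - t.2.2 * e 0 i))
      (fun i t => t.2.1 * e 0 i + t.2.2 * (t.1 * v 0 i)) _ _ _
      (fun i t => gR t.2 t.1 i) (fun i t => gI t.2 t.1 i)
      (fun i => gR (0, 0) b i) (fun i => gI (0, 0) b i)) => i.
    + apply: cvgD; first exact: cvg_cst.
      apply: cvgB; apply: cvgM => //; last exact: cvg_cst.
      by apply: cvgM; [exact: cvg_fst|exact: cvg_cst].
    + apply: cvgD; apply: cvgM => //; first exact: cvg_cst.
      by apply: cvgM; [exact: cvg_fst|exact: cvg_cst].
  have ne : csqn (ceval q (g (0, 0) b)) != 0.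
    rewrite /g /= csqn_eq0 scale0r addr0 ceval_real.
    by rewrite (fmorph_eq0 rc) (open_hcone_neq0 wU).
  exact: cvgr_neq0 H ne.
move=> [[U V] /= [U0 V0] UV].
have /nbhs_ballP[r /= r0 rW] : nbhs (0 : R) (U `&` V) by exact: filterI.
(* The inverse of [al +i* be] has squared modulus [m^-1], with [m] the squared modulus of
   [al +i* be]. Beyond this bound it falls within [r] of 0. *)
exists (r ^- 2); first by rewrite invr_gt0 exprn_gt0.
move=> b al be b01 z0; rewrite leNgt; apply/negP => big.
pose m := al ^+ 2 + be ^+ 2.
have m0 : 0 < m by apply: lt_trans big; rewrite invr_gt0 exprn_gt0.
have rm : m^-1 < r ^+ 2 by rewrite -[r ^+ 2]invrK ltf_pV2 // posrE ?invr_gt0 exprn_gt0.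
have inb c : c ^+ 2 <= m -> (U `&` V) (c / m).
  move=> cm; apply: rW; rewrite /ball /= sub0r normrN.
  rewrite -(@ltr_pXn2r _ 2) ?nnegrE ?(ltW r0) // real_normK ?num_real //.
  apply: le_lt_trans rm; rewrite expr_div_n expr2 [m ^+ 2]expr2 invfM mulrA.
  by rewrite -[leRHS]mul1r ler_pM2r ?invr_gt0 // ler_pdivrMr // mul1r -expr2.
have := UV (al / m, - be / m).
have UVm : (U `*` V) (al / m, - be / m).
  by split; [apply: (inb al _).1|apply: (inb (- be) _).2];
    rewrite /m ?sqrrN ?lerDl ?lerDr sqr_ge0.
move=> /(_ UVm b); rewrite /= in_itv /= => /(_ b01).
suff -> : ceval q (g (al / m, - be / m) b) = 0.
  by rewrite csqn_eq0 eqxx.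
have -> : g (al / m, - be / m) b = ((al / m) +i* (- be / m)) *: pt v w b al be.
  have sa : ((al / m) +i* (- be / m)) * (al +i* be) = 1.
    apply/eqP; rewrite eq_complex /=; apply/andP; split; apply/eqP.
      by have := lt0r_neq0 m0; rewrite /m => mn0; field.
    by have := lt0r_neq0 m0; rewrite /m => mn0; field.
  rewrite /g /pt !scalerDr [_ *: (_ *: cv w)]scalerA sa scale1r addrA.
  by congr (_ + _); rewrite addrC.
by rewrite (ceval_homog _ _ qd) z0 mulr0.
Qed.

(** Take a zero in the closed upper half-plane with the least [b]. For smaller [b] all zeros lie
    strictly below the axis, hence at distance at least [be] from it, and [csqn_root_bound] keeps
    [F] away from 0. The bound passes to the limit and contradicts the zero. *)
Lemma pt_lower v w : open_hcone q e w ->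
  forall b al be, 0 <= b <= 1 -> 0 <= be -> ceval q (pt v w b al be) != 0.
Proof.
move=> wU b0 al0 be0 b01 be00; apply/negP => /eqP z0.
have [B B0 Bb] := pt_bounded v wU.
(* [B + 1] bounds the square root of [B], whether or not [B] exceeds 1. *)
have coord (c : R) : c ^+ 2 <= B -> - (B + 1) <= c <= B + 1.
  by move=> cB; apply/andP; split; nra.
pose box := `[(0 : R), 1]%classic `*` (`[- (B + 1), B + 1]%classic `*` `[(0 : R), B + 1]%classic).
pose F (t : R * (R * R)) := csqn (ceval q (pt v w t.1 t.2.1 t.2.2)).
have ptR t i : Re (pt v w t.1 t.2.1 t.2.2 0 i) = t.1 * v 0 i + t.2.1 * w 0 i.
  by rewrite !mxE /= !(mul0r, mulr0, mul1r, subr0, addr0, add0r, sub0r).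
have ptI t i : Im (pt v w t.1 t.2.1 t.2.2 0 i) = t.2.2 * w 0 i + e 0 i.
  by rewrite !mxE /= !(mul0r, mulr0, mul1r, subr0, addr0, add0r, sub0r).
have cF : continuous F.
  move=> s; have c1 : t.1 @[t --> s] --> s.1 by exact: cvg_fst.
  have c21 : t.2.1 @[t --> s] --> s.2.1.
    by apply: (cvg_comp snd fst); [exact: cvg_snd|exact: cvg_fst].
  have c22 : t.2.2 @[t --> s] --> s.2.2.
    by apply: (cvg_comp snd snd); [exact: cvg_snd|exact: cvg_snd].
  apply: (@cvg_csqn_ceval _ _ _ (fun t : R * (R * R) => pt v w t.1 t.2.1 t.2.2)
    (pt v w s.1 s.2.1 s.2.2) q (fun i t => t.1 * v 0 i + t.2.1 * w 0 i)
    (fun i t => t.2.2 * w 0 i + e 0 i) _ _ _ (fun i t => ptR t i)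
    (fun i t => ptI t i) (fun i => ptR s i) (fun i => ptI s i)) => i.
  + by apply: cvgD; apply: cvgM => //; exact: cvg_cst.
  + by apply: cvgD; [apply: cvgM => //|]; exact: cvg_cst.
pose K := box `&` F @^-1` [set 0].
have Kc : compact K.
  apply: compact_closedI; first by do 2?apply: compact_setX; exact: segment_compact.
  apply: (continuous_closedP F).1 => //; exact: closed_eq.
have KP t : K t <-> [/\ 0 <= t.1 <= 1, 0 <= t.2.2 & ceval q (pt v w t.1 t.2.1 t.2.2) = 0].
  case: t => b [al be] /=; split=> [[[/= b1 [_ be1]] /= /eqP]|[b1 be1 z1]].
    rewrite /F csqn_eq0 /= => /eqP zz; move: b1 be1; rewrite /= !in_itv /= => -> /andP[-> _].
    by [].
  have B1 := Bb _ _ _ b1 z1.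
  have /andP[h1 h2] : - (B + 1) <= al <= B + 1.
    by apply: coord; apply: le_trans B1; rewrite lerDl sqr_ge0.
  have /andP[h3 h4] : - (B + 1) <= be <= B + 1.
    by apply: coord; apply: le_trans B1; rewrite lerDr sqr_ge0.
  split; last by rewrite /= /F /= z1 /csqn /= expr0n addr0.
  rewrite /box; split; first by rewrite /= in_itv.
  by split; rewrite /= in_itv /= ?h1 ?be1.
have K0 : K !=set0 by exists (b0, (al0, be0)); apply/KP.
have [|[b [al be]]] := compact_EVT_min K0 Kc (f := fst).
  by apply: continuous_subspaceT => t; exact: cvg_fst.
move=> Kbt bmin; have [/= /andP[bb0 bb1] be1 zz] := (KP _).1 (set_mem Kbt).
have be_gt0 : 0 < be.
  rewrite lt_def be1 andbT; apply: contraTneq (pt_real v w b al) => be_0.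
  by rewrite negbK -{1}be_0 zz.
(* At [b = 0] a zero would give, after division by [al +i* be], a real root [t] of [q (w + t e)]
   with [t * be = 1]. Such a [t] is nonnegative, which the cone excludes. *)
have b_gt0 : 0 < b.
  rewrite lt_def bb0 andbT; apply/negP => /eqP b_0.
  move: zz; rewrite /pt b_0 scale0r map_mx0 add0r => zz.
  have a0 : al +i* be != 0 by rewrite eq_complex /= negb_and orbC gt_eqF.
  move: zz; have -> : (al +i* be) *: cv w + 'i *: cv e =
      (al +i* be) *: (cv w + ('i / (al +i* be)) *: cv e).
    by rewrite scalerDr scalerA mulrC divfK.
  rewrite (ceval_homog _ _ qd) => /eqP; rewrite mulf_eq0 expf_eq0 (negbTE a0) andbF /=.
  move=> /eqP wt; have [t tE] := hyperbolic_root qh wt.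
  have iE : 'i = t%:C * (al +i* be) by rewrite -tE divfK.
  have : 1 = t * be by move: iE => /(congr1 Im) /=; rewrite mul0r addr0.
  move=> tbe; have t0 : 0 <= t.
    by rewrite leNgt; apply/negP => tneg; have := ltr01 (R := R); rewrite tbe; nra.
  have /eqP := wU t t0; apply.
  move: wt; rewrite tE -line_complex ceval_real => /(congr1 Re).
  by [].
have w0 : reval q w != 0 := open_hcone_neq0 wU.
have low c : 0 <= c < b -> reval q w ^+ 2 * (be ^+ 2) ^+ d <= F (c, (al, be)).
  move=> /andP[c0 cb]; rewrite /F /= /pt addrAC -[X in X * _]csqn_real -ceval_real.
  apply: csqn_root_bound => //; first exact: sqr_ge0.
  case=> s t; rewrite addrAC => z1.
  have t_lt0 : t < 0.
    rewrite ltNge; apply/negP => t0.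
    have Kc' : K (c, (s, t)) by apply/KP; split => //=; rewrite c0 (le_trans (ltW cb)).
    by have := bmin _ (mem_set Kc'); rewrite /= leNgt cb.
  rewrite /csqn /= -[leLHS]add0r lerD ?sqr_ge0 // ler_sqr ?nnegrE; lra.
have : reval q w ^+ 2 * (be ^+ 2) ^+ d <= F (b, (al, be)).
  have cvF : F (c, (al, be)) @[c --> b^'-] --> F (b, (al, be)).
    apply: cvg_at_left_filter.
    apply: (@cvg_csqn_ceval _ _ _ (fun c => pt v w c al be) (pt v w b al be) q
      (fun i c => c * v 0 i + al * w 0 i) (fun i c => be * w 0 i + e 0 i)
      (fun i => b * v 0 i + al * w 0 i) (fun i => be * w 0 i + e 0 i) _
      (fun i c => ptR (c, (al, be)) i) (fun i c => ptI (c, (al, be)) i)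
      (fun i => ptR (b, (al, be)) i) (fun i => ptI (b, (al, be)) i)) => i.
    - by apply: cvgD; [apply: cvgM; [exact: cvg_id|]|]; exact: cvg_cst.
    - exact: cvg_cst.
  apply: (cvgr_to_ge cvF); near=> c; apply: low; apply/andP; split.
    by apply: ltW; near: c; exact: nbhs_left_gt.
  by near: c; exact: nbhs_left_lt.
rewrite /F /= zz /csqn /= expr0n addr0 leNgt mulr_gt0 //.
  by rewrite exprn_even_gt0.
by rewrite !exprn_gt0.
Unshelve. all: end_near. Qed.
(** Perturb [v] by [dl] times ['i e]. After rescaling by [dl^-1], [pt_lower] at [b = 1] puts the
    zeros below the real axis; letting [dl] tend to 0 leaves only the weak inequality. *)
Lemma garding_Im_le0 v w (z : R[i]) : open_hcone q e w ->
  ceval q (cv v + z *: cv w) = 0 -> Im z <= 0.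
Proof.
move=> wU z0; rewrite leNgt; apply/negP => zI.
have w0 : reval q w != 0 := open_hcone_neq0 wU.
pose F (dl : R) := csqn (ceval q (cv v + (0 +i* dl) *: cv e + z *: cv w)).
have low dl : 0 < dl -> reval q w ^+ 2 * (Im z ^+ 2) ^+ d <= F dl.
  move=> dl0; rewrite /F -[X in X * _]csqn_real -ceval_real.
  apply: csqn_root_bound => //; first exact: sqr_ge0.
  case=> s t z1.
  have t_lt0 : t < 0.
    rewrite ltNge; apply/negP => t0.
    have := @pt_lower (dl^-1 *: v) w wU 1 (s / dl) (t / dl).
    rewrite ler01 lexx divr_ge0 ?(ltW dl0) // => /(_ isT isT)/eqP; apply.
    have <- : (dl^-1)%:C *: (cv v + (0 +i* dl) *: cv e + (s +i* t) *: cv w) =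
        pt (dl^-1 *: v) w 1 (s / dl) (t / dl).
      have dln0 : dl != 0 by rewrite gt_eqF.
      rewrite /pt.
      have -> : (s / dl) +i* (t / dl) = (dl^-1)%:C * (s +i* t).
        by apply/eqP; rewrite eq_complex /=; apply/andP; split; apply/eqP; field.
      have -> : 'i = (dl^-1)%:C * (0 +i* dl) :> R[i].
        by apply/eqP; rewrite eq_complex /=; apply/andP; split; apply/eqP; field.
      rewrite scale1r map_mxZ.
      have scl (U : lmodType R[i]) (a x y : R[i]) (u1 u2 u3 : U) :
          a *: (u1 + x *: u2 + y *: u3) = a *: u1 + (a * y) *: u3 + (a * x) *: u2.
        by rewrite !scalerDr !scalerA addrAC.
      exact: scl.
    by rewrite (ceval_homog _ _ qd) z1 mulr0.
  case: z zI {z0 F} => a b /= zI.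
  by rewrite /csqn /= -[leLHS]add0r lerD ?sqr_ge0 // ler_sqr ?nnegrE; lra.
have cvF : F dl @[dl --> 0^'+] --> F 0.
  apply: cvg_at_right_filter.
  apply: (@cvg_csqn_ceval _ _ _ (fun dl => cv v + (0 +i* dl) *: cv e + z *: cv w)
    (cv v + (0 +i* 0) *: cv e + z *: cv w) q
    (fun i dl => v 0 i + Re z * w 0 i) (fun i dl => dl * e 0 i + Im z * w 0 i)
    (fun i => v 0 i + Re z * w 0 i) (fun i => 0 * e 0 i + Im z * w 0 i)).
  - by move=> i t; rewrite !mxE !ReD !ReM /= !(mul0r, mulr0, mul1r, subr0, addr0, add0r, sub0r).
  - by move=> i t; rewrite !mxE !ImD !ImM /= !(mul0r, mulr0, mul1r, subr0, addr0, add0r, sub0r).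
  - by move=> i; rewrite !mxE !ReD !ReM /= !(mul0r, mulr0, mul1r, subr0, addr0, add0r, sub0r).
  - by move=> i; rewrite !mxE !ImD !ImM /= !(mul0r, mulr0, mul1r, subr0, addr0, add0r, sub0r).
  - by move=> i; exact: cvg_cst.
  - by move=> i; apply: cvgD; [apply: cvgM; [exact: cvg_id|]|]; exact: cvg_cst.
have : reval q w ^+ 2 * (Im z ^+ 2) ^+ d <= F 0.
  apply: (cvgr_to_ge cvF); near=> dl; apply: low; near: dl; exact: nbhs_right_gt.
rewrite /F (_ : 0 +i* 0 = 0) // scale0r addr0 z0 /csqn /= expr0n addr0 leNgt.
rewrite mulr_gt0 //; first by rewrite exprn_even_gt0.
by rewrite !exprn_gt0.
Unshelve. all: end_near. Qed.

(** The opposite inequality is the same statement for [- v] and [- z], as [q] is homogeneous. *)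
Lemma garding_root v w (z : R[i]) : open_hcone q e w ->
  ceval q (cv v + z *: cv w) = 0 -> exists t : R, z = t%:C.
Proof.
move=> wU z0; have h1 := garding_Im_le0 wU z0.
have : Im (- z) <= 0.
  apply: (@garding_Im_le0 (- v) w _ wU).
  by rewrite map_mxN scaleNr -opprD -scaleN1r (ceval_homog _ _ qd) z0 mulr0.
case: z h1 {z0} => a b /= h1 h2; exists a; apply/eqP; rewrite eq_complex /= eqxx /=; lra.
Qed.

(** All roots in the direction [w] are real, and by assumption none is positive, so each lies at
    distance at least 1 from the parameter 1. *)
Lemma garding_monotone w z : open_hcone q e w ->
  (forall t, 0 < t -> reval q (z + t *: w) != 0) ->
  reval q w ^+ 2 <= reval q (z + w) ^+ 2.
Proof.
move=> wU zP; have := @real_root_bound _ _ q d z w qd _ 1 ler01.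
rewrite expr1n expr1n mulr1 scale1r; apply.
move=> s s0; have [t tE] := garding_root wU s0; exists t; split=> //.
rewrite leNgt; apply/negP => /zP/eqP; apply.
by move: s0; rewrite tE -line_complex ceval_real => /(congr1 Re).
Qed.
End Garding.

(** * Gradients and first-order expansions *)

Section Gradient.
Variables (R : realType) (n : nat).
Implicit Types (f g : rpoly R n) (x u v h l : 'rV[R]_n).

Definition gradient f x : 'rV[R]_n := \row_i reval (mderiv i f) x.

Lemma mx_norm_coord x i : `|x 0 i| <= `|x|.
Proof.
rewrite [leRHS]mx_normrE.
exact: (le_bigmax 0 (fun ij : 'I_1 * 'I_n => `|x ij.1 ij.2|) (0, i)).
Qed.

End Gradient.

Section Pairing.
Variables (R : realType) (n : nat).
Implicit Types (l x y : 'rV[R]_n.+1).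

Lemma pairingDr l x y : pairing l (x + y) = pairing l x + pairing l y.
Proof. by rewrite -big_split; apply: eq_bigr => i _; rewrite mxE mulrDr. Qed.

Lemma pairingZr l (a : R) x : pairing l (a *: x) = a * pairing l x.
Proof. by rewrite big_distrr; apply: eq_bigr => i _; rewrite mxE mulrCA. Qed.

Lemma pairingDl l x y : pairing (x + y) l = pairing x l + pairing y l.
Proof. by rewrite -big_split; apply: eq_bigr => i _; rewrite mxE mulrDl. Qed.

Lemma pairingZl l (a : R) x : pairing (a *: x) l = a * pairing x l.
Proof. by rewrite big_distrr; apply: eq_bigr => i _; rewrite mxE -mulrA. Qed.

Lemma pairingNr l x : pairing l (- x) = - pairing l x.
Proof. by rewrite -scaleN1r pairingZr mulN1r. Qed.

Lemma pairing_delta l i : pairing l (delta_mx 0 i) = l 0 i.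
Proof.
rewrite /pairing (bigD1 i) //= mxE !eqxx mulr1 big1 ?addr0 // => j ji.
by rewrite mxE (negbTE ji) andbF mulr0.
Qed.

Lemma pairing_self_gt0 l : l != 0 -> 0 < pairing l l.
Proof.
move=> l0; rewrite lt_def sumr_ge0 ?andbT => [|i _]; last by rewrite -expr2 sqr_ge0.
apply: contra l0 => /eqP l0; apply/eqP/rowP => i; rewrite mxE.
have /psumr_eq0P : forall i, true -> 0 <= l 0 i * l 0 i.
  by move=> j _; rewrite -expr2 sqr_ge0.
by move=> /(_ l0 i isT) /eqP; rewrite mulf_eq0 orbb => /eqP.
Qed.

Lemma pairing_bound l : exists2 K : R, 0 <= K & forall x, `|pairing l x| <= K * `|x|.
Proof.
exists (\sum_i `|l 0 i|); first by rewrite sumr_ge0.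
move=> x; rewrite (le_trans (ler_norm_sum _ _ _)) // big_distrl /=.
by apply: ler_sum => i _; rewrite normrM ler_wpM2l // mx_norm_coord.
Qed.

End Pairing.

Section SecondOrder.
Variables (R : realType) (n : nat).
Implicit Types (f g : rpoly R n.+1) (x u v h l : 'rV[R]_n.+1).

Lemma pairing_gradientM f g x h : pairing (gradient (f * g) x) h =
  pairing (gradient f x) h * reval g x + reval f x * pairing (gradient g x) h.
Proof.
rewrite big_distrl big_distrr -big_split; apply: eq_bigr => i _ /=.
by rewrite !mxE mderivM revalD !revalM; ring.
Qed.

(** A Taylor expansion with quadratic error, built along the ring operations. Nearly all later
    calculus consists of comparing such expansions at small parameters. *)
Lemma second_order f x : exists2 K : R, 0 <= K & forall h, `|h| <= 1 ->
  `|reval f (x + h) - reval f x - pairing (gradient f x) h| <= K * `|h| ^+ 2.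
Proof.
elim/mpoly_ring_ind: f => [c|i|f g [Kf Kf0 fP] [Kg Kg0 gP]|f g [Kf Kf0 fP] [Kg Kg0 gP]].
- exists 0 => // h _; rewrite !revalC subrr sub0r mul0r normrN.
  rewrite /pairing big1 ?normr0 // => i _.
  by rewrite mxE mderivC /reval meval0 mul0r.
- exists 0 => // h _; rewrite !revalX mxE [x 0 i + _]addrC addrK mul0r.
  suff -> : pairing (gradient (mpolyX R (mnm1 i)) x) h = h 0 i by rewrite subrr normr0.
  rewrite /pairing (bigD1 i) //= big1 ?addr0.
    rewrite mxE mderivX mnm1E eqxx scale1r.
    have -> : mnm_sub (mnm1 i) (mnm1 i) = mnm0 (n := n.+1).
      by apply/mnmP => j; rewrite mnmBE mnm0E subnn.
    by rewrite mpolyX0 /reval meval1 mul1r.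
  move=> j ji; rewrite mxE mderivX mnm1E eq_sym (negbTE ji) scale0r.
  by rewrite /reval meval0 mul0r.
- exists (Kf + Kg) => [|h h1]; first exact: addr_ge0.
  have -> : gradient (f + g) x = gradient f x + gradient g x.
    by apply/rowP => j; rewrite !mxE mderivD revalD.
  rewrite pairingDl !revalD mulrDl.
  apply: le_trans (lerD (fP h h1) (gP h h1)); apply: le_trans (ler_normD _ _).
  by rewrite le_eqVlt; apply/orP; left; apply/eqP; congr `|_|; ring.
have [K1 K10 P1] := pairing_bound (gradient f x).
have [K2 K20 P2] := pairing_bound (gradient g x).
(* The three terms bound those of [(F - a - A) * G + (a + A) * (G - b - B) + A * B], where [a], [b]
   are the values at [x], [A], [B] the linear parts and [F], [G] the values at [x + h]. *)
exists (Kf * (`|reval g x| + K2 + Kg) + (`|reval f x| + K1) * Kg + K1 * K2) => [|h h1].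
  by rewrite !addr_ge0 ?mulr_ge0 ?addr_ge0.
rewrite pairing_gradientM !revalM.
move: (fP h h1) (gP h h1) (P1 h) (P2 h).
move: (reval f x) (reval g x) (reval f (x + h)) (reval g (x + h)).
move: (pairing (gradient f x) h) (pairing (gradient g x) h) => A B a b F G.
have h0 : 0 <= `|h| by [].
move: `|h| h0 h1 => t t0 t1 rP sP AP BP.
have t2 : t ^+ 2 <= t by rewrite expr2 ler_piMr.
have t20 : 0 <= t ^+ 2 by exact: sqr_ge0.
have GP : `|G| <= `|b| + K2 + Kg.
  have -> : G = b + B + (G - b - B) by ring.
  apply: le_trans (ler_normD _ _) _; apply: lerD; first apply: le_trans (ler_normD _ _) _.
    by rewrite lerD2l (le_trans BP) // ler_piMr.
  by rewrite (le_trans sP) // ler_piMr // (le_trans t2).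
have aAP : `|a + A| <= `|a| + K1.
  by apply: le_trans (ler_normD _ _) _; rewrite lerD2l (le_trans AP) // ler_piMr.
have -> : F * G - a * b - (A * b + a * B) =
   (F - a - A) * G + (a + A) * (G - b - B) + A * B by ring.
apply: le_trans (ler_normD _ _) _; rewrite [leRHS]mulrDl; apply: lerD.
  apply: le_trans (ler_normD _ _) _; rewrite [leRHS]mulrDl; apply: lerD; rewrite normrM.
    by rewrite mulrAC; apply: ler_pM.
  by rewrite -mulrA; apply: ler_pM.
rewrite normrM; apply: le_trans (ler_pM _ _ AP BP) _ => //.
by rewrite mulrACA expr2.
Qed.

Lemma first_order_ge0 (g K r : R) : 0 < r ->
  (forall t, 0 < t < r -> 0 <= t * g + K * t ^+ 2) -> 0 <= g.
Proof.
move=> r0 H; rewrite leNgt; apply/negP => g0.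
(* Small enough that the quadratic term takes back at most half of [- t * g]. *)
pose t := Num.min (r / 2) (- g / (2 * (`|K| + 1))).
have K1 : 0 < `|K| + 1 by rewrite ltr_wpDl.
have t0 : 0 < t by rewrite lt_min !divr_gt0 ?oppr_gt0 ?mulr_gt0.
have tr : t < r by rewrite gt_min; apply/orP; left; lra.
have tK : t * (`|K| + 1) <= - g / 2.
  rewrite -ler_pdivlMr // [leRHS](_ : _ = - g / (2 * (`|K| + 1))) ?ge_min ?lexx ?orbT //.
  by field; rewrite gt_eqF.
have := H t; rewrite t0 tr => /(_ isT); rewrite expr2 mulrCA -mulrDr pmulr_rge0 //.
have := ler_norm K; nra.
Qed.

End SecondOrder.

(** * The boundary of a hyperbolicity cone *)

Section LocalGeometry.
Variables (R : realType) (n : nat) (p : rpoly R n.+1) (e : 'rV[R]_n.+1) (d : nat).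
Implicit Types (u v w x y z m : 'rV[R]_n.+1) (t : R).
Hypotheses (pd : p \is ishomog1 d mdeg) (ph : hyperbolic p e).
Let U := open_hcone p e.
Let C := closed_hcone p e.
Hypothesis CD : forall x y, C x -> C y -> C (x + y).
Hypothesis CZ : forall t x, 0 <= t -> C x -> C (t *: x).

Definition hcone_boundary (p : rpoly R n.+1) e : set 'rV[R]_n.+1 :=
  [set x | closed_hcone p e x /\ reval p x = 0].
Let B := hcone_boundary p e.

Lemma open_hcone_retract w : U w -> exists2 t, 0 < t & C (w - t *: e).
Proof.
move=> wU; have FF : Filter (nbhs w) := nbhs_filter w.
have Uw : nbhs w U by apply: open_nbhs_nbhs; split => //; exact: (open_hcone_open pd ph).
have H : w - t *: e @[t --> 0^'+] --> w.
  rewrite -[X in _ --> X]addr0 -[X in _ --> w + X]oppr0 -[X in _ --> w + - X](scale0r e).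
  apply: cvgB; [exact: cvg_cst|apply: cvgZr_tmp].
  exact: (cvg_at_right_filter cvg_id).
have /filter_ex[t [Ut t0]] : \forall t \near (0 : R)^'+, U (w - t *: e) /\ 0 < t.
  by apply: filterI; [exact: (H _ Uw)|exact: nbhs_right_gt].
by exists t => //; exact: open_hcone_sub.
Qed.

Lemma hcone_addU x w : C x -> U w -> U (x + w).
Proof.
move=> xC /open_hcone_retract[t t0 wC].
have -> : x + w = (x + (w - t *: e)) + t *: e by rewrite -addrA subrK.
by apply: closed_hcone_shift => //; exact: CD.
Qed.

Lemma open_hconeZ t w : 0 < t -> U w -> U (t *: w).
Proof.
move=> t0 wU s s0; have -> : t *: w + s *: e = t *: (w + (s / t) *: e).
  by rewrite scalerDr scalerA mulrC divfK ?gt_eqF.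
rewrite (reval_homog _ _ pd) mulf_neq0 ?expf_neq0 //; first by rewrite gt_eqF.
by apply: wU; rewrite divr_ge0 // ltW.
Qed.

Lemma interior_hcone : C° = U.
Proof.
apply/seteqP; split=> w.
  move=> wC; have H : w - t *: e @[t --> 0^'+] --> w.
    rewrite -[X in _ --> X]addr0 -[X in _ --> w + X]oppr0 -[X in _ --> w + - X](scale0r e).
    apply: cvgB; [exact: cvg_cst|apply: cvgZr_tmp].
    exact: (cvg_at_right_filter cvg_id).
  have /filter_ex[t [Ct t0]] : \forall t \near (0 : R)^'+, C (w - t *: e) /\ 0 < t.
    by apply: filterI; [exact: (H _ wC)|exact: nbhs_right_gt].
  by rewrite -[w](subrK (t *: e)); exact: closed_hcone_shift.
move=> wU; have Uw : nbhs w U.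
  by apply: open_nbhs_nbhs; split => //; exact: (open_hcone_open pd ph).
exact: (filterS (@open_hcone_sub _ _ p e) Uw).
Qed.

Lemma boundary_hcone : boundary C = B.
Proof.
rewrite /boundary interior_hcone -(closure_id _).1; last exact: (closed_hcone_closed pd ph).
apply/seteqP; split=> x [xC xP]; split=> //.
  by apply/eqP; apply: contrapT => /negP x0; exact/xP/closed_hcone_neq0.
by move/open_hcone_neq0; rewrite xP eqxx.
Qed.

(* The boundary is a Lipschitz graph in the direction [e]. *)
Lemma boundary_graph : exists2 K, 0 <= K & forall x u, B x ->
  exists2 t, `|t| <= K * `|u| & B (x + u + t *: e).
Proof.
have eU : U e := open_hcone_e pd ph.
have /nbhs_ballP[r /= r0 rU] : nbhs e U.
  by apply: open_nbhs_nbhs; split => //; exact: (open_hcone_open pd ph).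
(* A ball of radius [r] about [e] lies in the cone. Scaled by [t], it contains [t *: e + u] as soon
   as [t * r] exceeds the norm of [u]; the factor 2 leaves room. *)
have big u t : 2 / r * `|u| < t -> U (u + t *: e).
  move=> ut; have t0 : 0 < t by apply: le_lt_trans ut; rewrite mulr_ge0 // divr_ge0 // ltW.
  have -> : u + t *: e = t *: (e + t^-1 *: u).
    by rewrite scalerDr scalerA divff ?gt_eqF // scale1r addrC.
  apply: open_hconeZ => //; apply: rU; rewrite -ball_normE /= opprD addrA subrr sub0r normrN.
  rewrite normrZ normfV (gtr0_norm t0) mulrC ltr_pdivrMr //.
  by move: ut; rewrite mulrAC ltr_pdivrMr // mulrC [t * r]mulrC => h; have := normr_ge0 u; lra.
exists (2 / r); first by rewrite divr_ge0 // ltW.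
move=> x u [xC x0]; set K := 2 / r.
(* The boundary point is at the lowest height in the cone. Below minus [K] times the norm of [u],
   adding back an interior vector would make [x] interior. *)
pose S := [set t | C (x + u + t *: e)].
have Sup t : K * `|u| < t -> S t.
  by move=> ut; rewrite /S /= -addrA; apply: open_hcone_sub; apply: hcone_addU => //; exact: big.
have Slow t : S t -> - (K * `|u|) <= t.
  rewrite /S /= => St; rewrite leNgt; apply/negP => tu.
  have : U x.
    have -> : x = (x + u + t *: e) + ((- u) + (- t) *: e).
      by rewrite scaleNr addrACA subrr addr0 -addrA subrr addr0.
    by apply: hcone_addU => //; apply: big; rewrite normrN ltrNr.
  by move/open_hcone_neq0; rewrite x0 eqxx.
have Slb : has_lbound S by exists (- (K * `|u|)) => t /Slow.
have S0 : S !=set0 by exists (K * `|u| + 1); apply: Sup; lra.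
have Sinf : has_inf S by [].
have tC : C (x + u + inf S *: e).
  move=> t t0; have [s Ss st] := inf_adherent t0 Sinf.
  have -> : x + u + inf S *: e + t *: e = (x + u + s *: e) + (inf S + t - s) *: e.
    by rewrite -!addrA -!scalerDl; congr (_ + (_ + _ *: _)); ring.
  by apply: Ss; rewrite subr_gt0.
exists (inf S).
  rewrite ler_norml lb_le_inf //=; apply/ler_addgt0Pl => s s0.
  by apply: ge_inf => //; apply: Sup; lra.
split=> //; apply/eqP; apply: contrapT => /negP n0.
have [s s0 sC] := open_hcone_retract (closed_hcone_neq0 tC n0).
have : inf S <= inf S - s.
  by apply: ge_inf => //; rewrite /S /= scalerBl addrA.
lra.
Qed.

(** From an interior point one can step a little against [m] and stay in the cone, and the step
    strictly lowers the value of [m]. *)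
Lemma dual_gt0 m w : (forall x, C x -> 0 <= pairing m x) -> m != 0 -> U w ->
  0 < pairing m w.
Proof.
move=> mC m0 wU.
have /nbhs_ballP[r /= r0 rU] : nbhs w U.
  by apply: open_nbhs_nbhs; split => //; exact: (open_hcone_open pd ph).
have mn0 : 0 < `|m| by rewrite normr_gt0.
pose t := r / (2 * `|m|).
have t0 : 0 < t by rewrite divr_gt0 // mulr_gt0.
have : U (w - t *: m).
  apply: rU; rewrite -ball_normE /= opprB addrC subrK normrZ (gtr0_norm t0) /t.
  rewrite invfM mulrA mulfVK ?gt_eqF //; lra.
move/open_hcone_sub/mC; rewrite pairingDr pairingNr pairingZr => h.
have := pairing_self_gt0 m0 => mm.
by have := mulr_gt0 t0 mm; lra.
Qed.

End LocalGeometry.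

Section Divisor.
Variables (R : realType) (n : nat) (p q s : rpoly R n.+1) (e : 'rV[R]_n.+1).
Hypotheses (ph : hyperbolic p e) (pE : p = s * q).

Lemma hyperbolic_divisor : hyperbolic q e.
Proof.
case: ph => e0 rP; split=> [|x z qz].
  by move: e0; rewrite pE revalM mulf_eq0 negb_or => /andP[].
apply: (rP x); rewrite pE /along_line (rmorphM (mmap (@polyC R) _)) rmorphM.
by rewrite rootM qz orbT.
Qed.

Lemma open_hcone_divisor : open_hcone p e `<=` open_hcone q e.
Proof.
move=> w wU t /wU; rewrite pE revalM mulf_eq0 negb_or => /andP[] //.
Qed.
End Divisor.

(** * Normals at smooth boundary points and their transfer along faces *)

Section SmoothBoundary.
Variables (R : realType) (n : nat) (p q : rpoly R n.+1) (e : 'rV[R]_n.+1) (d k : nat).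
Implicit Types (u v w x y z m : 'rV[R]_n.+1) (t : R).
Hypotheses (pd : p \is ishomog1 d mdeg) (ph : hyperbolic p e).
Hypotheses (qk : q \is ishomog1 k mdeg) (qh : hyperbolic q e).
Let U := open_hcone p e.
Let C := closed_hcone p e.
Let B := hcone_boundary p e.
Hypothesis CD : forall x y, C x -> C y -> C (x + y).
Hypothesis CZ : forall t x, 0 <= t -> C x -> C (t *: x).
Hypothesis UqU : U `<=` open_hcone q e.
Hypothesis qe : 0 < reval q e.
Hypothesis qB : forall x, B x -> reval q x = 0.

Lemma hcone_gt0 w : U w -> 0 < reval q w.
Proof.
move=> /UqU wU; rewrite ltNge; apply/negP => w0.
pose f (t : R) := reval q ((1 - t) *: w + t *: e).
have cf : continuous f.
  move=> t; apply: cvg_reval => i; rewrite !mxE; under eq_fun do rewrite !mxE.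
  apply: cvgD; apply: cvgM; do ?[exact: cvg_cst]; last exact: cvg_id.
  by apply: cvgB; [exact: cvg_cst|exact: cvg_id].
have f0 : f 0 = reval q w by rewrite /f subr0 scale0r addr0 scale1r.
have f1 : f 1 = reval q e by rewrite /f subrr scale0r add0r scale1r.
have [||t t01 ft] := @IVT R f 0 1 0 ler01.
- exact: continuous_subspaceT.
- by rewrite f0 f1 ge_min le_max w0 (ltW qe) orbT.
have := (open_hcone_segment qk qh w).1 wU t; move: t01; rewrite in_itv /= => -> /(_ isT).
by rewrite -/(f t) ft eqxx.
Qed.

Lemma hcone_ge0 x : C x -> 0 <= reval q x.
Proof.
move=> xC.
have H : reval q (x + t *: e) @[t --> 0^'+] --> reval q x.
  apply: cvg_at_right_filter.
  rewrite -[X in _ --> reval q X]addr0 -(scale0r e).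
  apply: cvg_reval => i; rewrite !mxE; under eq_fun do rewrite !mxE.
  by apply: cvgD; [exact: cvg_cst|apply: cvgM; [exact: cvg_id|exact: cvg_cst]].
apply: (cvgr_to_ge H); near=> t; apply/ltW/hcone_gt0/closed_hcone_shift => //.
Unshelve. all: end_near. Qed.

Lemma line_expansion x v : exists2 r, 0 < r & exists2 K, 0 <= K &
  forall t, 0 < t < r -> `|reval q (x + t *: v) - reval q x -
    t * pairing (gradient q x) v| <= K * t ^+ 2.
Proof.
have [K K0 KP] := second_order q x.
have v1 : 0 < `|v| + 1 by rewrite ltr_wpDl.
exists (`|v| + 1)^-1; first by rewrite invr_gt0.
exists (K * `|v| ^+ 2) => [|t /andP[t0 tv]]; first by rewrite mulr_ge0 ?sqr_ge0.
have nt : `|t *: v| = t * `|v| by rewrite normrZ gtr0_norm.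
have := KP (t *: v); rewrite nt pairingZr exprMn [t ^+ 2 * _]mulrC mulrA; apply.
have : t * (`|v| + 1) < 1 by rewrite -ltr_pdivlMr // div1r.
by have := normr_ge0 v; nra.
Qed.

(** [q] vanishes at [x] and is nonnegative on the cone, so it cannot decrease to first order into
    the cone. *)
Lemma gradient_dual x c : B x -> C c -> 0 <= pairing (gradient q x) c.
Proof.
move=> xB cC; have [r r0 [K K0 KP]] := line_expansion x c.
apply: (@first_order_ge0 _ _ K r) => // t tr; have /andP[t0 _] := tr.
have q0 : 0 <= reval q (x + t *: c).
  by apply: hcone_ge0; apply: CD; [case: xB|apply: CZ => //; exact: ltW].
have := KP t tr; rewrite (qB xB) ler_norml => /andP[_]; lra.
Qed.

Lemma gradient_e_gt0 x : B x -> gradient q x != 0 -> 0 < pairing (gradient q x) e.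
Proof.
move=> xB g0; apply: (dual_gt0 pd ph) (open_hcone_e pd ph) => // c.
exact: gradient_dual.
Qed.

Lemma gradient_self x : B x -> pairing (gradient q x) x = 0.
Proof.
move=> xB; have xC : C x by case: xB.
apply/le_anti; rewrite gradient_dual // andbT.
have [r r0 [K K0 KP]] := line_expansion x x.
rewrite -oppr_ge0; apply: (@first_order_ge0 _ _ K r) => // t tr.
have := KP t tr; rewrite -{1}[x]scale1r -scalerDl (reval_homog _ _ qk) (qB xB) mulr0.
rewrite ler_norml; lra.
Qed.

(** Move [x] by [t v] and return to the boundary by some [c e] with [c = O(t)]. There [m] is
    nonnegative and [q] vanishes, the latter tying [c] to the gradient up to [O(t ^ 2)]. Eliminating
    [c] gives an inequality linear in [v]; with [- v] it becomes an equality. *)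
Lemma dual_unique x m : B x -> gradient q x != 0 ->
  (forall c, C c -> 0 <= pairing m c) -> pairing m x = 0 ->
  m = (pairing m e / pairing (gradient q x) e) *: gradient q x.
Proof.
move=> xB g0 mC mx; set g := gradient q x.
have ge : 0 < pairing g e by exact: gradient_e_gt0.
have me : 0 <= pairing m e by apply: mC; apply: open_hcone_sub; exact: (open_hcone_e pd ph).
have [K K0 KP] := boundary_graph pd ph CD.
have [L L0 LP] := second_order q x.
have le v : 0 <= pairing m v * pairing g e - pairing g v * pairing m e.
  (* Bounds the displacement by [t * M]. For [t] below [M^-1] it has norm less than 1, the range of
     [second_order]. *)
  pose M := `|v| + K * `|v| * `|e| + 1.
  have M1 : 1 <= M by rewrite /M lerDr addr_ge0 ?mulr_ge0.
  have M0 : 0 < M by apply: lt_le_trans M1.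
  apply: (@first_order_ge0 _ _ (pairing m e * L * M ^+ 2) M^-1); first by rewrite invr_gt0.
  move=> t /andP[t0 tM].
  have [c cK [yC y0]] := KP x (t *: v) xB.
  have tM1 : t * M < 1 by rewrite -ltr_pdivlMr // div1r.
  have hM : `|t *: v + c *: e| <= t * M.
    rewrite (le_trans (ler_normD _ _)) // !normrZ (gtr0_norm t0) /M !mulrDr mulr1.
    have : `|c| * `|e| <= t * (K * `|v| * `|e|).
      rewrite !mulrA ler_wpM2r //.
      by move: cK; rewrite normrZ (gtr0_norm t0) mulrA [K * t]mulrC.
    by lra.
  have qy : reval q (x + (t *: v + c *: e)) = 0 by apply: qB; rewrite addrA.
  have := LP _ (le_trans hM (ltW tM1)); rewrite qy (qB xB) subrr sub0r normrN.
  rewrite -/g pairingDr !pairingZr => h1.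
  have h2 : `|t * pairing g v + c * pairing g e| <= L * (t * M) ^+ 2.
    by apply: le_trans h1 _; rewrite ler_wpM2l // ler_sqr ?nnegrE // mulr_ge0 // ltW.
  have := mC _ yC; rewrite !pairingDr !pairingZr mx add0r => h3.
  move: h2; rewrite ler_norml => /andP[_ h2].
  have h4 : 0 <= (t * pairing m v + c * pairing m e) * pairing g e by rewrite mulr_ge0 // ltW.
  have h5 : (t * pairing g v + c * pairing g e) * pairing m e <= L * (t * M) ^+ 2 * pairing m e.
    by rewrite ler_wpM2r.
  have -> : pairing m e * L * M ^+ 2 * t ^+ 2 = L * (t * M) ^+ 2 * pairing m e by ring.
  by lra.
have eqv v : pairing m v * pairing g e = pairing g v * pairing m e.
  apply/le_anti; have := le v; have := le (- v); rewrite !pairingNr; lra.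
apply/rowP => i; rewrite mxE -!pairing_delta.
by rewrite mulrAC [_ * pairing g _]mulrC -eqv mulfK // gt_eqF.
Qed.

(* Smoothness propagates from [x] to the relative interior of any face through
   [x]: this is where hyperbolicity (via Garding's theorem) is used. *)
Lemma gradient_transfer x z t : B x -> gradient q x != 0 -> C z -> 0 < t ->
  B (t *: x + z) -> exists2 c, 0 < c & gradient q (t *: x + z) = c *: gradient q x.
Proof.
move=> xB g0 zC t0 yB; set y := t *: x + z; have xC : C x by case: xB.
have gye : 0 < pairing (gradient q y) e.
  have gxe := gradient_e_gt0 xB g0.
  have [r1 r10 [K1 K10 P1]] := line_expansion x e.
  have [r2 r20 [K2 K20 P2]] := line_expansion y (t *: e).
  have tk0 : 0 < t ^+ k by exact: exprn_gt0.
  (* The two sides are the first-order coefficients in [a] of [q (y + a t e)] and of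
     [q (t (x + a e))], which equals [t ^+ k * q (x + a e)]. *)
  suff : 0 <= t * pairing (gradient q y) e - t ^+ k * pairing (gradient q x) e.
    have := mulr_gt0 tk0 gxe; move=> h1 h2; rewrite -(pmulr_rgt0 _ t0); lra.
  apply: (@first_order_ge0 _ _ (K2 + t ^+ k * K1) (Num.min r1 r2)).
    by rewrite lt_min r10.
  move=> a /andP[a0]; rewrite lt_min => /andP[a1 a2].
  have xa : U (x + a *: e) by exact: closed_hcone_shift.
  have wU : U (t *: (x + a *: e)) by exact: (open_hconeZ pd).
  (* Based at [z], in the interior direction [t (x + a e)]: adding [z] does not decrease [q]. *)
  have := @garding_monotone _ _ q e k qk qh (t *: (x + a *: e)) z (UqU wU).
  have -> : z + t *: (x + a *: e) = y + a *: (t *: e).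
    by rewrite scalerDr addrCA addrA scalerA [t * a]mulrC -scalerA.
  move=> /(_ _)h.
  have {h} : reval q (t *: (x + a *: e)) <= reval q (y + a *: (t *: e)).
    have yU : U (y + a *: (t *: e)).
      by rewrite scalerA; apply: closed_hcone_shift; [case: yB|exact: mulr_gt0].
    have hz b : 0 < b -> reval q (z + b *: (t *: (x + a *: e))) != 0.
      move=> b0; rewrite gt_eqF // hcone_gt0 //.
      by apply: (hcone_addU pd ph CD zC); exact: (open_hconeZ pd).
    by move: (h hz); rewrite ler_sqr // nnegrE; apply: ltW; exact: hcone_gt0.
  rewrite (reval_homog _ _ qk).
  have := P1 a; rewrite a0 a1 (qB xB) => /(_ isT); rewrite ler_norml => /andP[h1 _].
  have := P2 a; rewrite a0 a2 (qB yB) pairingZr => /(_ isT); rewrite ler_norml => /andP[_ h2] h3.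
  have h4 : t ^+ k * (a * pairing (gradient q x) e - K1 * a ^+ 2) <= t ^+ k * reval q (x + a *: e).
    by rewrite ler_pM2l //; lra.
  by lra.
have gy0 : gradient q y != 0.
  apply: contraTneq gye => ->; rewrite /pairing big1 ?ltxx // => i _.
  by rewrite mxE mul0r.
exists (pairing (gradient q y) e / pairing (gradient q x) e).
  by rewrite divr_gt0 // gradient_e_gt0.
apply: dual_unique => //; first by move=> c; exact: gradient_dual.
(* Both contributions, from [t *: x] and from [z], are nonnegative and sum to 0. Hence the gradient
   at [y] vanishes at [x], as [dual_unique] requires. *)
have : pairing (gradient q y) (t *: x + z) = 0 := gradient_self yB.
rewrite pairingDr pairingZr.
have h1 : 0 <= pairing (gradient q y) x := gradient_dual yB xC.
have h2 : 0 <= pairing (gradient q y) z := gradient_dual yB zC.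
have h3 := mulr_ge0 (ltW t0) h1 => h4.
have /eqP : t * pairing (gradient q y) x = 0 by lra.
by rewrite mulf_eq0 gt_eqF //= => /eqP.
Qed.

End SmoothBoundary.

(** * The vanishing ideal of the boundary *)

Lemma poly_small_nonroot (K : realFieldType) (f : {poly K}) (r : K) :
  f != 0 -> 0 < r -> exists2 x, 0 < x < r & f.[x] != 0.
Proof.
move=> f0 r0; apply: contrapT => nx.
pose s : seq K := [seq r / (i.+2)%:R | i <- iota 0 (size f)].
have rs : all (root f) s.
  apply/allP => _ /mapP[i _ ->]; rewrite rootE; apply: contrapT => /negP x0.
  apply: nx; exists (r / i.+2%:R) => //.
  by rewrite divr_gt0 ?ltr0n //= ltr_pdivrMr ?ltr0n // ltr_pMr // ltr1n.
have us : uniq s.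
  rewrite map_inj_uniq ?iota_uniq // => i j /(mulfI (lt0r_neq0 r0)) /invr_inj /eqP.
  by rewrite eqr_nat => /eqP[].
by have := max_poly_roots f0 rs us; rewrite size_map size_iota ltnn.
Qed.

Lemma prod_primes_dvd (D : idomainType) (s : seq D) (h : D) :
  (forall x, x \in s -> prime_elt x) ->
  (forall x, x \in s -> ~ rdvd x (\prod_(y <- rem x s) y)) ->
  (forall x, x \in s -> rdvd x h) -> rdvd (\prod_(y <- s) y) h.
Proof.
elim: s => [|a s IHs] sP sq sh; first by rewrite big_nil; exists h; rewrite mulr1.
have [|||h1 hE] := IHs.
- by move=> x xs; apply: sP; rewrite in_cons xs orbT.
- move=> x xs xr; have xas : x \in a :: s by rewrite in_cons xs orbT.
  apply: (sq x xas); rewrite /=; case: ifP => [_|ax].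
    by rewrite (perm_big _ (perm_to_rem xs)) big_cons; apply: rdvd_mulr; exact: rdvd_refl.
  by rewrite big_cons; exact: rdvd_mull.
- by move=> x xs; apply: sh; rewrite in_cons xs orbT.
have aas : a \in a :: s by rewrite mem_head.
have [_ _ aP] := sP a aas.
have [|[h2 h2E]|as'] := aP h1 (\prod_(y <- s) y); first by rewrite -hE; exact: sh.
  by exists h2; rewrite hE h2E big_cons mulrA.
by case: (sq a aas); rewrite /= eqxx.
Qed.

Section BoundaryIdeal.
Variables (R : realType) (n : nat) (p : rpoly R n.+1) (e : 'rV[R]_n.+1) (d : nat).
Hypotheses (pd : p \is ishomog1 d mdeg) (ph : hyperbolic p e) (e0 : e != 0).
Let C := closed_hcone p e.
Let B := hcone_boundary p e.
Hypothesis CD : forall x y, C x -> C y -> C (x + y).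

(** On the line from [x] towards a point where [c] is nonzero, [c] is nonzero at arbitrarily small
    parameters. Correcting along [e] to reach the boundary does not change [c], so [f] vanishes at
    boundary points arbitrarily close to [x]; continuity concludes. *)
Lemma boundary_cancel_invariant (c f : rpoly R n.+1) : c != 0 ->
  (forall (v : 'rV[R]_n.+1) t, reval c (v + t *: e) = reval c v) ->
  (forall x, B x -> reval (c * f) x = 0) -> forall x, B x -> reval f x = 0.
Proof.
move=> c0 ce cf x xB; apply: contrapT => /eqP fx0.
have [v0 v0c] := mpoly_nonroot c0.
pose v : 'rV[R]_n.+1 := \row_i v0 i.
have vc : reval c v != 0.
  by rewrite /reval (meval_eq (v2 := v0)) // => i; rewrite mxE.
pose u := v - x.
have l0 : along_line c x u != 0.
  apply: contra vc => /eqP l0; rewrite -[v](subrK x) addrC -/u -[u]scale1r.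
  by rewrite -horner_along_line l0 horner0.
have [K K0 KP] := boundary_graph pd ph CD.
have /nbhs_ballP[r /= r0 rf] : \forall y \near x, reval f y != 0.
  have FF : Filter (nbhs x) := nbhs_filter x.
  exact: (@cvgr_neq0 R R^o _ (nbhs x) FF (reval f) _ (@continuous_reval R n.+1 f x) fx0).
(* Makes the total displacement, along [u] and then along [e], less than [t * M]. *)
pose M := `|u| + K * `|u| * `|e| + 1.
have M0 : 0 < M by rewrite ltr_wpDl // addr_ge0 // ?mulr_ge0.
have [t /andP[t0 tr] tc] := poly_small_nonroot l0 (divr_gt0 r0 M0).
have [s sK yB] := KP x (t *: u) xB.
have /eqP := cf _ yB; rewrite revalM ce -horner_along_line mulf_eq0 (negbTE tc) /=.
apply/negP; apply: rf; rewrite -ball_normE /= -addrA opprD addrA subrr sub0r normrN.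
rewrite (le_lt_trans (ler_normD _ _)) // !normrZ (gtr0_norm t0).
move: tr; rewrite ltr_pdivlMr // /M !mulrDr mulr1.
have : `|s| * `|e| <= t * (K * `|u| * `|e|).
  rewrite !mulrA ler_wpM2r //.
  by move: sK; rewrite normrZ (gtr0_norm t0) mulrA [K * t]mulrC.
by lra.
Qed.

(** Let [h] vanish on the boundary and let a factor [f] of [q] not divide [h]. Multiplying the
    Bezout identity of [f] and [h] by the cofactor of [f] gives a form of zero on the boundary;
    cancelling the invariant constant, the cofactor itself vanishes there, against the minimality of
    [s]. *)
Lemma boundary_ideal : exists s : seq (rpoly R n.+1),
  let q := \prod_(f <- s) f in
  [/\ forall f, f \in s -> prime_elt f, rdvd q p,
      forall f, f \in s -> ~ rdvd f (\prod_(g <- rem f s) g) &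
      forall h, (forall x, B x -> reval h x = 0) <-> rdvd q h].
Proof.
have p0 : p != 0.
  by case: ph => pe _; apply: contra pe => /eqP->; rewrite /reval meval0.
pose P k := `[< exists s : seq (rpoly R n.+1), [/\ size s = k,
  forall f, f \in s -> prime_elt f, rdvd (\prod_(f <- s) f) p &
  forall x, B x -> reval (\prod_(f <- s) f) x = 0] >].
have exP : exists k, P k.
  have [u [s [uU sP pE]]] := factorial_mpoly p0.
  exists (size s); apply/asboolP; exists s; split=> //; first by exists u.
  move=> x [_]; rewrite pE revalM => /eqP; rewrite mulf_eq0 => /predU1P[ux|/eqP//].
  have : reval u x * reval u^-1 x = 1 by rewrite -revalM mulrV // /reval meval1.
  by rewrite ux mul0r => /eqP; rewrite eq_sym oner_eq0.
case: (ex_minnP exP) => k /asboolP[s [sk sP sp sB]] kmin.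
exists s => q.
have nB f : f \in s -> ~ forall x, B x -> reval (\prod_(g <- rem f s) g) x = 0.
  move=> fs H; suff : (k <= size (rem f s))%N.
    by rewrite size_rem // -sk; case: (s) fs => //= a l _; rewrite ltnn.
  apply: kmin; apply/asboolP; exists (rem f s); split=> //.
    by move=> g /mem_rem/sP.
  apply: rdvd_trans sp; rewrite (perm_big _ (perm_to_rem fs)) big_cons.
  exact: rdvd_mull (rdvd_refl _).
have qE f : f \in s -> q = f * \prod_(g <- rem f s) g.
  by move=> fs; rewrite /q (perm_big _ (perm_to_rem fs)) big_cons.
have sqf f : f \in s -> ~ rdvd f (\prod_(g <- rem f s) g).
  move=> fs [c fc]; apply: (nB f fs) => x xB.
  have := sB x xB; rewrite -/q (qE f fs) revalM => /eqP; rewrite mulf_eq0.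
  by move=> /predU1P[fx|/eqP//]; rewrite fc revalM fx mulr0.
split=> // h; split=> [hB|[c ->] x xB]; last by rewrite revalM sB // mulr0.
apply: prod_primes_dvd => // f fs; apply: contrapT => nfh.
have [|a [b [c [c0 cE ce]]]] := mpoly_bezout (e := fun i => e 0 i) _ (sP f fs) nfh.
  apply: contrapT => ne; case/eqP: e0; apply/rowP => i; rewrite mxE.
  by apply: contrapT => /eqP ei; apply: ne; exists i.
apply: (nB f fs); apply: (boundary_cancel_invariant c0).
  move=> v t; rewrite /reval -[RHS](ce _ t); apply: meval_eq => i.
  by rewrite !mxE.
move=> x xB; rewrite cE mulrDl revalD -mulrA -(qE f fs) !revalM sB // hB //.
by rewrite !(mulr0, mul0r) addr0.
Qed.

End BoundaryIdeal.

(** * Projective hypersurfaces *)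

Section ProjectivePoints.
Variables (K : fieldType) (n : nat).

Lemma proj_of_eq (u v : nzvec K n) :
  proj_of u = proj_of v <-> exists2 c, c != 0 & val u = c *: val v.
Proof.
have E : (proj_of u = proj_of v) <-> same_line u v.
  by split=> [/eqP|uv]; [|apply/eqP]; rewrite /proj_of eqmodE.
rewrite E; split=> [/andP[/sub_rVP[c uE] _]|[c c0 uE]].
  by exists c => //; apply: contraTneq (valP u) => c0; rewrite uE c0 scale0r eqxx.
apply/andP; split; apply/sub_rVP; first by exists c.
by exists c^-1; rewrite uE scalerA mulVf // scale1r.
Qed.

Lemma proj_of_repr (x : projspace K n) : proj_of (repr x) = x.
Proof. exact: reprK. Qed.

Lemma vec_of_proj (v : nzvec K n) : exists2 c, c != 0 & vec_of (proj_of v) = c *: val v.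
Proof. by apply/proj_of_eq; exact: proj_of_repr. Qed.

Lemma vec_of_neq0 (x : projspace K n) : vec_of x != 0.
Proof. exact: valP (repr x). Qed.

End ProjectivePoints.

Section Hypersurfaces.
Variables (R : realType) (n : nat).
Local Notation cv := (map_mx (real_complex R)).
Local Notation PC := (projspace R[i] n).
Implicit Types (f g : rpoly R n.+1) (z : PC) (X Y Z : set PC).

Lemma vec_of_complexify (x : projspace R n) :
  exists2 c, c != 0 & vec_of (complexify x) = c *: cv (vec_of x).
Proof. exact: vec_of_proj. Qed.

Lemma complexify_eval f k (v : nzvec R n) : f \is ishomog1 k mdeg ->
  (ceval f (vec_of (complexify (proj_of v))) = 0) <-> (reval f (val v) = 0).
Proof.
move=> fk; have [c c0 ->] := vec_of_complexify (proj_of v).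
have [a a0 ->] := vec_of_proj v.
rewrite (ceval_homog _ _ fk) ceval_real (reval_homog _ _ fk).
split=> [/eqP|->]; last by rewrite mulr0 rmorph0 mulr0.
rewrite mulf_eq0 expf_eq0 (negbTE c0) andbF /= (fmorph_eq0 (real_complex R)).
by rewrite mulf_eq0 expf_eq0 (negbTE a0) andbF => /eqP.
Qed.

Definition hypersurface f : set PC := [set z | ceval f (vec_of z) = 0].

Lemma hypersurface_variety f : homogeneous f -> real_variety (hypersurface f).
Proof.
move=> fh; exists [set f] => [g ->//|].
by apply/seteqP; split=> [z zf g ->|z zf]; [|exact: zf].
Qed.

Lemma hypersurface_dvd f g : rdvd f g -> hypersurface f `<=` hypersurface g.
Proof. by case=> h -> z zf; rewrite /hypersurface /= cevalM zf mulr0. Qed.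

Lemma hypersurfaceM f g : hypersurface (f * g) = hypersurface f `|` hypersurface g.
Proof.
apply/seteqP; split=> z; rewrite /hypersurface /= cevalM.
  by move=> /eqP; rewrite mulf_eq0 => /orP[/eqP|/eqP]; [left|right].
by case=> ->; rewrite ?mul0r ?mulr0.
Qed.

Lemma homogeneousM f g : homogeneous f -> homogeneous g -> homogeneous (f * g).
Proof. by move=> [i fi] [j gj]; exists (i + j)%N; exact: dhomogM. Qed.

Lemma homogeneous1 : homogeneous (1 : rpoly R n.+1).
Proof. by exists 0%N; exact: dhomog1. Qed.

Lemma homogeneous_prod (s : seq (rpoly R n.+1)) :
  (forall f, f \in s -> homogeneous f) -> homogeneous (\prod_(f <- s) f).
Proof.
move=> sh; rewrite big_seq; elim/big_ind: _ => //; first exact: homogeneous1.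
exact: homogeneousM.
Qed.

Lemma real_varietyI X Y : real_variety X -> real_variety Y -> real_variety (X `&` Y).
Proof.
move=> [S Sh ->] [T Th ->]; exists (S `|` T) => [f [/Sh|/Th]//|].
apply/seteqP; split=> [z [zS zT] f [/zS|/zT]//|z zST].
by split=> f fS; apply: zST; [left|right].
Qed.

Lemma irreducible_vanish Z f g : irreducible_variety Z ->
  homogeneous f -> homogeneous g -> Z `<=` hypersurface (f * g) ->
  Z `<=` hypersurface f \/ Z `<=` hypersurface g.
Proof.
move=> [Zv _ Zi] fh gh Zfg.
have [|||ZE|ZE] := Zi (Z `&` hypersurface f) (Z `&` hypersurface g).
- by apply: real_varietyI => //; exact: hypersurface_variety.
- by apply: real_varietyI => //; exact: hypersurface_variety.
- by rewrite -setIUr -hypersurfaceM; apply/esym/setIidl.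
- by left; rewrite ZE => z [].
- by right; rewrite ZE => z [].
Qed.

Lemma irreducible_vanish_prod Z (s : seq (rpoly R n.+1)) : irreducible_variety Z ->
  (forall f, f \in s -> homogeneous f) -> Z `<=` hypersurface (\prod_(f <- s) f) ->
  exists2 f, f \in s & Z `<=` hypersurface f.
Proof.
move=> Zi; elim: s => [|f s IHs] sh.
  have [_ [z zZ] _] := Zi; rewrite big_nil => /(_ z zZ).
  rewrite /hypersurface /= -(mpolyC1 n.+1) cevalC => /eqP.
  by rewrite (fmorph_eq0 (real_complex R)) oner_eq0.
rewrite big_cons => /(irreducible_vanish Zi) [||Zf|/IHs[]].
- by apply: sh; rewrite mem_head.
- by apply: homogeneous_prod => g gs; apply: sh; rewrite in_cons gs orbT.
- by exists f; rewrite ?mem_head.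
- by move=> g gs; apply: sh; rewrite in_cons gs orbT.
- by move=> g gs Zg; exists g; rewrite // in_cons gs orbT.
Qed.

Lemma irreducible_component_self X Y : irreducible_variety X ->
  irreducible_component X Y <-> Y = X.
Proof.
move=> Xi; split=> [[_ YX Ym]|->]; first by rewrite -(Ym X).
by split=> // Z _ ZX XZ; apply/seteqP; split.
Qed.

Lemma ceval_deriv_dvd f g (h : rpoly R n.+1) (z : 'rV[R[i]]_n.+1) i : f = h * g -> ceval g z = 0 ->
  ceval (mderiv i f) z = ceval h z * ceval (mderiv i g) z.
Proof. move=> -> g0; rewrite mderivM; apply: etrans (cevalD _ _ _) _.
apply: etrans (congr2 +%R (cevalM _ _ _) (cevalM _ _ _)) _.
move: (ceval (mderiv i h) z) (ceval (mderiv i g) z) (ceval h z) => a b c.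
by rewrite g0 mulr0 add0r. Qed.

End Hypersurfaces.

(** * Irreducible components of the algebraic boundary *)

Section BoundaryComponents.
Variables (R : realType) (n : nat) (p : rpoly R n.+1) (B : set 'rV[R]_n.+1).
Variable s : seq (rpoly R n.+1).
Let q := \prod_(f <- s) f.
Hypothesis ph : homogeneous p.
Hypothesis p0 : p != 0.
Hypothesis sP : forall f, f \in s -> prime_elt f.
Hypothesis qp : rdvd q p.
Hypothesis sqf : forall f, f \in s -> ~ rdvd f (\prod_(g <- rem f s) g).
Hypothesis Bq : forall h, (forall x, B x -> reval h x = 0) <-> rdvd q h.
Hypothesis Bn0 : exists2 x, B x & x != 0.
Implicit Types (f g h : rpoly R n.+1) (Z : set (projspace R[i] n)).

Lemma mem_prod_rem f : f \in s -> q = f * \prod_(g <- rem f s) g.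
Proof. by move=> fs; rewrite /q (perm_big _ (perm_to_rem fs)) big_cons. Qed.

Lemma dvd_homogeneous f : rdvd f p -> homogeneous f.
Proof.
move=> [g pE]; have [k pk] := ph; apply: (@homog_factor _ _ f g k).
  by rewrite mulrC -pE.
by rewrite mulrC -pE.
Qed.

Lemma factor_homogeneous f : f \in s -> homogeneous f.
Proof.
move=> fs; apply: dvd_homogeneous; apply: rdvd_trans qp.
by rewrite (mem_prod_rem fs); apply: rdvd_mulr; exact: rdvd_refl.
Qed.

Lemma q_homogeneous : homogeneous q.
Proof. exact: dvd_homogeneous. Qed.

Lemma cofactor_homogeneous f : f \in s -> homogeneous (\prod_(g <- rem f s) g).
Proof. by move=> fs; apply: homogeneous_prod => g /mem_rem/factor_homogeneous. Qed.

Lemma boundary_vanish f : homogeneous f ->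
  (forall x, B x -> x != 0 -> reval f x = 0) -> rdvd q f.
Proof.
move=> [k fk] fB; apply/Bq => x xB.
have [->|x0] := eqVneq x 0; last exact: fB.
have [y yB y0] := Bn0.
(* This covers degree 0 as well: there the value at 0 is the value at the nonzero point [y]. *)
by rewrite -(scale0r y) (reval_homog _ _ fk) (fB y) ?mulr0.
Qed.

Lemma zariski_closure_boundary :
  zariski_closure (@complexify R n @` proj_set B) = hypersurface q.
Proof.
apply/seteqP; split.
  apply: bigcap_inf; split; first exact: hypersurface_variety q_homogeneous.
  move=> _ [_ [v vB ->] <-]; have [k qk] := q_homogeneous.
  by apply/(complexify_eval v qk); move: vB; apply: (Bq q).2; exact: rdvd_refl.
move=> z zq Z [[S Sh ->] SB] f fS.
apply: (@hypersurface_dvd _ _ q) => //; apply: boundary_vanish => [|x xB x0]; first exact: Sh.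
have [k fk] := Sh f fS; pose v : nzvec R n := exist _ x x0.
apply/(complexify_eval v fk); apply: (SB (complexify (proj_of v))) => //.
by exists (proj_of v) => //; exists v.
Qed.

(** A Nullstellensatz for the factors: [h] times the cofactor of [f] vanishes on the whole boundary,
    so [q] divides it, and the cofactor cancels. *)
Lemma vanish_component_dvd f h : f \in s -> homogeneous h ->
  hypersurface f `<=` hypersurface h -> rdvd f h.
Proof.
move=> fs hh fh; have [i fi] := factor_homogeneous fs; have [j hj] := hh.
have : rdvd q (h * \prod_(g <- rem f s) g).
  apply: boundary_vanish.
    by apply: homogeneousM => //; exact: cofactor_homogeneous.
  move=> x xB x0; have : reval q x = 0 by move: xB; apply: (Bq q).2; exact: rdvd_refl.
  rewrite (mem_prod_rem fs) !revalM => /eqP; rewrite mulf_eq0.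
  move=> /predU1P[fx|/eqP->]; last by rewrite mulr0.
  pose v : nzvec R n := exist _ x x0.
  have : hypersurface f (complexify (proj_of v)) by apply/(complexify_eval v fi).
  by move/fh/(complexify_eval v hj) => /= ->; rewrite mul0r.
move=> [c cE]; exists c.
have r0 : \prod_(g <- rem f s) g != 0.
  by apply/eqP => r0; apply: (sqf fs); rewrite r0; exists 0; rewrite mul0r.
by apply: (mulIf r0); rewrite cE (mem_prod_rem fs) mulrA.
Qed.

Lemma factor_irreducible f : f \in s -> irreducible_variety (hypersurface f).
Proof.
move=> fs; have [f0 fU fP] := sP fs; split.
- exact: hypersurface_variety (factor_homogeneous fs).
(* Were the hypersurface empty, the form 1 would vanish on it, and [f] would divide 1. *)
- apply: contrapT => ne; case/negP: fU.
  have f1 : rdvd f (1 : rpoly R n.+1).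
    apply: (vanish_component_dvd fs (homogeneous1 R n)) => z zf.
    by case: ne; exists z.
  exact: rdvd_unit (unitr1 _) f1.
- move=> Y Z [S Sh YE] [T Th ZE] fYZ.
  apply: contrapT => /not_orP[nY nZ].
  have nsub (S' : set (rpoly R n.+1)) (X : set (projspace R[i] n)) :
      X = [set x | forall f, S' f -> ceval f (vec_of x) = 0] -> X `<=` hypersurface f ->
      hypersurface f <> X -> exists2 a, S' a & ~ hypersurface f `<=` hypersurface a.
    move=> XE Xf nX; apply: contrapT => na; apply: nX; apply/seteqP; split; last exact: Xf.
    move=> z zf; rewrite XE => a aS; apply: contrapT => az; apply: na.
    by exists a; [exact: aS|move=> fa; exact/az/fa].
  have [|a aS na] := nsub S Y YE _ nY; first by rewrite fYZ; left.
  have [|b bT nb] := nsub T Z ZE _ nZ; first by rewrite fYZ; right.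
  have : rdvd f (a * b).
    apply: (vanish_component_dvd fs (homogeneousM (Sh a aS) (Th b bT))).
    rewrite hypersurfaceM fYZ YE ZE => z [zz|zz].
      by left; exact: (zz a aS).
    by right; exact: (zz b bT).
  by case/fP => /hypersurface_dvd h; [exact: na h|exact: nb h].
Qed.

Lemma component_factor Y : irreducible_component (hypersurface q) Y ->
  exists2 f, f \in s & Y = hypersurface f.
Proof.
move=> [Yi Yq Ym]; have [f fs Yf] := irreducible_vanish_prod Yi factor_homogeneous Yq.
exists f; first exact: fs.
apply/esym/Ym; [exact: factor_irreducible| |exact: Yf].
by apply: hypersurface_dvd; rewrite (mem_prod_rem fs); apply: rdvd_mulr; exact: rdvd_refl.
Qed.

Lemma factor_component f : f \in s -> irreducible_component (hypersurface q) (hypersurface f).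
Proof.
move=> fs; split; first exact: factor_irreducible.
  by apply: hypersurface_dvd; rewrite (mem_prod_rem fs); apply: rdvd_mulr; exact: rdvd_refl.
move=> Z Zi Zq fZ; have [g gs Zg] := irreducible_vanish_prod Zi factor_homogeneous Zq.
apply/seteqP; split; last exact: fZ.
apply: (subset_trans Zg); apply: hypersurface_dvd.
apply: rdvd_prime (sP fs) (sP gs) _.
exact: (vanish_component_dvd fs (factor_homogeneous gs) (subset_trans fZ Zg)).
Qed.

Lemma tangent_space_factor f z : f \in s -> hypersurface f z ->
  tangent_space (hypersurface f) z =
    [set v | \sum_(i < n.+1) ceval (mderiv i f) (vec_of z) * v 0 i = 0].
Proof.
move=> fs zf; apply/seteqP; split=> v.
  by move=> /(_ f (factor_homogeneous fs)); apply.
move=> /= vf g gh gf; have [h hE] := vanish_component_dvd fs gh gf.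
under eq_bigr => i _ do rewrite (ceval_deriv_dvd i hE zf) -mulrA.
by rewrite -big_distrr /= vf mulr0.
Qed.

End BoundaryComponents.

(** * Dimension of hypersurfaces, by counting forms *)

Section HypersurfaceDimension.
Variables (R : realType) (n : nat).
Local Notation PC := (projspace R[i] n).
Implicit Types (f g : rpoly R n.+1) (W X Y Z : set PC).

(* For a chain [W 0 < ... < W d] and forms [f i] vanishing on [W i] but not on
   [W i.+1], the monomials of degree less than [M] in each [f i] are linearly
   independent modulo the forms vanishing on [W d].  One more form vanishing on
   [W d] yields [M ^ d.+1] independent forms of degree [O(M)], while the forms of
   that degree span a space of dimension [O(M ^ n)]. *)
Definition indep_mod (N : rpoly R n.+1 -> Prop) (T : finType) (E : nat) : Prop :=
  exists g : T -> rpoly R n.+1, (forall t, g t \is ishomog1 E mdeg) /\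
    forall c : T -> R, N (\sum_t c t *: g t) -> forall t, c t = 0.

(** On [W] only the term without [f] survives, so [G 0] is zero; then one factor [f] is cancelled
    and the sum is shorter. [N] is vanishing on the next variety of the chain or, in the last step,
    being zero: both allow this cancellation. *)
Lemma power_sum_eq0 (N : rpoly R n.+1 -> Prop) W f a M E (G : nat -> rpoly R n.+1) :
  (forall g, N g -> W `<=` hypersurface g) ->
  (forall g, homogeneous g -> N (f * g) -> N g) ->
  f \is ishomog1 a mdeg -> W `<=` hypersurface f -> (a * M <= E)%N ->
  (forall k, (k < M)%N -> G k \is ishomog1 (E - k * a) mdeg) ->
  (forall k, (k < M)%N -> W `<=` hypersurface (G k) -> G k = 0) ->
  N (\sum_(k < M) f ^+ k * G k) -> forall k, (k < M)%N -> G k = 0.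
Proof.
move=> NW Nf fa fW; elim: M E G => [//|M IHM] E G aE Gh G0.
have sumE : \sum_(k < M.+1) f ^+ k * G k =
    G 0%N + f * \sum_(k < M) f ^+ k * G k.+1.
  rewrite big_ord_recl expr0 mul1r big_distrr; congr (_ + _).
  by apply: eq_bigr => i _ /=; rewrite exprS mulrA.
rewrite sumE => NG.
have G00 : G 0%N = 0.
  apply: (G0 0%N (ltn0Sn M)) => z zW; have := NW _ NG z zW.
  rewrite /hypersurface /= => h; apply: etrans h; apply: esym.
  apply: etrans (cevalD _ _ _) _; apply: etrans (congr1 _ (cevalM _ _ _)) _.
  by rewrite (fW z zW) mul0r addr0.
have sh : \sum_(k < M) f ^+ k * G k.+1 \is ishomog1 (E - a) mdeg.
  apply: rpred_sum => k _.
  have -> : (E - a = a * k + (E - k.+1 * a))%N.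
    by have := ltn_ord k; move: aE; nia.
  by apply: dhomogM; [exact: dhomogMn|apply: Gh; rewrite ltnS].
case=> [//|k kM].
apply: (IHM (E - a)%N (fun k => G k.+1)) kM.
- by move: aE; nia.
- move=> j jM; have -> : (E - a - j * a = E - j.+1 * a)%N by nia.
  exact: Gh.
- by move=> j jM; exact: (G0 j.+1 jM).
- apply: Nf; first by exists (E - a)%N.
  by move: NG; rewrite G00 add0r.
Qed.

Lemma indep_mod_step (N : rpoly R n.+1 -> Prop) W f a M (T : finType) E :
  (forall g, N g -> W `<=` hypersurface g) ->
  (forall g, homogeneous g -> N (f * g) -> N g) ->
  f \is ishomog1 a mdeg -> W `<=` hypersurface f -> (a * M <= E)%N ->
  (forall k, (k < M)%N -> indep_mod (fun g => W `<=` hypersurface g) T (E - k * a)) ->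
  indep_mod N ('I_M * T)%type E.
Proof.
move=> NW Nf fa fW aE ind.
have [g gP] : exists g : 'I_M -> T -> rpoly R n.+1, forall k : 'I_M,
    (forall t, g k t \is ishomog1 (E - k * a) mdeg) /\
    forall c : T -> R, W `<=` hypersurface (\sum_t c t *: g k t) -> forall t, c t = 0.
  by have [g gP] := choice (fun k : 'I_M => ind k (ltn_ord k)); exists g.
exists (fun kt : 'I_M * T => f ^+ kt.1 * g kt.1 kt.2); split.
  move=> [k t] /=; have -> : (E = a * k + (E - k * a))%N.
    by have := ltn_ord k; move: aE; nia.
  by apply: dhomogM; [exact: dhomogMn|exact: (gP k).1].
move=> c; pose G k := if insub k is Some k' then \sum_t c (k', t) *: g k' t else 0.
have GE (k : 'I_M) : G k = \sum_t c (k, t) *: g k t by rewrite /G valK.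
have -> : \sum_kt c kt *: (f ^+ kt.1 * g kt.1 kt.2) = \sum_(k < M) f ^+ k * G k.
  transitivity (\sum_(k < M) \sum_t c (k, t) *: (f ^+ k * g k t)).
    by rewrite pair_bigA; apply: eq_bigr => -[].
  apply: eq_bigr => k _; rewrite GE big_distrr; apply: eq_bigr => t _ /=.
  by rewrite scalerAr.
move=> NG; have Gk k (kM : (k < M)%N) : G k = \sum_t c (Ordinal kM, t) *: g (Ordinal kM) t.
  exact: (GE (Ordinal kM)).
have c0 k (kM : (k < M)%N) : W `<=` hypersurface (G k) -> forall t, c (Ordinal kM, t) = 0.
  rewrite Gk => H; exact: (gP (Ordinal kM)).2 (fun t => c (Ordinal kM, t)) H.
have G0 := @power_sum_eq0 N W f a M E G NW Nf fa fW aE.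
have Gz : forall k, (k < M)%N -> G k = 0.
  apply: G0 NG => j jM.
    rewrite Gk; apply: rpred_sum => t' _; apply: rpredZ.
    exact: (gP (Ordinal jM)).1.
  move=> WG; rewrite Gk big1 // => t' _; by rewrite (c0 j jM WG) scale0r.
move=> [[k kM] t]; apply: c0 => z _; rewrite (Gz k kM).
by rewrite /hypersurface /= -(mpolyC0 n.+1) cevalC.
Qed.

Lemma chain_indep X d (W : nat -> set PC) : variety_chain X d W ->
  forall i, (i <= d)%N -> exists A, forall M, exists T : finType, #|T| = (M ^ i)%N /\
    forall E, (A * M <= E)%N -> indep_mod (fun g => W i `<=` hypersurface g) T E.
Proof.
move=> [Wi Wlt]; elim=> [_|i IHi id].
  exists 0%N => M; exists unit; rewrite card_unit expn0; split=> // E _.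
  have [[_ [z zW] _] _] := Wi 0%N isT.
  have /rV0Pn[j zj] := vec_of_neq0 z.
  (* A power of a coordinate that is nonzero at some point of [W 0]. *)
  exists (fun=> (mpolyX R (mnm1 j)) ^+ E); split=> [_|c].
    rewrite -{2}[E]mul1n; apply: dhomogMn; apply/dhomogP => m.
    by rewrite msuppX inE => /eqP->; exact: mdeg1.
  move=> /(_ z zW); rewrite /hypersurface /= (big_pred1 tt) => [|[]//].
  rewrite -mul_mpolyC cevalM cevalC.
  have -> : ceval (mpolyX R (mnm1 j) ^+ E) (vec_of z) = vec_of z 0 j ^+ E.
    elim: E => [|E IHE]; first by rewrite !expr0 -(mpolyC1 n.+1) cevalC.
    by rewrite !exprS cevalM IHE cevalX.
  move=> /eqP; rewrite mulf_eq0 expf_eq0 (negbTE zj) andbF orbF.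
  by rewrite (fmorph_eq0 (real_complex R)) => /eqP c0 [].
have [A AP] := IHi (ltnW id).
have [[[Sv Sh WE] _ _] _] := Wi i (ltnW id).
have [Wi1 _] := Wi i.+1 id.
have [f fS [z zW1 fz]] : exists2 f, Sv f & exists2 z, W i.+1 z & ceval f (vec_of z) != 0.
  apply: contrapT => nf; have [sub nsub] := Wlt i id; apply: nsub => z zW1.
  rewrite WE => f fS; apply: contrapT => /eqP fz; apply: nf; exists f; first exact: fS.
  by exists z.
have [a fa] := Sh f fS.
(* The powers of [f] use degree less than [a * M], which leaves at least [A * M] for the previous
   family. *)
exists (A + a)%N => M; have [T [cT TP]] := AP M; exists ('I_M * T)%type.
split; first by rewrite card_prod card_ord cT expnS.
move=> E AE; apply: (@indep_mod_step _ (W i) f a).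
- by move=> g; apply: subset_trans; have [] := Wlt i id.
- move=> g gh fg; case: (irreducible_vanish Wi1 (Sh f fS) gh fg) => [f0|gW]; last exact: gW.
  by case/eqP: fz; exact: (f0 z zW1).
- exact: fa.
- by rewrite WE => y yS; exact: (yS f fS).
- by move: AE; nia.
- by move=> k kM; apply: TP; move: AE; nia.
Qed.

Lemma indep_mod_card (T : finType) E : indep_mod (fun g => g = 0) T E ->
  (#|T| <= 'C(E + n, E))%N.
Proof.
move=> [g [gE gP]].
pose X : #|T|.-tuple (dhomog n.+1 R E) := [tuple DHomog (gE (enum_val i)) | i < #|T|].
have : free X.
  apply/freeP => c cX i.
  have := gP (fun t => c (enum_rank t)); rewrite -(enum_valK i); apply.
  rewrite (reindex _ (onW_bij _ (enum_val_bij T))) /=.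
  have := congr1 (fun x => mpoly_of_dhomog x) cX; rewrite raddf_sum /= => E0.
  apply: etrans E0; apply: eq_bigr => j _.
  have Xj : X`_j = DHomog (gE (enum_val j)) by rewrite -tnth_nth tnth_mktuple.
  by rewrite enum_valK Xj.
rewrite /free size_tuple => /eqP <-; apply: leq_trans (dimvS (subvf _)) _.
by rewrite dimvf.
Qed.

Lemma bin_le_exp E m : ('C(E + m, E) <= E.+1 ^ m)%N.
Proof.
rewrite -(@bin_sub (E + m) E) ?leq_addr // addKn.
elim: m => [|m IHm]; first by rewrite bin0.
have := mul_bin_diag (E + m.+1) m; rewrite addnS /= => h.
rewrite -(@leq_pmul2l m.+1) // -h expnS mulnCA mulnA.
by apply: leq_mul => //; nia.
Qed.

Lemma hypersurface_dimension_lt f Y d : homogeneous f -> f != 0 ->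
  Y `<=` hypersurface f -> has_dimension Y d -> (d < n)%N.
Proof.
move=> [a fa] f0 Yf [[W WY] _]; rewrite ltnNge; apply/negP => nd.
have [A AP] := chain_indep WY (leqnn d).
have [Wd WdY] := WY.1 d (leqnn d).
pose E M := ((A + a) * M)%N.
have bound M : (M ^ d.+1 <= (E M).+1 ^ n)%N.
  have [T [cT TP]] := AP M.
  apply: leq_trans (bin_le_exp (E M) n).
  have <- : #|{: 'I_M * T}| = (M ^ d.+1)%N by rewrite card_prod card_ord cT expnS.
  apply: indep_mod_card; apply: (@indep_mod_step _ (W d) f a).
  - by move=> g -> z _; rewrite /hypersurface /= -(mpolyC0 n.+1) cevalC.
  - by move=> g _ /eqP; rewrite mulf_eq0 (negbTE f0) /= => /eqP.
  - exact: fa.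
  - exact: subset_trans Yf.
  - by rewrite /E; nia.
  - by move=> k kM; apply: TP; rewrite /E; nia.
(* Just large enough that [M ^ n.+1] exceeds [((A + a).+1 * M) ^ n]. *)
pose M := ((A + a).+1 ^ n).+1.
have : (M ^ n.+1 <= ((A + a).+1 * M) ^ n)%N.
  apply: leq_trans (leq_trans (bound M) _); first exact: leq_pexp2l.
  have EM : ((E M).+1 <= (A + a).+1 * M)%N by rewrite /E /M mulSn -addn1 addnC leq_add2r.
  by case: (n) => [|k]; rewrite ?expn0 ?leq_exp2r.
rewrite expnS expnMn leq_pmul2r ?expn_gt0 //.
by rewrite /M ltnn.
Qed.

End HypersurfaceDimension.

(** * Faces *)

Section Faces.
Variables (R : realType) (n : nat).
Local Notation V := 'rV[R]_n.+1.
Implicit Types (C F A : set V) (x y z v : V).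

Lemma convex_set_comb A x y (t : R) : convex_set A -> A x -> A y -> 0 <= t <= 1 ->
  A (t *: x + (1 - t) *: y).
Proof.
move=> cA Ax Ay /andP[t0 t1].
exact: (set_mem (cA x y (Itv01 t0 t1) (mem_set Ax) (mem_set Ay))).
Qed.

Lemma convex_coneD C x y : convex_cone C -> C x -> C y -> C (x + y).
Proof.
move=> [_ cC CZ] Cx Cy.
have -> : x + y = (2^-1 : R) *: (2 *: x) + (1 - 2^-1 : R) *: (2 *: y).
  by rewrite !scalerA (_ : 1 - 2^-1 = 2^-1) ?mulVf ?pnatr_eq0 // ?scale1r //; lra.
apply: convex_set_comb => //; [by apply: CZ|by apply: CZ|lra].
Qed.

Section Face.
Variables (C F : set V).
Hypothesis cC : convex_cone C.
Hypothesis fF : face C F.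

Lemma face_sub x : F x -> C x.
Proof. by have [_ FC _ _] := fF; exact: FC. Qed.

Lemma face0 : F 0.
Proof.
have [C0 _ CZ] := cC; have [[x Fx] _ _ Fs] := fF.
have half : 0 < (2^-1 : R) < 1 by lra.
have [|//] := Fs (2 *: x) 0 2^-1 (CZ _ _ (ler0n _ 2) (face_sub Fx)) C0 half.
by rewrite scaler0 addr0 scalerA mulVf ?pnatr_eq0 // scale1r.
Qed.

Lemma faceZ t x : 0 <= t -> F x -> F (t *: x).
Proof.
move=> t0 Fx; have [C0 _ CZ] := cC; have [_ _ Fc Fs] := fF.
have [t1|t1] := leP t 1.
  have := @convex_set_comb F x 0 t Fc Fx face0; rewrite scaler0 addr0; apply.
  by rewrite t0.
have tn0 : t != 0 by rewrite gt_eqF // (lt_trans _ t1).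
have tp : 0 < t by exact: lt_trans t1.
have t1' : 0 < t^-1 < 1 by rewrite invr_gt0 tp invf_lt1.
have [|//] := Fs (t *: x) 0 t^-1 (CZ _ _ t0 (face_sub Fx)) C0 t1'.
by rewrite scaler0 addr0 scalerA mulVf // scale1r.
Qed.

Lemma faceD x y : F x -> F y -> F (x + y).
Proof.
move=> Fx Fy; have [_ _ Fc _] := fF.
have -> : x + y = (2^-1 : R) *: (2 *: x) + (1 - 2^-1 : R) *: (2 *: y).
  by rewrite !scalerA (_ : 1 - 2^-1 = 2^-1) ?mulVf ?pnatr_eq0 // ?scale1r //; lra.
apply: convex_set_comb => //; [exact: faceZ|exact: faceZ|lra].
Qed.

Lemma face_splitl x y : C x -> C y -> F (x + y) -> F x.
Proof.
move=> Cx Cy Fxy; have [C0 _ CZ] := cC; have [_ _ _ Fs] := fF.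
have half : 0 < (2^-1 : R) < 1 by lra.
have [] := Fs (2 *: x) (2 *: y) 2^-1 (CZ _ _ (ler0n _ 2) Cx) (CZ _ _ (ler0n _ 2) Cy) half.
  by rewrite !scalerA (_ : 1 - 2^-1 = 2^-1) ?mulVf ?pnatr_eq0 // ?scale1r //; lra.
move=> F2x _; have -> : x = (2^-1 : R) *: (2 *: x).
  by rewrite scalerA mulVf ?pnatr_eq0 // scale1r.
by apply: faceZ => //; lra.
Qed.

(** From an interior point [x], step beyond [x] away from any [c] of the cone. Then a positive
    multiple of [x] is that new point plus a multiple of [c], and the face absorbs [c]. *)
Lemma proper_face_interior : F <> C -> forall x, F x -> ~ C° x.
Proof.
move=> FC x Fx /nbhs_ballP[r /= r0 rC]; apply: FC; apply/seteqP; split; first exact: face_sub.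
move=> c Cc; pose t := r / (2 * (`|x - c| + 1)).
have m0 : 0 < `|x - c| + 1 by rewrite ltr_wpDl.
have t0 : 0 < t by rewrite divr_gt0 // mulr_gt0.
have [C0 _ CZ] := cC.
have Cy : C (x + t *: (x - c)).
  apply: rC; rewrite -ball_normE /= opprD addrA subrr sub0r normrN normrZ (gtr0_norm t0).
  have : t * (`|x - c| + 1) = r / 2.
    by rewrite /t invfM mulrA mulfVK // gt_eqF.
  by have := normr_ge0 (x - c); nra.
have : F (t *: c).
  apply: (@face_splitl _ (x + t *: (x - c)) _ Cy); first by apply: CZ => //; exact: ltW.
  have -> : t *: c + (x + t *: (x - c)) = (1 + t) *: x.
    by rewrite scalerBr scalerDl scale1r addrCA [t *: c + _]addrC subrK.
  by apply: faceZ => //; rewrite addr_ge0 // ltW.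
move=> /(@faceZ t^-1); rewrite scalerA mulVf ?gt_eqF // scale1r; apply.
by rewrite invr_ge0 ltW.
Qed.

(** The segment from [x] to [y] extends inside the face a little beyond [y]; [z] is a multiple of
    its new endpoint. *)
Lemma relint_absorb x y : relint F y -> F x -> exists t z, [/\ 0 < t, F z & y = t *: x + z].
Proof.
move=> [Fy /nbhs_ballP[r /= r0 rF]] Fx.
pose t := r / (2 * (`|y - x| + 1)).
have m0 : 0 < `|y - x| + 1 by rewrite ltr_wpDl.
have t0 : 0 < t by rewrite divr_gt0 // mulr_gt0.
have Fw : F (y + t *: (y - x)).
  apply: rF.
    rewrite -ball_normE /= opprD addrA subrr sub0r normrN normrZ (gtr0_norm t0).
    have : t * (`|y - x| + 1) = r / 2.
      by rewrite /t invfM mulrA mulfVK // gt_eqF.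
    by have := normr_ge0 (y - x); nra.
  move=> L [La FL]; have := La y x (1 + t) (FL _ Fy) (FL _ Fx).
  by rewrite (_ : 1 - (1 + t) = - t) ?scaleNr ?scalerDl ?scale1r -?addrA -?scalerBr //; ring.
have t1 : 0 < 1 + t by rewrite addr_gt0.
exists (t / (1 + t)), ((1 + t)^-1 *: (y + t *: (y - x))); split.
- by rewrite divr_gt0.
- by apply: faceZ => //; rewrite invr_ge0 ltW.
have -> : y + t *: (y - x) = (1 + t) *: y - t *: x.
  by rewrite scalerBr scalerDl scale1r addrA.
rewrite scalerBr !scalerA mulVf ?gt_eqF // scale1r [_^-1 * t]mulrC.
by rewrite addrCA subrr addr0.
Qed.

(** If 0 were relatively interior, a negative multiple of a nonzero [x] of the face would lie in the
    face, and the cone would contain a line. *)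
Lemma relint_neq0 y : ~ (exists x v, v != 0 /\ forall t : R, C (x + t *: v)) ->
  F <> [set 0] -> relint F y -> y != 0.
Proof.
move=> Cl F0 yF; apply/eqP => y0; have [C0 _ CZ] := cC.
have [x Fx xn0] : exists2 x, F x & x != 0.
  apply: contrapT => nx; apply: F0; apply/seteqP; split=> [x Fx|x -> /=]; last exact: face0.
  by apply: contrapT => /eqP x0; apply: nx; exists x.
have [t [z [t0 Fz /esym/eqP]]] := relint_absorb yF Fx.
rewrite y0 addrC addr_eq0 => /eqP zE.
apply: Cl; exists 0, x; split=> // s; rewrite add0r.
have [s0|/ltW s0] := leP 0 s; first by apply: CZ => //; exact: face_sub.
have -> : s *: x = (- s / t) *: z.
  by rewrite zE scalerN scalerA divfK ?gt_eqF // scaleNr opprK.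
by apply: CZ; [rewrite divr_ge0 ?oppr_ge0 // ltW|exact: face_sub].
Qed.

(** A maximal free family of vectors of the face spans it, hence also its affine hull. The sum of
    the family has all coordinates 1; nearby points of the span have nonnegative coordinates and are
    in the face. *)
Lemma relint_nonempty : relint F !=set0.
Proof.
pose P k := `[< exists X : seq V, [/\ size X = k, free X & forall x, x \in X -> F x] >].
have exP : exists k, P k.
  by exists 0%N; apply/asboolP; exists [::]; split=> //; exact: nil_free.
have bP k : P k -> (k <= \dim {: V})%N.
  move=> /asboolP[X [<- fX _]]; move: fX; rewrite /free => /eqP <-.
  exact: dimvS (subvf _).
case: (ex_maxnP exP bP) => k /asboolP[X [Xk fX XF]] kmax.
have Fsub x : F x -> x \in <<X>>%VS.
  move=> Fx; apply: contrapT => /negP xX.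
  have : P k.+1.
    apply/asboolP; exists (x :: X); split; rewrite /= ?Xk // ?free_cons ?xX //.
    by move=> y; rewrite in_cons => /predU1P[->|/XF].
  by move/kmax; rewrite ltnn.
pose Y := in_tuple X; have fY : free Y by [].
have YF (i : 'I_(size X)) : F Y`_i by apply: XF; rewrite mem_nth.
pose y := \sum_(i < size X) Y`_i; exists y.
have sumF (c : 'I_(size X) -> R) : (forall i, 0 <= c i) -> F (\sum_(i < size X) c i *: Y`_i).
  move=> c0; elim/big_ind: _ => [|u v|i _]; [exact: face0|exact: faceD|exact: faceZ].
split.
  rewrite /y (eq_bigr (fun i : 'I_(size X) => (1 : R) *: Y`_i)) => [|i _]; last by rewrite scale1r.
  by apply: sumF => i; exact: ler01.
have FF : Filter (nbhs y) := nbhs_filter y.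
have near_pos : \forall u \near y, forall i, 0 <= coord Y i u.
  apply: (@filter_forall _ _ (fun (i : 'I_(size X)) (u : V) => is_true (0 <= coord Y i u))
    (nbhs y) FF) => i.
  have [K K0 KP] : exists2 K : R, 0 <= K & forall u, `|coord Y i u| <= K * `|u|.
    have [K K0 KP] := pairing_bound (\row_j coord Y i (delta_mx 0 j)).
    exists K => // u; apply: le_trans (KP u).
    rewrite {1}[u]row_sum_delta linear_sum /pairing le_eqVlt; apply/orP; left.
    by apply/eqP; congr `|_|; apply: eq_bigr => j _; rewrite linearZ mxE mulrC.
  have yi : coord Y i y = 1.
    rewrite /y linear_sum (bigD1 i) //= coord_free // eqxx big1 ?addr0 // => j ji.
    rewrite coord_free //; case: eqP => // ij.
    by case/eqP: ji; apply/val_inj; rewrite /= ij.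
  apply/nbhs_ballP; exists (K + 1)^-1; first by rewrite /= invr_gt0 ltr_wpDl.
  move=> u; rewrite -ball_normE /= => yu.
  have : `|coord Y i (y - u)| <= 1.
    apply: le_trans (KP _) _; have K1 : 0 < K + 1 by rewrite ltr_wpDl.
    move: yu; rewrite -[_^-1]mul1r ltr_pdivlMr // mulrC.
    by have := normr_ge0 (y - u); nra.
  by rewrite linearB /= yi ler_norml => /andP[_]; lra.
apply: filterS near_pos => u u0 uF.
have uX : u \in <<X>>%VS.
  apply: (uF [set` <<X>>%VS]); split; last by move=> x /Fsub.
  by move=> a b t /= aX bX; rewrite memvD // memvZ.
by rewrite (coord_span (X := Y) uX); exact: sumF.
Qed.

End Face.
End Faces.

(** * Patches *)

Section ProjectivePaths.
Variables (R : realType) (n : nat).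
Local Notation V := 'rV[R]_n.+1.
Local Notation P := (projspace R n).

(** The squared coefficients are nonnegative for every real [t], so the path is defined and
    continuous on the whole line before it is restricted to the unit interval. *)
Lemma proj_path (L : set (P * P)) (l : P) (x y : V) (x0 : x != 0) (y0 : y != 0)
    (xy0 : forall t : R, (1 - t) ^+ 2 *: x + t ^+ 2 *: y != 0) :
  (forall t, L (proj_of (exist (fun v : V => is_true (v != 0)) _ (xy0 t)), l)) ->
  connected_component L (proj_of (exist (fun v : V => is_true (v != 0)) _ x0), l)
    (proj_of (exist (fun v : V => is_true (v != 0)) _ y0), l).
Proof.
move=> Lt; pose g (t : R) : nzvec R n := exist (fun v : V => is_true (v != 0)) _ (xy0 t).
have cg : continuous g.
  apply: continuous_comp_initial => t.
  have -> : val \o g = fun t : R => (1 - t) ^+ 2 *: x + t ^+ 2 *: y by [].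
  apply: cvgD; apply: cvgZr_tmp.
    by rewrite expr2; apply: cvgM; apply: cvgB;
      [exact: cvg_cst|exact: cvg_id|exact: cvg_cst|exact: cvg_id].
  by rewrite expr2; apply: cvgM; exact: cvg_id.
have cp : continuous (fun t => (proj_of (g t), l)).
  have cpg : continuous (fun t => proj_of (g t)).
    move=> t; apply: continuous_comp; first exact: cg.
    exact: pi_continuous.
  move=> t D [[U W] /= [hU hW] UW]; have FF : Filter (nbhs t) := nbhs_filter t.
  have H : nbhs t ((fun t => proj_of (g t)) @^-1` U) := cpg t U hU.
  apply: (@filterS _ (nbhs t) FF _ _ _ H) => s Us.
  by apply: UW; split=> //=; exact: nbhs_singleton.
have gE t (v : V) (v0 : v != 0) : (1 - t) ^+ 2 *: x + t ^+ 2 *: y = v ->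
    proj_of (g t) = proj_of (exist (fun v : V => is_true (v != 0)) _ v0).
  by move=> E; congr proj_of; apply: val_inj.
have hsub : (fun t => (proj_of (g t), l)) @` `[0, 1] `<=` L by move=> _ [t _ <-]; exact: Lt.
apply: (connected_component_max _ hsub).
- exists 0; first by rewrite /= in_itv /= lexx ler01.
  by rewrite (gE _ _ x0) // subr0 expr1n scale1r expr0n scale0r addr0.
- apply: connected_continuous_connected; first exact: segment_connected.
  exact: continuous_subspaceT.
- exists 1; first by rewrite /= in_itv /= lexx ler01.
  by rewrite (gE _ _ y0) // subrr expr0n scale0r add0r expr1n scale1r.
Qed.

End ProjectivePaths.

Section Derivatives.
Variables (R : realType) (n : nat).
Implicit Types (f g : rpoly R n.+1) (x y l m : 'rV[R]_n.+1) (C : set 'rV[R]_n.+1).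

Lemma dual_cone_closed C : closed (dual_cone C).
Proof.
have -> : dual_cone C = \bigcap_(x in C) [set l | 0 <= pairing l x].
  by apply/seteqP; split=> l lC x; exact: lC.
apply: closed_bigI => x _.
pose f : rpoly R n.+1 := \sum_i x 0 i *: mpolyX R (mnm1 i).
have fE l : pairing l x = reval f l.
  rewrite /reval /f raddf_sum; apply: eq_bigr => i _.
  by rewrite /= mevalZ mevalXU mulrC.
have -> : [set l | 0 <= pairing l x] = reval f @^-1` [set t | 0 <= t].
  by apply/seteqP; split=> l /=; rewrite fE.
exact: ((continuous_closedP (reval f)).1 (@continuous_reval _ _ f) _ (@closed_ge R _)).
Qed.

Lemma mderiv_homog f k i : f \is ishomog1 k mdeg -> mderiv i f \is ishomog1 k.-1 mdeg.
Proof.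
move=> /dhomogP fk; apply/dhomogP => m; rewrite mcoeff_msupp mcoeff_deriv => m0.
have /fk : mnm_add m (mnm1 i) \in msupp f.
  by rewrite mcoeff_msupp; apply: contraNneq m0 => ->; rewrite mul0rn.
by rewrite /= mdegD mdeg1 addn1 => <-.
Qed.

Lemma gradientM f g x :
  gradient (f * g) x = reval g x *: gradient f x + reval f x *: gradient g x.
Proof.
apply/rowP => i; rewrite !mxE mderivM revalD !revalM.
by rewrite [reval g x * _]mulrC.
Qed.

Lemma gradientC (c : R) x : gradient (mpolyC n.+1 c) x = 0.
Proof. by apply/rowP => i; rewrite !mxE mderivC /reval meval0. Qed.

Lemma along_lineM f g x y : along_line (f * g) x y = along_line f x y * along_line g x y.
Proof. exact: (rmorphM (mmap (@polyC R) _)). Qed.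

(** A polynomial in one variable that vanishes on a ray is zero, and the restriction of [g] is not
    zero since [g x] is not. *)
Lemma factor_vanish_ray f g x y : reval g x != 0 ->
  (forall t, 0 <= t -> reval (f * g) (x + t *: y) = 0) ->
  forall t, reval f (x + t *: y) = 0.
Proof.
move=> gx fg t; have /eqP : along_line (f * g) x y = 0.
  apply: contrapT => /eqP /poly_small_nonroot /(_ ltr01)[s /andP[s0 _]].
  by rewrite horner_along_line fg ?eqxx // ltW.
rewrite along_lineM mulf_eq0 => /predU1P[f0|/eqP g0].
  by rewrite -horner_along_line f0 horner0.
by move: gx; rewrite -[x]addr0 -(scale0r y) -horner_along_line g0 horner0 eqxx.
Qed.

Lemma ceval_gradient f k (v : nzvec R n) : f \is ishomog1 k mdeg ->
  exists2 c : R[i], c != 0 & forall i,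
    ceval (mderiv i f) (vec_of (complexify (proj_of v))) = c * (gradient f (val v) 0 i)%:C.
Proof.
move=> fk; have [c c0 cE] := vec_of_complexify (proj_of v).
have [a a0 aE] := vec_of_proj v.
exists (c ^+ k.-1 * (a ^+ k.-1)%:C) => [|i].
  by rewrite mulf_neq0 ?expf_neq0 // (fmorph_eq0 (real_complex R)) expf_neq0.
rewrite cE aE (ceval_homog _ _ (mderiv_homog i fk)) ceval_real.
rewrite (reval_homog _ _ (mderiv_homog i fk)) rmorphM mulrA.
by rewrite mxE.
Qed.

End Derivatives.

Section PatchPoints.
Variables (R : realType) (n : nat) (p : rpoly R n.+1) (e : 'rV[R]_n.+1) (d : nat).
Variable s : seq (rpoly R n.+1).
Local Notation V := 'rV[R]_n.+1.
Local Notation B := (hcone_boundary p e).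
Local Notation C := (closed_hcone p e).
Local Notation q := (\prod_(f <- s) f).
Local Notation cofactor f := (\prod_(g <- rem f s) g).
Implicit Types (f g : rpoly R n.+1) (v w : nzvec R n) (l : projspace R n).
Hypotheses (pd : p \is ishomog1 d mdeg) (ph : hyperbolic p e).
Hypothesis CD : forall x y, C x -> C y -> C (x + y).
Hypothesis CZ : forall (t : R) x, 0 <= t -> C x -> C (t *: x).
Hypothesis sP : forall f, f \in s -> prime_elt f.
Hypothesis qp : rdvd q p.
Hypothesis sqf : forall f, f \in s -> ~ rdvd f (cofactor f).
Hypothesis Bq : forall h, (forall x, B x -> reval h x = 0) <-> rdvd q h.
Hypothesis Bn0 : exists2 x, B x & x != 0.

Let homp : homogeneous p. Proof. by exists d. Qed.

Let p0 : p != 0.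
Proof. by case: ph => pe _; apply: contra pe => /eqP->; rewrite /reval meval0. Qed.

Let homs f : f \in s -> homogeneous f.
Proof. exact: (factor_homogeneous homp p0 qp). Qed.

Let irr f : f \in s -> irreducible_variety (hypersurface f).
Proof. exact: (factor_irreducible homp p0 sP qp sqf Bq Bn0). Qed.

Let tanE f (z : projspace R[i] n) : f \in s -> hypersurface f z ->
  tangent_space (hypersurface f) z =
    [set u | \sum_(i < n.+1) ceval (mderiv i f) (vec_of z) * u 0 i = 0].
Proof. exact: (tangent_space_factor homp p0 qp sqf Bq Bn0). Qed.

Let cofactorE f : f \in s -> q = f * cofactor f.
Proof. exact: mem_prod_rem. Qed.

(** With zero gradient the tangent space would be everything, of dimension [n.+1], while the
    dimension of the hypersurface is less than [n]. *)
Lemma regular_gradient f v : f \in s ->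
  regular_locus (hypersurface f) (complexify (proj_of v)) -> gradient f (val v) != 0.
Proof.
move=> fs [vf [m [[[Z [Zc _ Zm]] _] [U UE Um]]]].
have ZE := (irreducible_component_self Z (irr fs)).1 Zc.
have f0 : f != 0 by case: (sP fs).
have mn : (m < n)%N.
  by apply: (hypersurface_dimension_lt (homs fs) f0 _ Zm); rewrite ZE.
apply/eqP => g0; have [k fk] := homs fs; have [c c0 cE] := ceval_gradient v fk.
have Ufull : U = fullv.
  apply/vspaceP => u; rewrite memvf.
  suff : [set` U] u by [].
  rewrite UE (tanE fs vf) /=; apply: big1 => i _.
  by rewrite cE g0 mxE rmorph0 mulr0 mul0r.
by move: Um; rewrite Ufull dimvf dim_matrix => Um; move: mn; lia.
Qed.

(** Scaled by its own value at [e], the boundary polynomial becomes positive at [e] and keeps its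
    zeros. *)
Let q1 : rpoly R n.+1 := mpolyC n.+1 (reval q e) * q.

Let qe0 : reval q e != 0.
Proof.
by have [g pE] := qp; have [pe _] := ph; move: pe; rewrite pE revalM mulf_eq0 negb_or => /andP[].
Qed.

Let q1p : exists g, p = g * q1.
Proof.
have [g pE] := qp; exists (g * mpolyC n.+1 (reval q e)^-1).
rewrite /q1 {}pE; move: qe0; move: (q) => r; move: (reval r e) => a a0.
by rewrite -mulrA [_ * (_ * r)]mulrA -mpolyCM mulVf // mpolyC1 mul1r.
Qed.

Let q1k : exists k, q1 \is ishomog1 k mdeg.
Proof.
have [k qk] := q_homogeneous homp p0 qp; exists k.
by rewrite /q1 mul_mpolyC; exact: rpredZ.
Qed.

Let q1h : hyperbolic q1 e.
Proof. by have [g pE] := q1p; exact: (hyperbolic_divisor ph pE). Qed.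

Let q1U : open_hcone p e `<=` open_hcone q1 e.
Proof. by have [g pE] := q1p; exact: (open_hcone_divisor pE). Qed.

Let q1e : 0 < reval q1 e.
Proof.
rewrite revalM revalC; move: (reval q e) qe0 => a a0.
by rewrite -expr2 exprn_even_gt0.
Qed.

Let qB x : B x -> reval q x = 0.
Proof. by apply: (Bq q).2; exact: rdvd_refl. Qed.

Let q1B x : B x -> reval q1 x = 0.
Proof. by move=> /qB qx; rewrite revalM qx mulr0. Qed.

Let gradient_factor f x : f \in s -> reval f x = 0 ->
  gradient q1 x = (reval q e * reval (cofactor f) x) *: gradient f x.
Proof.
move=> fs fx; rewrite /q1 gradientM gradientC scaler0 add0r revalC.
by rewrite (cofactorE fs) gradientM fx scale0r addr0 scalerA.
Qed.

Lemma factor_gradient_self f x : f \in s -> B x -> reval f x = 0 ->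
  reval (cofactor f) x != 0 -> pairing (gradient f x) x = 0.
Proof.
move=> fs xB fx cx; have [k qk] := q1k.
have := gradient_self qk q1h CD CZ q1U q1e q1B xB.
rewrite (gradient_factor fs fx) pairingZl => /eqP.
by rewrite !mulf_eq0 (negbTE qe0) (negbTE cx) => /eqP.
Qed.

Lemma factor_dual_unique f x m : f \in s -> B x -> reval f x = 0 ->
  reval (cofactor f) x != 0 -> gradient f x != 0 -> dual_cone C m -> pairing m x = 0 ->
  exists c, m = c *: gradient f x.
Proof.
move=> fs xB fx cx gx mC mx; have [k qk] := q1k.
have g1 : gradient q1 x != 0.
  by rewrite (gradient_factor fs fx) scaler_eq0 mulf_eq0 !negb_or qe0 cx.
have := dual_unique pd ph qk q1h CD CZ q1U q1e q1B xB g1 mC mx.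
by move: (_ / _) => c ->; rewrite (gradient_factor fs fx) scalerA; eexists.
Qed.

(** Near [x] the cofactor is nonzero, so [f] is the factor that vanishes along the ray. The gradient
    of [q1] at [y] is the gradient of [f] times the cofactor; as it is nonzero, no other factor
    vanishes at [y]. *)
Lemma factor_gradient_transfer f x z t : f \in s -> reval f x = 0 ->
  reval (cofactor f) x != 0 -> gradient f x != 0 -> C z ->
  (forall a b, 0 <= a -> 0 <= b -> B (a *: x + b *: z)) -> 0 < t ->
  let y := t *: x + z in
  [/\ reval f y = 0, reval (cofactor f) y != 0 &
      exists2 c, c != 0 & gradient f y = c *: gradient f x].
Proof.
move=> fs fx cx gx zC Bxz t0 y; have [k qk] := q1k.
have yB : B y.
  by rewrite /y -[z]scale1r; apply: Bxz; [exact: ltW|exact: ler01].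
have xB : B x by rewrite -[x]addr0 -[x]scale1r -(scale0r z); apply: Bxz; [exact: ler01|].
have fy : reval f y = 0.
  have [j fj] := homs fs.
  have -> : y = t *: (x + t^-1 *: z) by rewrite /y scalerDr scalerA mulfV ?gt_eqF // scale1r.
  rewrite (reval_homog _ _ fj) (factor_vanish_ray cx) ?mulr0 // => r r0.
  rewrite -(cofactorE fs); apply: qB; rewrite -[X in B (X + _)]scale1r.
  by apply: Bxz; [exact: ler01|].
have g1 : gradient q1 x != 0.
  by rewrite (gradient_factor fs fx) scaler_eq0 mulf_eq0 !negb_or qe0 cx.
have [c c0] := gradient_transfer pd ph qk q1h CD CZ q1U q1e q1B xB g1 zC t0 yB.
rewrite (gradient_factor fs fy) => E.
have cy : reval (cofactor f) y != 0.
  apply/eqP => cy; move: E; rewrite cy mulr0 scale0r => /esym/eqP.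
  by rewrite scaler_eq0 (gt_eqF c0) (negbTE g1).
split=> //; move: E; rewrite (gradient_factor fs fx) => E; move: E cx cy qe0.
move: (reval (cofactor f) x) (reval (cofactor f) y) (reval q e).
move=> cx cy a E cx0 cy0 a0; exists ((a * cy)^-1 * (c * (a * cx))).
  by rewrite !mulf_neq0 ?invr_eq0 ?mulf_neq0 // gt_eqF.
by rewrite -scalerA -[(c * _) *: _]scalerA -E scalerA mulVf ?scale1r // mulf_neq0.
Qed.

Lemma algebraic_boundaryE : algebraic_boundary C = hypersurface q.
Proof.
rewrite /algebraic_boundary (boundary_hcone pd ph).
exact: (zariski_closure_boundary homp p0 qp Bq Bn0).
Qed.

Lemma patch_point f v l : f \in s -> B (val v) ->
  patch_locus C (hypersurface f) (proj_of v, l) ->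
  [/\ reval f (val v) = 0, reval (cofactor f) (val v) != 0, gradient f (val v) != 0 &
      exists2 c, c != 0 & vec_of l = c *: gradient f (val v)].
Proof.
move=> fs vB [[_ /= [m mD ml] mx] [_ /= vreg _] vY]; have [k fk] := homs fs.
have fv : reval f (val v) = 0 by apply/(complexify_eval v fk); case: vreg.
(* Another factor vanishing at [v] would define the same component, hence be a multiple of [f],
   which the minimal family excludes. *)
have cv : reval (cofactor f) (val v) != 0.
  apply/eqP => /eqP c0.
  have [g gs gv] : exists2 g, g \in rem f s & reval g (val v) = 0.
    move: c0; elim: (rem f s) => [|g r IHr].
      by rewrite big_nil -(mpolyC1 n.+1) revalC oner_eq0.
    rewrite big_cons revalM mulf_eq0 => /orP[/eqP gv|/IHr[h hr hv]].
      by exists g => //; rewrite mem_head.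
    by exists h => //; rewrite in_cons hr orbT.
  have gs' := mem_rem gs; have [j gj] := homs gs'.
  have gf : hypersurface g = hypersurface f.
    apply: vY; last by apply/(complexify_eval v gj).
    rewrite algebraic_boundaryE.
    exact: (factor_component homp p0 sP qp sqf Bq Bn0 gs').
  apply: (sqf fs); rewrite (perm_big _ (perm_to_rem gs)) big_cons; apply: rdvd_mulr.
  apply: (vanish_component_dvd homp p0 qp sqf Bq Bn0 fs (homs gs')).
  by rewrite gf.
have gv := regular_gradient fs vreg; split=> //.
have [b b0 lE] : exists2 b, b != 0 & vec_of l = b *: val m.
  by rewrite ml; exact: vec_of_proj.
have [c mE] : exists c, val m = c *: gradient f (val v).
  (* A boundary point of the dual cone belongs to it because that cone is closed. *)
  apply: (factor_dual_unique fs vB fv cv gv); first exact: (dual_cone_closed mD.1).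
  have [a a0 vE] := vec_of_proj v; move: mx; rewrite lE vE pairingZl pairingZr.
  by move=> /eqP; rewrite !mulf_eq0 (negbTE a0) (negbTE b0) => /eqP.
exists (b * c); last by rewrite lE mE scalerA.
rewrite mulf_neq0 //; apply: contraTneq (valP m) => c0.
by rewrite mE c0 scale0r eqxx.
Qed.

(** Proportional gradients give equal tangent spaces, so conormality of [l] carries over. So does
    regularity, the hypersurface being irreducible and its local dimension thus constant. The
    nonzero cofactor excludes other components. *)
Lemma patch_transfer f v w l k : f \in s -> B (val v) -> B (val w) ->
  patch_locus C (hypersurface f) (proj_of v, l) ->
  reval f (val w) = 0 -> reval (cofactor f) (val w) != 0 ->
  k != 0 -> gradient f (val w) = k *: gradient f (val v) ->
  patch_locus C (hypersurface f) (proj_of w, l).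
Proof.
move=> fs vB wB vL fw cw k0 gw.
have [fv cv gv [c c0 lE]] := patch_point fs vB vL.
have [[_ /= lD _] [_ /= vreg lreg] _] := vL; have [j fj] := homs fs.
have wf : hypersurface f (complexify (proj_of w)) by apply/(complexify_eval w fj).
have vf : hypersurface f (complexify (proj_of v)) by apply/(complexify_eval v fj).
have [a a0 aE] := ceval_gradient v fj; have [b b0 bE] := ceval_gradient w fj.
have tanw : tangent_space (hypersurface f) (complexify (proj_of w)) =
    [set u | \sum_(i < n.+1) (gradient f (val v) 0 i)%:C * u 0 i = 0].
  rewrite (tanE fs wf); apply/seteqP; split=> u /=.
    move=> /eqP; under eq_bigr do rewrite bE gw mxE rmorphM -!mulrA.
    rewrite -!big_distrr /= !mulf_eq0 (negbTE b0) (fmorph_eq0 (real_complex R)) (negbTE k0).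
    by move=> /eqP.
  move=> u0; under eq_bigr do rewrite bE gw mxE rmorphM -!mulrA.
  by rewrite -!big_distrr /= u0 !mulr0.
have tanv : tangent_space (hypersurface f) (complexify (proj_of v)) =
    tangent_space (hypersurface f) (complexify (proj_of w)).
  rewrite tanw (tanE fs vf); apply/seteqP; split=> u /=.
    move=> /eqP; under eq_bigr do rewrite aE -!mulrA.
    by rewrite -!big_distrr /= !mulf_eq0 (negbTE a0) => /eqP.
  move=> u0; under eq_bigr do rewrite aE -!mulrA.
  by rewrite -!big_distrr /= u0 !mulr0.
have wreg : regular_locus (hypersurface f) (complexify (proj_of w)).
  have [_ [r [[[Z [Zc Zv Zr]] Zmax] [U UE Ur]]]] := vreg; split=> //; exists r; split.
    split; last first.
      move=> Y m Yc _; apply: Zmax (Yc) _.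
      by rewrite ((irreducible_component_self Y (irr fs)).1 Yc).
    have ZE := (irreducible_component_self Z (irr fs)).1 Zc; exists Z; split=> //.
    by rewrite ZE.
  by exists U => //; rewrite UE tanv.
split=> /=.
- split=> //=; first by rewrite (boundary_hcone pd ph); exists w.
  have [t t0 ->] := vec_of_proj w; rewrite lE pairingZl pairingZr.
  have := factor_gradient_self fs wB fw cw; rewrite gw pairingZl => /eqP.
  by rewrite mulf_eq0 (negbTE k0) => /eqP ->; rewrite !mulr0.
- split=> //= W [_ WP]; apply: WP; split=> //= u; rewrite tanw => u0.
  have [t t0 ->] := vec_of_complexify l; rewrite lE /pairing.
  move: u0; move: (gradient f (val v)) => g u0.
  under eq_bigr do rewrite !mxE rmorphM -!mulrA.
  by rewrite -!big_distrr /= u0 !mulr0.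
move=> Z; rewrite algebraic_boundaryE => Zc Zw.
have [g gs ZE] := component_factor homp p0 sP qp sqf Bq Bn0 Zc.
have [gf|gf] := eqVneq g f; first exact: (etrans ZE (congr1 (@hypersurface R n) gf)).
have grem : g \in rem f s.
  by move: gs; rewrite (perm_mem (perm_to_rem fs)) in_cons (negbTE gf).
have [m gm] := homs gs.
have gw0 : reval g (val w) = 0 by apply/(complexify_eval w gm); rewrite ZE in Zw.
exfalso; move: cw => /eqP; apply; rewrite (perm_big _ (perm_to_rem grem)) big_cons.
exact: (etrans (revalM _ _ _) (etrans (congr1 ( *%R^~ _) gw0) (mul0r _))).
Qed.

End PatchPoints.

Lemma pointed_cone_comb (R : realType) (n : nat) (C : set 'rV[R]_n.+1)
    (x z : 'rV[R]_n.+1) (a b : R) :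
  convex_cone C -> ~ (exists x v, v != 0 /\ forall t : R, C (x + t *: v)) ->
  C x -> C z -> x != 0 -> 0 < a -> 0 <= b -> a *: x + b *: z != 0.
Proof.
move=> [_ _ CZ] Cl Cx Cz x0 a0 b0; apply/eqP => /eqP; rewrite addr_eq0 => /eqP E.
apply: Cl; exists 0, (a *: x); split=> [|t]; first by rewrite scaler_eq0 gt_eqF.
rewrite add0r; have [t0|/ltW t0] := leP 0 t.
  by rewrite scalerA; apply: (CZ) => //; rewrite mulr_ge0 // ltW.
by rewrite E scalerN -scaleNr scalerA; apply: (CZ) => //; rewrite mulr_ge0 ?oppr_ge0.
Qed.

Lemma vec_of_collinear (K : fieldType) (n : nat) (x y : projspace K n) (v : 'rV[K]_n.+1)
    (a b : K) : a != 0 -> b != 0 -> vec_of x = a *: v -> vec_of y = b *: v -> x = y.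
Proof.
move=> a0 b0 xE yE; rewrite -[x]proj_of_repr -[y]proj_of_repr; apply/proj_of_eq.
exists (a / b); first by rewrite mulf_neq0 // invr_eq0.
by move: xE yE; rewrite /vec_of => -> ->; rewrite scalerA divfK.
Qed.

Theorem lemma4p3 (R : realType) (n : nat) (p : rpoly R n.+1) (e : 'rV[R]_n.+1)
    (p_homog : homogeneous p) (p_hyp : hyperbolic p e)
    (C_proper : proper_cone (hyperbolicity_cone p e))
    (F : set 'rV[R]_n.+1) (F_face : proper_face (hyperbolicity_cone p e) F)
    (F_neq0 : F <> [set 0]) :
  let C := hyperbolicity_cone p e in
  let one_patch := exists! P : set (projspace R n * projspace R n),
    open_patch C P /\ proj_set (relint F) `<=` fst @` P in
  let no_patch := ~ exists P : set (projspace R n * projspace R n),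
    open_patch C P /\ fst @` P `&` proj_set F !=set0 in
  (one_patch \/ no_patch) /\ ~ (one_patch /\ no_patch).
Proof.
have [d pd] := p_homog; move: C_proper F_face; rewrite (hyperbolicity_coneE pd p_hyp).
move=> [_ cC _ Cl] [fF FC] C one_patch no_patch.
pose B := hcone_boundary p e.
have FB x : F x -> B x.
  move=> Fx; rewrite /B -(boundary_hcone pd p_hyp); split.
    by apply: subset_closure; exact: (face_sub fF).
  exact: (proper_face_interior cC fF FC).
have [w0 w0F] : exists w : nzvec R n, relint F (val w).
  have [y yF] := relint_nonempty cC fF.
  by exists (exist (fun v : 'rV[R]_n.+1 => is_true (v != 0)) y (relint_neq0 cC fF Cl F_neq0 yF)).
have w0B := FB _ w0F.1.
have Bn0 : exists2 x, B x & x != 0 by exists (val w0); [exact: w0B|exact: (valP w0)].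
have CD x y : closed_hcone p e x -> closed_hcone p e y -> closed_hcone p e (x + y).
  exact: (convex_coneD cC).
have CZ (t : R) x : 0 <= t -> closed_hcone p e x -> closed_hcone p e (t *: x).
  by have [_ _ H] := cC; exact: H.
have e0 : e != 0.
  apply/eqP => e0; have [pe _] := p_hyp; have [_ w0p] := w0B.
  by move: pe; rewrite e0 -(scale0r (val w0)) (reval_homog _ _ pd) w0p mulr0 eqxx.
have [s [sP qp sqf Bq]] := boundary_ideal pd p_hyp e0 CD.
have p0 : p != 0.
  by have [pe _] := p_hyp; apply: contra pe => /eqP->; rewrite /reval meval0.
have aE := algebraic_boundaryE pd p_hyp qp Bq Bn0.
pose L f := patch_locus C (hypersurface f).
(* A patch is the component of any of its points, so it can be based at a point over the face. *)
have key (Q : set (projspace R n * projspace R n)) : open_patch C Q ->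
    fst @` Q `&` proj_set F !=set0 ->
    exists f v l, [/\ f \in s, F (val v), L f (proj_of v, l) &
      Q = connected_component (L f) (proj_of v, l)].
  move=> [Y Yc [z zL ->]] [_ [[[x l] xlQ <-] [v vF /= xE]]]; move: Yc; rewrite aE => Yc.
  have [f fs YE] := component_factor p_homog p0 sP qp sqf Bq Bn0 Yc.
  exists f, v, l; rewrite -xE /L -YE; split=> //; first exact: connected_component_sub xlQ.
  exact: same_connected_component.
(* The functional stays fixed while the point moves; each path point is a positive multiple of [v]
   plus an element of the face, as the transfer requires. *)
have cover f (v w : nzvec R n) l : f \in s -> F (val v) -> L f (proj_of v, l) ->
    relint F (val w) -> connected_component (L f) (proj_of v, l) (proj_of w, l).
  move=> fs vF vL wF; have [t [z [t0 zF wE]]] := relint_absorb cC fF wF vF.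
  have [fv cv gv _] := patch_point pd p_hyp CD CZ sP qp sqf Bq Bn0 fs (FB _ vF) vL.
  have Fvz a b : 0 <= a -> 0 <= b -> F (a *: val v + b *: z).
    by move=> a0 b0; apply: (faceD cC fF); apply: (faceZ cC fF).
  have pathE r : (1 - r) ^+ 2 *: val v + r ^+ 2 *: val w =
      ((1 - r) ^+ 2 + r ^+ 2 * t) *: val v + r ^+ 2 *: z.
    by rewrite wE scalerDr scalerA addrA -scalerDl.
  have path0 (r : R) : 0 < (1 - r) ^+ 2 + r ^+ 2 * t.
    have [->|r0] := eqVneq r 0; first by rewrite subr0 expr1n expr0n mul0r addr0.
    by rewrite ltr_wpDl ?sqr_ge0 // mulr_gt0 // exprn_even_gt0.
  have path_neq0 r : (1 - r) ^+ 2 *: val v + r ^+ 2 *: val w != 0.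
    rewrite pathE.
    exact: (pointed_cone_comb cC Cl (face_sub fF vF) (face_sub fF zF) (valP v)
      (path0 r) (sqr_ge0 r)).
  have := @proj_path _ _ (L f) l (val v) (val w) (valP v) (valP w) path_neq0.
  have vE (u : nzvec R n) : exist (fun v => is_true (v != 0)) (val u) (valP u) = u.
    exact: val_inj.
  rewrite !vE; apply=> r.
  set u := exist _ _ _.
  have uE : val u = ((1 - r) ^+ 2 + r ^+ 2 * t) *: val v + r ^+ 2 *: z by rewrite /= pathE.
  have zC : closed_hcone p e (r ^+ 2 *: z) := CZ _ _ (sqr_ge0 r) (face_sub fF zF).
  have Bvz a b : 0 <= a -> 0 <= b -> hcone_boundary p e (a *: val v + b *: (r ^+ 2 *: z)).
    by move=> a0 b0; apply: FB; rewrite scalerA; apply: Fvz => //; rewrite mulr_ge0 ?sqr_ge0.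
  have := factor_gradient_transfer pd p_hyp CD CZ qp Bq fs fv cv gv zC Bvz (path0 r).
  rewrite /= -uE => -[fu cu [k k0 gu]].
  apply: (patch_transfer pd p_hyp CD CZ sP qp sqf Bq Bn0 fs (FB _ vF) _ vL fu cu k0 gu).
  by rewrite uE; apply: FB; apply: Fvz; [exact: ltW|exact: sqr_ge0].
have meets (Q : set (projspace R n * projspace R n)) :
    proj_set (relint F) `<=` fst @` Q -> fst @` Q `&` proj_set F !=set0.
  move=> QF; exists (proj_of w0); split; first by apply: QF; exists w0.
  by exists w0; [exact: w0F.1|].
split; last first.
  (* The relative interior has a nonzero point, so a patch covering it meets the face: the
     alternatives exclude each other. *)
  by move=> [[Q [[Qo QF] _]]]; apply; exists Q; split=> //; exact: meets.
have [[Q [Qo QF]]|] := pselect (exists P : set (projspace R n * projspace R n),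
    open_patch C P /\ fst @` P `&` proj_set F !=set0); last by right.
left; exists Q; have [f [v [l [fs vF vL QE]]]] := key Q Qo QF; split.
  by split=> // _ [w wF ->]; exists (proj_of w, l) => //; rewrite QE; exact: cover.
move=> Q' [Qo' QF']; have [f' [v' [l' [fs' vF' vL' QE']]]] := key Q' Qo' (meets _ QF').
(* Both patches reach the fibre over [w0]. There the component and then the functional must agree,
   so the patches have a common point. *)
have cw := cover f v w0 l fs vF vL w0F; have cw' := cover f' v' w0 l' fs' vF' vL' w0F.
have wL : L f (proj_of w0, l) := connected_component_sub cw.
have wL' : L f' (proj_of w0, l') := connected_component_sub cw'.
have ff' : hypersurface f' = hypersurface f.
  have [_ _ H] := wL; apply: H; last by case: wL' => _ [_ [? _]].
  by rewrite aE; exact: (factor_component p_homog p0 sP qp sqf Bq Bn0 fs').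
have LE : L f' = L f by rewrite /L ff'.
rewrite LE in cw' wL' QE'.
have [_ _ _ [c c0 lE]] := patch_point pd p_hyp CD CZ sP qp sqf Bq Bn0 fs w0B wL.
have [_ _ _ [c' c0' lE']] := patch_point pd p_hyp CD CZ sP qp sqf Bq Bn0 fs w0B wL'.
have ll' : l = l' := vec_of_collinear c0 c0' lE lE'.
rewrite QE QE' (same_connected_component cw) (same_connected_component cw').
by rewrite ll'.
Qed.
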